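(* There is an algorithm that, given an instance $(G,L)$ of MLCM-P with $G=(V,E)$, decides in $O(|E|\,|L|^2)$ time whether $(G,L)$ admits a crossing-free line layout satisfying the periphery condition at every port.
   Context: An instance $(G,L)$ consists of a graph $G=(V,E)$ embedded in the plane and a set $L$ of simple paths in $G$ (lines). The endpoints of a line are its terminals, the other vertices its intermediate stations. For an edge $(u,v)$, $L_{uv}$ is the set of lines containing it. Each vertex is a polygon with one side (port) per incident edge, in embedding order. A line layout specifies for every edge $(u,v)$ linear orders $\pi_{uv},\pi_{vu}$ of $L_{uv}$, $\pi_{uv}$ being the clockwise order (w.r.t. the center of $u$'s polygon) in which lines attach to the port of $u$ for $(u,v)$. Lines $l_1,l_2$ have an edge crossing on $(u,v)$ if $l_1$ precedes $l_2$ in both $\pi_{uv}$ and $\pi_{vu}$; with $\pi_u$ the cyclic concatenation of the orders at the ports of $u$ in clockwise order, they have a vertex crossing at $u$ if $\pi_u=(\dots l_1\dots l_2\dots l_1\dots l_2\dots)$. A crossing is unavoidable if it occurs in every layout. A layout is feasible if it has no avoidable vertex crossings; a crossing-free layout is a feasible layout with no edge or vertex crossings. The order $\pi_{uv}$ satisfies the periphery condition if $\pi_{uv}=(l_1\dots l_p\,l_{p+1}\dots l_{q-1}\,l_q\dots l_m)$ where $u$ is a terminal of $l_1,\dots,l_p,l_q,\dots,l_m$ and an intermediate station of $l_{p+1},\dots,l_{q-1}$. MLCM-P asks for a feasible layout satisfying the periphery condition at every port with the minimum number of (edge) crossings. *)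

(* Defs.v *)
From mathcomp Require Import all_boot.

Set Implicit Arguments.
Unset Strict Implicit.
Unset Printing Implicit Defensive.

(* Embedded graphs.  The embedding of a finite simple graph on 'I_n is given by
   its rotation system: nb u lists the neighbours of u in the clockwise order of
   the ports of u (cyclically; the choice of the first port is immaterial). *)

Section Embedding.

Variables (n : nat) (nb : 'I_n -> seq 'I_n).

Definition adj : rel 'I_n := fun u v => v \in nb u.

Definition rotation_system : Prop :=
  [/\ forall u, uniq (nb u), irreflexive adj & symmetric adj].

Definition num_edges : nat :=
  #|[set e : 'I_n * 'I_n | adj e.1 e.2 && (e.1 < e.2)]|.

Definition dart : pred ('I_n * 'I_n) := [pred d | adj d.1 d.2].

(* The dart following d on the boundary of a face: cross the edge, then turn to
   the next port. *)
Definition face_step (d : 'I_n * 'I_n) : 'I_n * 'I_n :=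
  (d.2, next (nb d.2) d.1).

Definition non_isolated : pred 'I_n := [pred u | nb u != [::]].

(* Euler's formula V - E + F = 2 summed over the connected components having at
   least one edge, F counting the face orbits of each component: it holds iff
   every component has genus 0, i.e. iff the rotation system is that of an
   embedding in the plane. *)
Definition planar : Prop :=
  #|non_isolated| + fcard face_step dart =
  num_edges + 2 * n_comp adj non_isolated.

Definition simple_path (l : seq 'I_n) : bool :=
  [&& l != [::], sorted adj l & uniq l].

End Embedding.

(* A line is the vertex sequence of a path, read in one of its two directions;
   since the lines form a set, no path is listed twice, even reversed. *)
Record instance := Instance {
  nV : nat;
  nbrs : 'I_nV -> seq 'I_nV;
  lines : seq (seq 'I_nV);
  nbrs_rotation : rotation_system nbrs;
  nbrs_planar : planar nbrs;
  lines_simple : forall l, l \in lines -> simple_path nbrs l;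
  lines_distinct : pairwise (fun l l' => (l != l') && (l != rev l')) lines
}.

Definition nE (I : instance) : nat := num_edges (@nbrs I).
Definition nL (I : instance) : nat := size (lines I).

Section Layouts.

Variable I : instance.

Notation V := 'I_(nV I).
Notation line := (seq V).

Definition terminal (l : line) (u : V) : bool :=
  (ohead l == Some u) || (ohead (rev l) == Some u).

Definition intermediate (l : line) (u : V) : bool :=
  (u \in l) && ~~ terminal l u.

Definition uses_edge (u v : V) (l : line) : bool :=
  infix [:: u; v] l || infix [:: v; u] l.

Definition edge_lines (u v : V) : seq line :=
  [seq l <- lines I | uses_edge u v l].

(* pi u v is the order pi_{uv}; its value is irrelevant if uv is not an edge. *)
Definition is_layout (pi : V -> V -> seq line) : Prop :=
  forall u v, v \in nbrs u -> perm_eq (pi u v) (edge_lines u v).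

Definition precedes (s : seq line) (l1 l2 : line) : bool :=
  (l2 \in s) && (index l1 s < index l2 s).

Definition edge_crossing (pi : V -> V -> seq line) (u v : V) (l1 l2 : line) :=
  precedes (pi u v) l1 l2 && precedes (pi v u) l1 l2.

Definition vertex_order (pi : V -> V -> seq line) (u : V) : seq line :=
  flatten [seq pi u v | v <- nbrs u].

Definition vertex_crossing (pi : V -> V -> seq line) (u : V) (l1 l2 : line) :=
  l1 != l2 /\
  exists k, subseq [:: l1; l2; l1; l2] (rot k (vertex_order pi u)).

Definition unavoidable_vertex_crossing (u : V) (l1 l2 : line) : Prop :=
  forall pi, is_layout pi -> vertex_crossing pi u l1 l2.

Definition feasible (pi : V -> V -> seq line) : Prop :=
  is_layout pi /\
  forall u l1 l2, vertex_crossing pi u l1 l2 ->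
    unavoidable_vertex_crossing u l1 l2.

Definition crossing_free (pi : V -> V -> seq line) : Prop :=
  [/\ feasible pi,
      forall u v l1 l2, v \in nbrs u -> ~~ edge_crossing pi u v l1 l2 &
      forall u l1 l2, ~ vertex_crossing pi u l1 l2].

Definition periphery_condition (pi : V -> V -> seq line) (u v : V) : Prop :=
  exists s1 s2 s3 : seq line,
    [/\ pi u v = s1 ++ s2 ++ s3,
        all (terminal^~ u) s1, all (intermediate^~ u) s2 &
        all (terminal^~ u) s3].

Definition has_crossing_free_periphery_layout : Prop :=
  exists pi, crossing_free pi /\
    forall u v, v \in nbrs u -> periphery_condition pi u v.

End Layouts.

(* Random-access machine under the uniform cost measure, with addition and
   truncated subtraction as the only arithmetic.  Control flow is structured
   instead of given by jumps, which changes running times only by a constant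
   factor depending on the program: a program mentions finitely many registers
   and each of its expressions has a fixed size. *)

Inductive expr :=
| Const of nat
| Reg of nat
| Mem of expr
| Add of expr & expr
| Sub of expr & expr.

Inductive cmd :=
| Skip
| Assign of nat & expr
| Store of expr & expr
| Seq of cmd & cmd
| If of expr & cmd & cmd
| While of expr & cmd.

Record state := State { regs : nat -> nat; heap : nat -> nat }.

Definition upd (f : nat -> nat) (a v : nat) : nat -> nat :=
  fun b => if b == a then v else f b.

Fixpoint eval (s : state) (e : expr) : nat :=
  match e with
  | Const k => k
  | Reg r => regs s r
  | Mem e1 => heap s (eval s e1)
  | Add e1 e2 => eval s e1 + eval s e2
  | Sub e1 e2 => eval s e1 - eval s e2
  end.

Fixpoint expr_cost (e : expr) : nat :=
  match e with
  | Const _ | Reg _ => 1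
  | Mem e1 => (expr_cost e1).+1
  | Add e1 e2 | Sub e1 e2 => (expr_cost e1 + expr_cost e2).+1
  end.

(* exec c s s' t: started in s, c halts in s' after t elementary steps.
   Guards are true when nonzero. *)
Inductive exec : cmd -> state -> state -> nat -> Prop :=
| ExecSkip s : exec Skip s s 1
| ExecAssign r e s :
    exec (Assign r e) s (State (upd (regs s) r (eval s e)) (heap s))
      (expr_cost e).+1
| ExecStore e1 e2 s :
    exec (Store e1 e2) s (State (regs s) (upd (heap s) (eval s e1) (eval s e2)))
      (expr_cost e1 + expr_cost e2).+1
| ExecSeq c1 c2 s s1 s2 t1 t2 :
    exec c1 s s1 t1 -> exec c2 s1 s2 t2 -> exec (Seq c1 c2) s s2 (t1 + t2)
| ExecIfTrue e c1 c2 s s' t :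
    eval s e != 0 -> exec c1 s s' t ->
    exec (If e c1 c2) s s' (expr_cost e + t).+1
| ExecIfFalse e c1 c2 s s' t :
    eval s e = 0 -> exec c2 s s' t ->
    exec (If e c1 c2) s s' (expr_cost e + t).+1
| ExecWhileTrue e c s s1 s2 t1 t2 :
    eval s e != 0 -> exec c s s1 t1 -> exec (While e c) s1 s2 t2 ->
    exec (While e c) s s2 (expr_cost e + t1 + t2).+1
| ExecWhileFalse e c s :
    eval s e = 0 -> exec (While e c) s s (expr_cost e).+1.

(* Adjacency-array (compressed sparse row) format of a list of lists: the start
   offsets of the rows, closed by the total length, then the rows themselves. *)
Definition csr (ss : seq (seq nat)) : seq nat :=
  0 :: scanl addn 0 (shape ss) ++ flatten ss.

Definition encode (I : instance) : seq nat :=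
  [:: nV I; nE I; nL I]
    ++ csr [seq map val (nbrs u) | u <- enum 'I_(nV I)]
    ++ csr [seq map val l | l <- lines I].

Definition input_state (w : seq nat) : state :=
  State (fun=> 0) (fun a => nth 0 w a).

(* One program and one constant serve all instances; the answer is read in
   register 0.  The successor only matters when T I = 0, where a constant number
   of steps is allowed. *)
Definition decidable_in_time (T : instance -> nat) (Q : instance -> Prop) :=
  exists (p : cmd) (c : nat), forall I : instance,
    exists (s : state) (t : nat),
      [/\ exec p (input_state (encode I)) s t,
          t <= c * (T I).+1 &
          regs s 0 != 0 <-> Q I].

(* Main.v *)
Require Import Defs.
From mathcomp Require Import all_boot.
From mathcomp Require Import zify.
From Stdlib Require Import Classical ClassicalChoice.

(* Two lines of a crossing-free layout see each other only through a relative order at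
   every shared port.  It flips along a shared edge and across a vertex where both
   lines stay together; where they diverge it is dictated by the rotation; where
   exactly one of them ends it is given by the side, left or right of the lines passing
   through, on which that terminal is attached; where both end nothing is required.
   These pairwise constraints do not make the orders transitive, but a cyclic triple
   forces a line p that is contained in two others, one ending with p at x and the other
   one at y, and that has the same side at x and y.  Changing the side of p at x gives
   a solution with fewer lines of that kind, so a solution minimizing their number
   comes from a layout.

   The constraints of a pair of lines are equations x + y = c over the field with two
   elements between the sides of the 2|L| terminals.  Walking along one of the two lines
   they are read off in time O(|E|), since a vertex costs its degree, and a union-find
   structure with parities decides the system: at most 2|L| + 1 merging passes of
   O(|L|) steps each. *)

Set Implicit Arguments.
Unset Strict Implicit.
Unset Printing Implicit Defensive.

(** * Sequences and equations *)

(** A cyclic triple survives every vertex where its lines stay together. A line that ends alone or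
    turns off alone compares in the same way with the two others, which a cycle forbids, and three
    lines that part at one vertex are ordered linearly by the rotation. So a common stretch of the
    triple ends only where two of the three lines end; the two pairs found at its ends share a line
    [p], and two distinct lines cannot both be the stretch. Moving [p] to the other side at [x] only
    affects lines that pass [x] along [p]; these contain [p] and end with it at [y], where their
    order is free. Hence a system that speaks of pairs only decides the problem, and the program
    never looks for triples.

    The time bound does not mention the number of vertices, which isolated vertices make arbitrarily
    large. Therefore the arrays indexed by vertices are neither cleared nor scanned, stored
    positions are validated when read, and the cases without edges or without lines are answered
    before any loop. *)

Section Sequences.

Variable T : eqType.
Implicit Types (s t : seq T) (x y : T).

Lemma infix_pair_index s x y : uniq s ->
  infix [:: x; y] s = [&& x \in s, y \in s & index y s == (index x s).+1].
Proof.
move=> Us; apply/idP/idP => [/infixP[p [q Es]]|/and3P[xs ys /eqP ixy]].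
  move: Us; rewrite Es !mem_cat !inE !eqxx !orbT /= cat_uniq /= !inE !negb_or.
  case/and5P=> _ /and3P[/= xp yp _] /andP[xy _] _ _.
  by rewrite !index_cat (negPf xp) (negPf yp) /= eqxx (negPf xy) eqxx addn0 addn1.
have iy : (index x s).+1 < size s by rewrite -ixy index_mem.
apply/infixP; exists (take (index x s) s), (drop (index x s).+2 s).
rewrite -[LHS](cat_take_drop (index x s)) (drop_nth x) ?index_mem // nth_index //.
by rewrite (drop_nth x) // -ixy nth_index.
Qed.

Lemma index_filter_ltn (p : pred T) s x y : p x -> p y ->
  (index x [seq z <- s | p z] < index y [seq z <- s | p z]) =
  (index x s < index y s).
Proof.
move=> px py; elim: s => //= z s IHs; case: ifP => pz /=.
  by case: (z == x); case: (z == y).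
have /negPf-> : z != x by apply: contraFneq pz => ->.
by have /negPf-> : z != y by apply: contraFneq pz => ->.
Qed.

Lemma filter_pred2_uniq s x y : uniq s -> x != y ->
  [seq z <- s | pred2 x y z] =
  if x \in s then
    if y \in s then if index x s < index y s then [:: x; y] else [:: y; x]
    else [:: x]
  else if y \in s then [:: y] else [::].
Proof.
move=> + xy; elim: s => //= z s IHs /andP[zNs Us]; rewrite (IHs Us) !inE.
have [zx|zx] /= := eqVneq z x.
  by subst z; rewrite (negPf xy) (negPf zNs) (eq_sym y) (negPf xy); case: (y \in s).
have [zy|zy] /= := eqVneq z y.
  by subst z; rewrite (negPf zNs) /=; case: (x \in s).
by [].
Qed.

Lemma filter_rot (p : pred T) k s :
  exists k', [seq z <- rot k s | p z] = rot k' [seq z <- s | p z].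
Proof.
exists (size [seq z <- take k s | p z]).
by rewrite -{3}(cat_take_drop k s) filter_cat rot_size_cat -filter_cat.
Qed.

(* With at most two occurrences of each letter, an alternating cyclic subsequence
   must consist of all occurrences of both letters. *)
Lemma subseq_rot_alternating s x y : x != y ->
  size [seq z <- s | pred2 x y z] <= 4 ->
  (exists k, subseq [:: x; y; x; y] (rot k s)) ->
  [seq z <- s | pred2 x y z] = [:: x; y; x; y] \/
  [seq z <- s | pred2 x y z] = [:: y; x; y; x].
Proof.
move=> xy sz [k sub].
have: subseq [:: x; y; x; y] [seq z <- rot k s | pred2 x y z].
  by rewrite subseq_filter /= !eqxx orbT.
have [k' ->] := filter_rot (pred2 x y) k s.
move: [seq _ <- s | _] sz => t sz {}sub.
have [_] := size_subseq_leqif sub; rewrite size_rot.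
have := size_subseq sub; rewrite size_rot /= => sz4.
have -> : (4 == size t) = true by lia.
move/esym/eqP => E; move: E.
case: t sz sz4 {sub} => [|a [|b [|c [|d [|e t]]]]] //= _ _.
case: k' => [|[|[|[|k']]]]; rewrite /rot /=.
- by case=> <- <- <- <-; left.
- by case=> <- <- <- <-; right.
- by case=> <- <- <- <-; left.
- by case=> <- <- <- <-; right.
by case=> <- <- <- <-; left.
Qed.

Lemma flatten_map_filter (U : eqType) (F : U -> seq T) (p : pred U) r :
  (forall z, ~~ p z -> F z = [::]) ->
  flatten (map F r) = flatten (map F [seq z <- r | p z]).
Proof.
move=> F0; elim: r => //= z r ->; case: ifP => //= /negbT/F0 ->.
by [].
Qed.

Lemma perm2_cases s x y : perm_eq s [:: x; y] -> s = [:: x; y] \/ s = [:: y; x].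
Proof.
move=> E; have := perm_size E; case: s E => [|a [|b [|]]] //= E _.
have := perm_mem E a; rewrite !inE eqxx => /esym/orP[] /eqP ?; subst a.
  by move: E; rewrite perm_cons => /perm_mem/(_ b); rewrite !inE eqxx;
    move/esym/eqP=> ->; left.
move: E; rewrite -[perm_eq _ _]/(perm_eq _ ([:: x] ++ [:: y])) perm_sym perm_catC.
by rewrite perm_cons => /perm_mem/(_ b); rewrite !inE eqxx => /eqP ->; right.
Qed.

End Sequences.

Ltac index_lia :=
  repeat match goal with H : context [index _ _] |- _ => revert H end;
  repeat match goal with |- context [index ?x ?s] => move: (index x s) end;
  repeat match goal with |- context [size ?s] => move: (size s) end;
  lia.

(** For distinct arguments one or two of the comparisons hold; two hold exactly when [x], [y], [z]
    are met in this order on a circle, wherever it is cut open. *)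
Definition cyclic3 (x y z : nat) : bool := 1 < (x < y) + (y < z) + (z < x).

(* [(i, c)] stands for variable [i] plus [c], and [(i, j, c)] for the equation
   [i + j = c]. *)
Definition literal := (nat * bool)%type.
Definition equation := (nat * nat * bool)%type.

(* While line [b] is followed, a truth value tells whether line [a] precedes it at the
   port through which [b] leaves the previous vertex.  [Start] and [Stop] fix it at the
   two ends of a common stretch; [Meet c] is a vertex where the lines share no edge,
   [c] telling whether they cross there. *)
Inductive event :=
| Idle
| Cont
| Start of literal
| Stop of literal
| Meet of bool.

(** * Truth of the equations emitted by a walk *)

Section Walk.

Variable f : nat -> bool.

Definition lit_val (x : literal) : bool := f x.1 (+) x.2.

(* Node 0 stands for no variable at all: equations mentioning it are void. *)
Definition sat (q : equation) : bool :=
  (q.1.1 != 0) ==> (q.1.2 != 0) ==> (f q.1.1 (+) f q.1.2 == q.2).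

End Walk.

(** [Stop x] relates the two ends of one edge, where the order is reversed, hence the negation. The
    equation [(1, 1, c)] reads 0 = [c]: a crossing at a meeting makes the system unsatisfiable. *)
Definition walk_step (cur : literal) (e : event) : literal * equation :=
  match e with
  | Idle | Cont => (cur, (0, 0, false))
  | Start x => (x, (0, 0, false))
  | Stop x => ((0, false), (cur.1, x.1, ~~ (cur.2 (+) x.2)))
  | Meet c => (cur, (1, 1, c))
  end.

Fixpoint walk_eqs (cur : literal) (es : seq event) : seq equation :=
  if es is e :: es' then (walk_step cur e).2 :: walk_eqs (walk_step cur e).1 es'
  else [::].

Section WalkSat.

Variable f : nat -> bool.

(** A literal with node 0 imposes nothing and leaves the value free; this happens where both lines
    end. *)
Fixpoint chain (b : bool) (es : seq event) : Prop :=
  if es is e :: es' then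
    match e with
    | Idle | Cont => chain b es'
    | Start x => exists b', (x.1 <> 0 -> b' = lit_val f x) /\ chain b' es'
    | Stop x => (x.1 <> 0 -> b = ~~ lit_val f x) /\ exists b', chain b' es'
    | Meet c => c = false /\ chain b es'
    end
  else True.

Lemma walk_eqs_chain cur es : all (sat f) (walk_eqs cur es) <->
  exists b, (cur.1 <> 0 -> b = lit_val f cur) /\ chain b es.
Proof.
elim: es cur => [|e es IHes] cur /=.
  by split=> // _; exists (lit_val f cur).
case: e => [||x|x|c] /=; rewrite ?IHes //.
- split=> [[b' [xb' C]]|[b [_ [b' [xb' C]]]]].
    by exists (lit_val f cur); split=> //; exists b'.
  by exists b'.
- split=> [/andP[sx /IHes[b' [_ C]]]|[b [curb [xb [b' C]]]]]; last first.
    apply/andP; split; last by apply/IHes; exists b'.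
    apply/implyP=> /= /eqP /curb E1; apply/implyP=> /eqP /xb; rewrite E1 /lit_val.
    by case: (f _); case: (f _); case: (cur.2); case: (x.2).
  (* An unknown current value may be chosen to be the one that [Stop] asks for. *)
  have [c0|c0] := eqVneq cur.1 0.
    by exists (~~ lit_val f x); split=> [|]; [rewrite c0 | split=> //; exists b'].
  exists (lit_val f cur); split=> //; split; last by exists b'.
  move=> /eqP x0; move: sx; rewrite /sat /= c0 x0 /lit_val /= => /eqP.
  by case: (f _); case: (f _); case: (cur.2); case: (x.2).
rewrite /sat /= addbb -[false == c]/(false == c).
split=> [/andP[/eqP<- /IHes[b [cb C]]]|[b [cb [-> C]]]]; first by exists b.
by rewrite eqxx; apply/IHes; exists b.
Qed.

Definition event_ok (e : event) (a b : bool) : Prop :=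
  match e with
  | Idle | Cont => b = a
  | Start x => x.1 <> 0 -> b = lit_val f x
  | Stop x => x.1 <> 0 -> a = ~~ lit_val f x
  | Meet c => c = false /\ b = a
  end.

(** The values chosen one by one in [chain] are collected in a sequence [x], where [x i] is the
    value before event [i]. *)
Lemma chain_events (ev : nat -> event) j n b : chain b [seq ev i | i <- iota j n] <->
  exists x : nat -> bool, x j = b /\
    forall i, j <= i < j + n -> event_ok (ev i) (x i) (x i.+1).
Proof.
elim: n j b => [|n IHn] j b /=.
  by split=> // _; exists (fun=> b); split=> // i; rewrite addn0; lia.
have ext b' : (exists x : nat -> bool, x j.+1 = b' /\
      forall i, j.+1 <= i < j.+1 + n -> event_ok (ev i) (x i) (x i.+1)) ->
    event_ok (ev j) b b' -> exists x : nat -> bool, x j = b /\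
      forall i, j <= i < j + n.+1 -> event_ok (ev i) (x i) (x i.+1).
  move=> [x [xj H]] ok; exists (fun i => if i == j then b else x i).
  rewrite eqxx; split=> // i /andP[ji ijn]; rewrite (gtn_eqF (_ : j < i.+1)) //.
  case: (eqVneq i j) => [->|ij]; first by rewrite xj.
  by apply: H; move: ji ijn ij; clear; lia.
have res x : (forall i, j <= i < j + n.+1 -> event_ok (ev i) (x i) (x i.+1)) ->
    event_ok (ev j) (x j) (x j.+1) /\ chain (x j.+1) [seq ev i | i <- iota j.+1 n].
  move=> H; split; first by apply: H; clear; lia.
  by apply/IHn; exists x; split=> // i iI; apply: H; move: iI; clear; lia.
case E: (ev j) => [||y|y|c].
- split=> [/IHn/ext|[x [xj /res[]]]]; rewrite E; first exact.
  by move=> /= -> ; rewrite xj.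
- split=> [/IHn/ext|[x [xj /res[]]]]; rewrite E; first exact.
  by move=> /= -> ; rewrite xj.
- split=> [[b' [yb' /IHn/ext]]|[x [xj /res[]]]]; rewrite E; first exact.
  by move=> /= yb' C; exists (x j.+1).
- split=> [[yb [b' /IHn/ext]]|[x [xj /res[]]]]; rewrite E; first exact.
  by move=> /= yb C; rewrite -xj; split=> //; exists (x j.+1).
split=> [[c0 /IHn/ext]|[x [xj /res[]]]]; rewrite E; first exact.
by move=> /= [-> ->]; rewrite xj.
Qed.

Lemma walk_eqs_sat (ev : nat -> event) n :
  all (sat f) (walk_eqs (0, false) [seq ev i | i <- iota 0 n]) <->
  exists x : nat -> bool, forall i, i < n -> event_ok (ev i) (x i) (x i.+1).
Proof.
rewrite walk_eqs_chain; split=> [[b [_ /chain_events[x [_ H]]]]|[x H]]; first by exists x.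
by exists (x 0); split=> //; apply/chain_events; exists x; split=> // i /andP[_ /H].
Qed.

End WalkSat.

(* Neighbours on a path are coded by their successor, 0 meaning that there is none. *)
Definition pcode (l : seq nat) (u : nat) : nat :=
  if (u \in l) && (0 < index u l) then (nth 0 l (index u l).-1).+1 else 0.

Definition ncode (l : seq nat) (u : nat) : nat :=
  if (u \in l) && ((index u l).+1 < size l) then (nth 0 l (index u l).+1).+1 else 0.

Definition other (v p n : nat) : nat := if v == p then n else p.

(* At an end of a common stretch, [q1] and [q2] code where the two lines go on. *)
Definition split_literal (na nb q1 q2 : nat) (c : bool) : literal :=
  if q1 == 0 then if q2 == 0 then (0, false) else (na, true)
  else if q2 == 0 then (nb, false) else (1, c).

(** * Events at a vertex and the system of equations *)

Section VertexEvent.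

Variables (rk : nat -> nat) (na nb p1 n1 p2 n2 : nat).

(** Code 0 is excluded, since two missing neighbours would otherwise count as a common one. *)
Definition shares (v : nat) : bool := (v != 0) && ((v == p1) || (v == n1)).

(** Where a line ends, its predecessor code is 0 exactly at the first vertex, so [p1 != 0] and
    [p2 != 0] select the variable of the right end. *)
Definition end_literal (v q2 : nat) : literal :=
  split_literal (na + (p1 != 0)) (nb + (p2 != 0)) (other v p1 n1) q2
    (cyclic3 (rk v) (rk q2) (rk (other v p1 n1))).

(** The walk follows the second line from [p2] to [n2]. With both ports shared, the reversals along
    the edge and at the vertex cancel, so the value is carried on. A crossing of lines without a
    common port needs two ports of each. *)
Definition vertex_event : event :=
  if shares p2 then if shares n2 then Cont else Stop (end_literal p2 n2)
  else if shares n2 then Start (end_literal n2 p2)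
  else if [&& p1 != 0, n1 != 0, p2 != 0 & n2 != 0] then
    Meet (cyclic3 (rk p1) (rk p2) (rk n1) != cyclic3 (rk p1) (rk n2) (rk n1))
  else Idle.

End VertexEvent.

Definition pair_events (rk : nat -> nat -> nat) (na nb : nat) (a b : seq nat) :
    seq event :=
  [seq vertex_event (rk u) na nb (pcode a u) (ncode a u) (pcode b u) (ncode b u)
    | u <- b].


Definition ranking (rot : seq (seq nat)) (u c : nat) : nat :=
  index c.-1 (nth [::] rot u).

(* Variables 2a+2 and 2a+3 are the sides of line [a] at its first and last vertex;
   variable 1 stands for the constant [false]. *)
Definition pair_eqs (rot ls : seq (seq nat)) (a b : nat) : seq equation :=
  walk_eqs (0, false)
    (pair_events (ranking rot) (a + a).+2 (b + b).+2 (nth [::] ls a) (nth [::] ls b)).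

Definition line_eqs (rot ls : seq (seq nat)) (a : nat) : seq equation :=
  flatten [seq pair_eqs rot ls a b | b <- iota a.+1 (size ls - a.+1)].

Definition all_eqs (rot ls : seq (seq nat)) : seq equation :=
  flatten [seq line_eqs rot ls a | a <- iota 0 (size ls)].

Definition satisfiable (qs : seq equation) : Prop :=
  exists f : nat -> bool, f 1 = false /\ all (sat f) qs.

Lemma all_flatten_map (T U : Type) (p : pred U) (F : T -> seq U) (s : seq T) :
  all p (flatten (map F s)) = all (fun x => all p (F x)) s.
Proof. by elim: s => //= x s IHs; rewrite all_cat IHs. Qed.

Lemma all_eqs_sat f rot ls : all (sat f) (all_eqs rot ls) <->
  forall a b, a < b -> b < size ls -> all (sat f) (pair_eqs rot ls a b).
Proof.
rewrite all_flatten_map; split=> [/allP H a b ab bs|H].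
  have /H : a \in iota 0 (size ls) by rewrite mem_iota add0n (ltn_trans ab).
  rewrite /= all_flatten_map => /allP; apply; rewrite mem_iota ab /=.
  by rewrite subnKC // (ltn_trans ab).
apply/allP => a; rewrite mem_iota add0n => /= a_s; rewrite all_flatten_map.
by apply/allP => b; rewrite mem_iota subnKC // => /andP[]; apply: H.
Qed.


(** * Layouts and solutions *)

Section Instance.

Variable I : instance.

Notation V := 'I_(nV I).
Notation line := (seq V).
Implicit Types (l m n p q : line) (u v w : V) (pi : V -> V -> seq line).

Lemma line_uniq l : l \in lines I -> uniq l.
Proof. by move/lines_simple/and3P=> []. Qed.

Lemma lines_uniq : uniq (lines I).
Proof.
have := lines_distinct I; rewrite uniq_pairwise.
by apply: sub_pairwise => l m /andP[].
Qed.

Lemma lines_not_rev l m : l \in lines I -> m \in lines I -> l != m -> l != rev m.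
Proof.
have := lines_distinct I; elim: (lines I) => //= x s IHs /andP[/allP xs Ps].
rewrite !inE => /orP[/eqP->|ls] /orP[/eqP->|ms]; rewrite ?eqxx // => lm.
- by have /andP[] := xs _ ms.
- by rewrite -(can_eq revK) revK eq_sym; have /andP[] := xs _ ls.
exact: IHs.
Qed.

Lemma uses_edge_index u v l : uniq l ->
  uses_edge u v l = [&& u \in l, v \in l &
    (index v l == (index u l).+1) || (index u l == (index v l).+1)].
Proof.
move=> Ul; rewrite /uses_edge !infix_pair_index //.
by case: (u \in l); case: (v \in l).
Qed.

Lemma uses_edgeC u v l : uses_edge u v l = uses_edge v u l.
Proof. exact: orbC. Qed.

Lemma terminal_index l u : uniq l ->
  terminal l u = (u \in l) && ((index u l == 0) || ((index u l).+1 == size l)).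
Proof.
move=> Ul; rewrite /terminal; case: (lastP l) Ul => [|s y] // Ul.
rewrite rev_rcons /= size_rcons eqSS.
have -> : (ohead (rcons s y) == Some u) = (head y s == u) by case: (s).
move: Ul; rewrite rcons_uniq mem_rcons -cats1 index_cat inE => /andP[ys Us].
case: (boolP (u \in s)) => [us|uNs]; last first.
  have -> : (Some y == Some u) = (y == u) by [].
  case: (eqVneq y u) => [<-|yu]; first by rewrite /= !eqxx addn0 eqxx !orbT.
  rewrite orbF /=; apply/eqP => E; move: uNs yu; rewrite -E.
  by case: (s) => [|a s'] /=; rewrite ?eqxx // inE eqxx.
rewrite orbT /=; have /negPf yu : y != u by apply: contraNneq ys => ->.
have -> : (Some y == Some u) = (y == u) by [].
rewrite yu (_ : index u s == size s = false) ?orbF; last first.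
  by have := us; rewrite -index_mem => /ltn_eqF.
by case: (s) us => //= a s' _; case: eqP.
Qed.

Lemma uses_edge_mem u v l : uses_edge u v l -> u \in l.
Proof.
by case/orP=> /infixP[p [q ->]]; rewrite !mem_cat !inE eqxx ?orbT.
Qed.

Lemma uses_edge_adj u v l : l \in lines I -> uses_edge u v l -> v \in nbrs u.
Proof.
move=> lI; have /and3P[_ Sl _] := lines_simple lI; have [_ _ sym] := nbrs_rotation I.
case/orP=> /infixP[p [q El]]; move: Sl; rewrite El => /cat_sorted2[_] /=.
  by case/andP.
by case/andP; rewrite sym.
Qed.

Lemma uses_edge_neq u v l : l \in lines I -> uses_edge u v l -> u != v.
Proof.
move=> lI; rewrite uses_edge_index ?line_uniq // => /and3P[_ _ ix].
by apply/eqP=> uv; move: ix; rewrite uv; lia.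
Qed.

Lemma line_terminalVintermediate l u v : uses_edge u v l ->
  intermediate l u = ~~ terminal l u.
Proof. by move/uses_edge_mem; rewrite /intermediate => ->. Qed.

Lemma index_eq l u v : u \in l -> index u l = index v l -> u = v.
Proof.
move=> ul E; have vl : v \in l by rewrite -index_mem -E index_mem.
exact: (index_inj u ul vl E).
Qed.

Lemma terminal_port l u v w : l \in lines I -> terminal l u ->
  uses_edge u v l -> uses_edge u w l -> v = w.
Proof.
move=> lI; have Ul := line_uniq lI; rewrite terminal_index // !uses_edge_index //.
move=> /andP[_ t] /and3P[_ vl ev] /and3P[_ wl ew].
apply: (index_eq vl); move: vl wl; rewrite -!index_mem.
index_lia.
Qed.

Lemma ports_le2 l u v w z : l \in lines I -> v != w ->
  uses_edge u v l -> uses_edge u w l -> uses_edge u z l -> z = v \/ z = w.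
Proof.
move=> lI vw; have Ul := line_uniq lI; rewrite !uses_edge_index //.
move=> /and3P[_ vl ev] /and3P[_ wl ew] /and3P[_ zl ez].
have vwi : index v l != index w l by apply: contra vw => /eqP/(index_eq vl)->.
have [E|E] : index z l = index v l \/ index z l = index w l by index_lia.
  by left; apply: index_eq zl E.
by right; apply: index_eq zl E.
Qed.

Lemma intermediate_port l u v : uniq l -> intermediate l u ->
  uses_edge u v l -> exists2 w, w != v & uses_edge u w l.
Proof.
move=> Ul; rewrite /intermediate terminal_index //.
case/andP=> ul; rewrite ul /= negb_or !uses_edge_index // => /andP[i0 isz].
case/and3P=> _ vl ev; have szu := ul; rewrite -index_mem in szu; move: ev.
have nthP i : i < size l -> (nth u l i \in l) /\ index (nth u l i) l = i.
  by move=> il; rewrite mem_nth // index_uniq.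
case/orP => /eqP ev.
  have [] := nthP (index u l).-1; first by index_lia.
  move=> nl ni; exists (nth u l (index u l).-1); first by apply/eqP=> E; move: ni;
    rewrite E; index_lia.
  by rewrite uses_edge_index // ul nl ni; index_lia.
have [] := nthP (index u l).+1; first by index_lia.
move=> nl ni; exists (nth u l (index u l).+1); first by apply/eqP=> E; move: ni;
  rewrite E; index_lia.
by rewrite uses_edge_index // ul nl ni; index_lia.
Qed.

Lemma nbrs_uniq u : uniq (nbrs u).
Proof. by have [] := nbrs_rotation I. Qed.

Lemma index_nbrs_neq u v w : v \in nbrs u -> w \in nbrs u -> v != w ->
  index v (nbrs u) != index w (nbrs u).
Proof. by move=> vu wu; apply: contra => /eqP/(index_inj v vu wu)->. Qed.


(** * Vertex crossings of two lines in terms of their ports *)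

Definition turn u x y z : bool :=
  cyclic3 (index x (nbrs u)) (index y (nbrs u)) (index z (nbrs u)).

(** A decidable form of [vertex_crossing], symmetric in the two lines: a line has at most two ports
    at a vertex, so a crossing uses every occurrence of both. *)
Definition alternates pi u l m : bool :=
  [seq z <- vertex_order pi u | pred2 l m z] \in
    [:: [:: l; m; l; m]; [:: m; l; m; l]].

(** What the port of [u] towards [v] contributes to the vertex order restricted to [l] and [m]. *)
Definition port_block pi u l m v : seq line :=
  if uses_edge u v l then
    if uses_edge u v m then
      if precedes (pi u v) l m then [:: l; m] else [:: m; l]
    else [:: l]
  else if uses_edge u v m then [:: m] else [::].

Lemma mem_layout pi u v l : is_layout pi -> v \in nbrs u ->
  (l \in pi u v) = (l \in lines I) && uses_edge u v l.
Proof. by move=> L vu; rewrite (perm_mem (L u v vu)) mem_filter andbC. Qed.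

Lemma layout_uniq pi u v : is_layout pi -> v \in nbrs u -> uniq (pi u v).
Proof.
by move=> L vu; rewrite (perm_uniq (L u v vu)) filter_uniq // lines_uniq.
Qed.

Section TwoLines.

Variables (pi : V -> V -> seq line) (u : V) (l m : line).
Hypotheses (L : is_layout pi) (lI : l \in lines I) (mI : m \in lines I).
Hypothesis lm : l != m.

Lemma filter_vertex_order : [seq z <- vertex_order pi u | pred2 l m z] =
  flatten [seq port_block pi u l m v |
    v <- nbrs u & uses_edge u v l || uses_edge u v m].
Proof.
rewrite filter_flatten -map_comp -flatten_map_filter; last first.
  by move=> v; rewrite negb_or /port_block => /andP[/negPf-> /negPf->].
congr flatten; apply/eq_in_map => v vu /=.
rewrite filter_pred2_uniq ?layout_uniq // !mem_layout // lI mI /= /port_block.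
rewrite /precedes mem_layout // mI /=.
by case: (uses_edge u v l) => //; case: (uses_edge u v m).
Qed.

Lemma count_ports_vertex_order n : n \in lines I ->
  count_mem n (vertex_order pi u) = count (fun v => uses_edge u v n) (nbrs u).
Proof.
move=> nI; rewrite count_flatten -map_comp -sumn_count; congr sumn.
apply/eq_in_map => v vu /=.
by rewrite count_uniq_mem ?layout_uniq // mem_layout // nI.
Qed.

End TwoLines.

Lemma count_ports_le2 u l : l \in lines I ->
  count (fun v => uses_edge u v l) (nbrs u) <= 2.
Proof.
move=> lI; rewrite -size_filter; case E: [seq _ <- _ | _] => [|x [|y [|z r]]] //.
have U : uniq [:: x, y, z & r] by rewrite -E filter_uniq // nbrs_uniq.
have P t : t \in [:: x, y, z & r] -> uses_edge u t l.
  by rewrite -E mem_filter => /andP[].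
move: U; rewrite /= !inE !negb_or => /andP[/and3P[xy xz _] /andP[/andP[yz _] _]].
have xl : uses_edge u x l by apply: P; rewrite !inE eqxx.
have yl : uses_edge u y l by apply: P; rewrite !inE eqxx orbT.
have zl : uses_edge u z l by apply: P; rewrite !inE eqxx !orbT.
by have [E'|E'] := ports_le2 lI xy xl yl zl; move: xz yz; rewrite E' eqxx.
Qed.

Lemma count_ports2 u l : l \in lines I ->
  1 < count (fun v => uses_edge u v l) (nbrs u) ->
  exists v w, [/\ v != w, uses_edge u v l & uses_edge u w l].
Proof.
move=> lI; rewrite -size_filter; case E: [seq _ <- _ | _] => [|x [|y r]] // _.
have U : uniq [:: x, y & r] by rewrite -E filter_uniq // nbrs_uniq.
have P t : t \in [:: x, y & r] -> uses_edge u t l.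
  by rewrite -E mem_filter => /andP[].
exists x, y; split; first by move: U; rewrite /= inE negb_or => /andP[/andP[]].
  by apply: P; rewrite !inE eqxx.
by apply: P; rewrite !inE eqxx orbT.
Qed.

Lemma size_filter_pred2 (T : eqType) (l m : T) (s : seq T) : l != m ->
  size [seq z <- s | pred2 l m z] = count_mem l s + count_mem m s.
Proof.
move=> lm; rewrite size_filter -count_predUI -[LHS]addn0; congr addn; apply/esym/eqP;
  rewrite -leqn0 leqNgt -has_count.
by apply/hasPn => z _ /=; case: (eqVneq z l) => [->|] //; rewrite (negPf lm).
Qed.

Lemma vertex_crossing_alternates pi u l m : is_layout pi ->
  vertex_crossing pi u l m ->
  [/\ l \in lines I, m \in lines I, l != m & alternates pi u l m].
Proof.
move=> L [lm [k sub]].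
have in_lines n : n \in [:: l; m; l; m] -> n \in lines I.
  move/(mem_subseq sub); rewrite mem_rot => /flatten_mapP[v vu].
  by rewrite mem_layout // => /andP[].
have lI : l \in lines I by rewrite in_lines // !inE eqxx.
have mI : m \in lines I by rewrite in_lines // !inE eqxx orbT.
split=> //; rewrite /alternates !inE.
have := @subseq_rot_alternating _ (vertex_order pi u) l m lm.
rewrite size_filter_pred2 // !count_ports_vertex_order //.
have := count_ports_le2 u lI; have := count_ports_le2 u mI.
move=> cm cl H; case: H => [||->|->]; rewrite ?eqxx ?orbT //; last by exists k.
by rewrite -[4]/(2 + 2) leq_add.
Qed.

Lemma alternates_vertex_crossing pi u l m : l != m -> alternates pi u l m ->
  vertex_crossing pi u l m \/ vertex_crossing pi u m l.
Proof.
move=> lm; rewrite /alternates !inE => /orP[] /eqP E.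
  by left; split=> //; exists 0; rewrite rot0 -E filter_subseq.
by right; split; rewrite 1?eq_sym //; exists 0; rewrite rot0 -E filter_subseq.
Qed.

Lemma alternates_ports pi u l m : is_layout pi -> l \in lines I -> m \in lines I ->
  l != m -> alternates pi u l m ->
  (exists v w, [/\ v != w, uses_edge u v l & uses_edge u w l]) /\
  (exists v w, [/\ v != w, uses_edge u v m & uses_edge u w m]).
Proof.
move=> L lI mI lm A.
have c n : n \in lines I -> pred2 l m n -> 1 < count (fun v => uses_edge u v n) (nbrs u).
  move=> nI pn; rewrite -(count_ports_vertex_order u L) //.
  have -> : count_mem n (vertex_order pi u) =
            count_mem n [seq z <- vertex_order pi u | pred2 l m z].
    rewrite count_filter; apply: eq_count => z /=.
    by case: eqP => // ->; rewrite -[_ || _]/(pred2 l m n) pn.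
  have ml : (m == l) = false by rewrite eq_sym (negPf lm).
  move: A; rewrite /alternates !inE => /orP[] /eqP->;
  by move: pn => /= /orP[] /eqP->; rewrite /= ?eqxx ?ml ?(negPf lm).
by split; apply: count_ports2 => //; apply: c; rewrite //= eqxx ?orbT.
Qed.


Section AlternationCases.

Variables (pi : V -> V -> seq line) (u : V) (l m : line).
Hypotheses (L : is_layout pi) (lI : l \in lines I) (mI : m \in lines I).
Hypothesis lm : l != m.

Lemma port_not_used n a b c : n \in lines I -> a != b ->
  uses_edge u a n -> uses_edge u b n -> c != a -> c != b -> uses_edge u c n = false.
Proof.
move=> nI ab ua ub ca cb; apply/negP=> uc.
by have [E|E] := ports_le2 nI ab ua ub uc; move: ca cb; rewrite E eqxx.
Qed.

Let used := [seq v <- nbrs u | uses_edge u v l || uses_edge u v m].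

Lemma used_uniq : uniq used.
Proof. by rewrite filter_uniq // nbrs_uniq. Qed.

Lemma mem_used v : (v \in used) = uses_edge u v l || uses_edge u v m.
Proof.
rewrite mem_filter; case: (boolP (uses_edge u v l)) => [/(uses_edge_adj lI)->|_] //=.
by case: (boolP (uses_edge u v m)) => [/(uses_edge_adj mI)->|_].
Qed.

Lemma turn_used a b c : a \in used -> b \in used -> c \in used ->
  turn u a b c = cyclic3 (index a used) (index b used) (index c used).
Proof.
by rewrite !mem_used => ua ub uc; rewrite /turn /cyclic3 !index_filter_ltn.
Qed.

(** Only the ports [a] and [b] contribute, with a block of two letters each; the four letters
    alternate exactly when the blocks are equal. *)
Lemma alternates_parallel a b : a != b ->
  uses_edge u a l -> uses_edge u b l -> uses_edge u a m -> uses_edge u b m ->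
  alternates pi u l m = (precedes (pi u a) l m == precedes (pi u b) l m).
Proof.
move=> ab al bl am bm; rewrite /alternates filter_vertex_order // -/used.
have P : perm_eq used [:: a; b].
  apply: uniq_perm used_uniq _ _; first by rewrite /= inE ab.
  move=> v; rewrite mem_used !inE; case: (eqVneq v a) => [->|va]; first by rewrite al.
  case: (eqVneq v b) => [->|vb]; first by rewrite bl.
  by rewrite (port_not_used lI ab) // (port_not_used mI ab).
have ml : (m == l) = false by rewrite eq_sym (negPf lm).
case: (perm2_cases P) => ->; rewrite /= /port_block al bl am bm /= !inE.
  by case: precedes; case: precedes; rewrite /= !eqseq_cons !eqxx ?ml ?(negPf lm).
by case: precedes; case: precedes; rewrite /= !eqseq_cons !eqxx ?ml ?(negPf lm).
Qed.

(** Around [u] lie the block of [v] and single letters at [b] and [c]. With [l] first in the block,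
    the letters alternate when [b] is met before [c] clockwise from [v]; with [m] first it is the
    other way round. *)
Lemma alternates_split v b c : b != v -> c != v -> b != c ->
  uses_edge u v l -> uses_edge u v m -> uses_edge u b l -> uses_edge u c m ->
  alternates pi u l m = (precedes (pi u v) l m != turn u v c b).
Proof.
move=> bv cv bc vl vm bl cm; have := used_uniq; have := mem_used.
have cl : uses_edge u c l = false by apply: (port_not_used lI bv); rewrite // eq_sym.
have bm : uses_edge u b m = false by apply: (port_not_used mI cv).
have ml : (m == l) = false by rewrite eq_sym (negPf lm).
have P : perm_eq used [:: v; b; c].
  apply: uniq_perm used_uniq _ _.
    by rewrite /= !inE negb_or !(eq_sym v) bv cv bc.
  move=> z; rewrite mem_used !inE; case: (eqVneq z v) => [->|zv]; first by rewrite vl.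
  case: (eqVneq z b) => [->|zb]; first by rewrite bl.
  case: (eqVneq z c) => [->|zc]; first by rewrite cm orbT.
  by rewrite (port_not_used lI bv) // (port_not_used mI cv).
rewrite /alternates filter_vertex_order // -/used => _ _.
rewrite turn_used ?(perm_mem P) ?inE ?eqxx ?orbT //.
have U := used_uniq; have S := perm_size P; have M := perm_mem P.
move: used P U S M => [|x [|y [|z [|]]]] // _ U _ M.
have vb : (v == b) = false by rewrite eq_sym (negPf bv).
have vc : (v == c) = false by rewrite eq_sym (negPf cv).
have cb : (c == b) = false by rewrite eq_sym (negPf bc).
have {M} : [&& x \in [:: v; b; c], y \in [:: v; b; c] & z \in [:: v; b; c]].
  by rewrite -!M !inE !eqxx !orbT.
have simp := (eqxx, vb, vc, cb, negPf bv, negPf cv, negPf bc).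
(* Only the six orders of the three ports survive [U], and each is a finite check. *)
rewrite !inE => /and3P[/or3P[] /eqP Ex /or3P[] /eqP Ey /or3P[] /eqP Ez];
move: U; rewrite Ex Ey Ez /= !inE ?simp //= => _;
  rewrite /port_block ?vl ?vm ?bl ?cm ?bm ?cl /cyclic3 ?simp /=;
by case: precedes; rewrite /= !eqseq_cons ?eqxx ?ml ?(negPf lm).
Qed.

(** The ports [a] and [b] cut the circle into two arcs, and the lines cross exactly when [c] and [d]
    lie on different ones. *)
Lemma alternates_disjoint a b c d : uniq [:: a; b; c; d] ->
  uses_edge u a l -> uses_edge u b l -> uses_edge u c m -> uses_edge u d m ->
  alternates pi u l m = (turn u a c b != turn u a d b).
Proof.
rewrite /= !inE !negb_or => /and4P[/and3P[ab ac ad] /andP[bc bd] cd _].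
move=> al bl cm dm.
have ml : (m == l) = false by rewrite eq_sym (negPf lm).
have cl : uses_edge u c l = false by apply: (port_not_used lI ab); rewrite // eq_sym.
have dl : uses_edge u d l = false by apply: (port_not_used lI ab); rewrite // eq_sym.
have am : uses_edge u a m = false by apply: (port_not_used mI cd).
have bm : uses_edge u b m = false by apply: (port_not_used mI cd).
have P : perm_eq used [:: a; b; c; d].
  apply: uniq_perm used_uniq _ _.
    by rewrite /= !inE !negb_or ab ac ad bc bd cd.
  move=> z; rewrite mem_used !inE.
  case: (eqVneq z a) => [->|za]; first by rewrite al.
  case: (eqVneq z b) => [->|zb]; first by rewrite bl.
  case: (eqVneq z c) => [->|zc]; first by rewrite cm orbT.
  case: (eqVneq z d) => [->|zd]; first by rewrite dm orbT.
  by rewrite (port_not_used lI ab) // (port_not_used mI cd).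
rewrite /alternates filter_vertex_order // -/used.
rewrite !turn_used ?(perm_mem P) ?inE ?eqxx ?orbT //.
have U := used_uniq; have S := perm_size P; have M := perm_mem P.
move: used P U S M => [|x [|y [|z [|t [|]]]]] // _ U _ M.
have simp := (eqxx, negPf ab, negPf ac, negPf ad, negPf bc, negPf bd, negPf cd).
have ba : (b == a) = false by rewrite eq_sym simp.
have ca : (c == a) = false by rewrite eq_sym simp.
have da : (d == a) = false by rewrite eq_sym simp.
have cb : (c == b) = false by rewrite eq_sym simp.
have db : (d == b) = false by rewrite eq_sym simp.
have dc : (d == c) = false by rewrite eq_sym simp.
have simp2 := (simp, ba, ca, da, cb, db, dc).
have [ix iy iz it] : [/\ x \in [:: a; b; c; d], y \in [:: a; b; c; d],
    z \in [:: a; b; c; d] & t \in [:: a; b; c; d]].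
  by rewrite -!M !inE !eqxx !orbT.
move: U; rewrite /= !inE !negb_or => /and4P[/and3P[xy xz xt] /andP[yz yt] zt _].
move: ix; rewrite !inE => /or4P[] /eqP ?; subst x;
move: iy; rewrite !inE => /or4P[] /eqP ?; subst y; rewrite ?simp2 // in xy;
move: iz; rewrite !inE => /or4P[] /eqP ?; subst z; rewrite ?simp2 // in xz yz;
move: it; rewrite !inE => /or4P[] /eqP ?; subst t; rewrite ?simp2 // in xt yt zt;
by rewrite /= /port_block ?al ?bl ?cm ?dm ?am ?bm ?cl ?dl /cyclic3 ?simp2 /=
  ?eqseq_cons ?eqxx ?ml ?(negPf lm).
Qed.

End AlternationCases.

(** * Pairwise constraints: from a layout, and back to one when the orders are acyclic *)

Section Solutions.
Implicit Types (s : line -> V -> bool) (r : V -> V -> bool).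
Implicit Types (R : line -> line -> V -> V -> bool).

(* [s l u] tells whether [l] is attached to the right of the intermediate lines at
   its terminal [u], and [r u v] whether [l] precedes [m] at the port of [u]
   towards [v].  Two lines that both terminate at [u] are not constrained there. *)
Record compatible s l m r : Prop := Compatible {
  compat_edge u v : uses_edge u v l -> uses_edge u v m -> r v u = ~~ r u v;
  compat_vertex u v w : v != w -> uses_edge u v l -> uses_edge u v m ->
    uses_edge u w l -> uses_edge u w m -> r u v = ~~ r u w;
  compat_split u v b c : b != v -> c != v -> b != c ->
    uses_edge u v l -> uses_edge u v m -> uses_edge u b l -> uses_edge u c m ->
    r u v = turn u v c b;
  compat_left u v : uses_edge u v l -> uses_edge u v m -> terminal l u ->
    intermediate m u -> r u v = ~~ s l u;
  compat_right u v : uses_edge u v l -> uses_edge u v m -> intermediate l u ->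
    terminal m u -> r u v = s m u;
  compat_meet u a b c d : uniq [:: a; b; c; d] ->
    uses_edge u a l -> uses_edge u b l -> uses_edge u c m -> uses_edge u d m ->
    turn u a c b = turn u a d b }.

Definition solution s R : Prop :=
  forall l m, l \in lines I -> m \in lines I -> l != m ->
  compatible s l m (R l m) /\ forall u v, uses_edge u v l -> uses_edge u v m ->
    R m l u v = ~~ R l m u v.

Lemma crossing_free_no_alternation pi u l m : crossing_free pi ->
  l != m -> alternates pi u l m = false.
Proof.
case=> _ _ nv lm; apply/negP=> /alternates_vertex_crossing.
by case/(_ lm) => /nv.
Qed.

Section FromLayout.

Variable pi : V -> V -> seq line.
Hypothesis L : is_layout pi.

(** One intermediate line before [l] is enough: the periphery condition puts all intermediate lines
    of the port on the same side of a terminal. *)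
Let side l u : bool :=
  has (fun v => has (fun m => intermediate m u && precedes (pi u v) m l) (pi u v))
    [seq v <- nbrs u | uses_edge u v l].

Lemma precedes_swap u v l m : l \in lines I -> m \in lines I -> l != m ->
  uses_edge u v l -> uses_edge u v m ->
  precedes (pi u v) m l = ~~ precedes (pi u v) l m.
Proof.
move=> lI mI lm lu mu; have vu := uses_edge_adj lI lu.
have lp : l \in pi u v by rewrite mem_layout // lI.
have mp : m \in pi u v by rewrite mem_layout // mI.
rewrite /precedes lp mp /= -leqNgt [RHS]leq_eqVlt orb_idl // => /eqP E.
by move: lm; rewrite -(index_inj l mp lp) ?eqxx.
Qed.

Lemma sideE l u v : l \in lines I -> terminal l u -> uses_edge u v l ->
  side l u = has (fun m => intermediate m u && precedes (pi u v) m l) (pi u v).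
Proof.
move=> lI lt lu; rewrite /side; apply/hasP/idP => [[w]|H].
  by rewrite mem_filter => /andP[lw _]; rewrite (terminal_port lI lt lu lw).
by exists v; rewrite // mem_filter lu (uses_edge_adj lI lu).
Qed.

(** The clauses on edges and vertices are crossing-freeness read through the alternation lemmas; the
    two clauses on sides are where the periphery condition enters. *)
Lemma solution_of_layout : crossing_free pi ->
  (forall u v, v \in nbrs u -> periphery_condition pi u v) ->
  exists s R, solution s R.
Proof.
move=> cf per; exists side, (fun l m u v => precedes (pi u v) l m).
have left l m u v : l \in lines I -> m \in lines I -> uses_edge u v l ->
  uses_edge u v m -> terminal l u -> intermediate m u ->
  precedes (pi u v) l m = ~~ side l u.
  move=> lI mI lu mu lt mi; rewrite (sideE lI lt lu).
  have vu := uses_edge_adj lI lu; have U := layout_uniq L vu.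
  have lm : l != m by apply: contraTneq lt => ->; case/andP: mi.
  have mp : m \in pi u v by rewrite mem_layout // mI.
  have lp : l \in pi u v by rewrite mem_layout // lI.
  apply/idP/hasPn => [plm n|H]; last first.
    by have := H _ mp; rewrite mi /= precedes_swap // negbK.
  (* With [n] before and [m] after it, [l] would lie inside the block of intermediate lines. *)
  move=> np; apply/andP=> -[ni pnl].
  have [s1 [s2 [s3 [E /allP t1 /allP i2 /allP t3]]]] := per u v vu.
  have : l \in s1 ++ s2 ++ s3 by rewrite -E.
  have terminalN k : terminal k u -> intermediate k u = false.
    by rewrite /intermediate => ->; rewrite andbF.
  have in2 k : k \in pi u v -> intermediate k u -> k \in s2 /\ k \notin s1.
    move=> kp ki; have kN1 : k \notin s1.
      by apply/negP=> /t1/terminalN; rewrite ki.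
    split=> //; move: kp; rewrite E !mem_cat (negPf kN1) /= => /orP[//|/t3/terminalN].
    by rewrite ki.
  have [m2 mN1] := in2 _ mp mi; have [n2 nN1] := in2 _ np ni.
  have lN2 : l \notin s2 by apply/negP=> /i2; rewrite terminalN.
  move: plm pnl; rewrite /precedes lp mp E !index_cat (negPf mN1) m2 (negPf nN1) n2.
  rewrite (negPf lN2); case: ifP => l1 /=; move: n2 m2; rewrite -!index_mem.
    by move: l1; rewrite -index_mem =>
      l1 _ _ _ /(leq_ltn_trans (leq_addr _ _))/ltn_trans/(_ l1); rewrite ltnn.
  by move=> _ m2 + _; rewrite ltn_add2l =>
    /(leq_ltn_trans (leq_addr _ _))/ltn_trans/(_ m2); rewrite ltnn.
move=> l m lI mI lm; have nalt u := crossing_free_no_alternation u cf lm.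
have [_ ne _] := cf; split; last by move=> u v lu mu; apply: precedes_swap.
have ml : m != l by rewrite eq_sym.
split.
- move=> u v lu mu; have vu := uses_edge_adj lI lu.
  have := ne u v l m vu; have := ne u v m l vu; rewrite /edge_crossing.
  rewrite (precedes_swap lI mI lm lu mu) (precedes_swap (u := v) (v := u) lI mI lm);
    rewrite 1?uses_edgeC //.
  by do 2!case: precedes.
- move=> u v w vw lv mv lw mw.
  have := nalt u; rewrite (alternates_parallel L lI mI lm vw) //.
  by do 2!case: precedes.
- move=> u v b c bv cv bc lv mv lb mc.
  have := nalt u; rewrite (alternates_split L lI mI lm bv cv bc) //.
  by move/negbFE/eqP.
- by move=> u v lv mv lt mi; apply: left.
- move=> u v lv mv li mt.
  by rewrite (precedes_swap mI lI ml) // (left m l u v) // negbK.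
move=> u a b c d U al bl cm dm.
have := nalt u; rewrite (alternates_disjoint L lI mI lm U) //.
by move/negbFE/eqP.
Qed.

End FromLayout.

Section ToLayout.

Variables (s : line -> V -> bool) (R : line -> line -> V -> V -> bool).
Hypothesis sol : solution s R.
Hypothesis acyclic : forall u v l m n, l \in lines I -> m \in lines I ->
  n \in lines I -> l != m -> m != n -> n != l ->
  uses_edge u v l -> uses_edge u v m -> uses_edge u v n ->
  R l m u v -> R m n u v -> R l n u v.

Let pi u v := sort (fun l m => (l == m) || R l m u v) (edge_lines u v).

Lemma mem_edge_lines u v l :
  (l \in edge_lines u v) = (l \in lines I) && uses_edge u v l.
Proof. by rewrite mem_filter andbC. Qed.

Lemma sort_layout : is_layout pi.
Proof. by move=> u v _; rewrite perm_sort. Qed.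

(** [acyclic] and the antisymmetry in [solution] make the relation a total order on the lines of the
    edge, so sorting realises it. *)
Lemma precedes_sort u v l m : l \in lines I -> m \in lines I -> l != m ->
  uses_edge u v l -> uses_edge u v m -> precedes (pi u v) l m = R l m u v.
Proof.
move=> lI mI lm lu mu; have vu := uses_edge_adj lI lu.
pose le l m := (l == m) || R l m u v.
have le_total : {in edge_lines u v &, total le}.
  move=> x y; rewrite !mem_edge_lines => /andP[xI xu] /andP[yI yu].
  rewrite /le; case: (eqVneq x y) => //= xy.
  by rewrite (sol xI yI xy).2 // orbN.
have le_trans : {in edge_lines u v & &, transitive le}.
  move=> y x z; rewrite !mem_edge_lines => /andP[yI yu] /andP[xI xu] /andP[zI zu].
  rewrite /le; case: (eqVneq x y) => [->|xy] //=.
  case: (eqVneq y z) => [<-|yz] /=; first by move=> ->; rewrite orbT.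
  case: (eqVneq x z) => //= xz rxy ryz.
  by apply: (acyclic (m := y)) => //; rewrite eq_sym.
have key x y : x \in lines I -> y \in lines I -> x != y ->
    uses_edge u v x -> uses_edge u v y -> precedes (pi u v) x y -> R x y u v.
  move=> xI yI xy xu yu /andP[yp pxy].
  have : le x y.
    apply: (@sorted_ltn_index_in _ le (pi u v)) => //.
    - by apply: sub_in3 le_trans => z; rewrite mem_sort.
    - by apply: sort_sorted_in le_total _ _; apply/allP.
    by rewrite mem_sort mem_edge_lines xI.
  by rewrite /le (negPf xy).
case P: precedes; first by rewrite key.
have := precedes_swap sort_layout lI mI lm lu mu; rewrite P => /key H.
by apply/esym/negbTE; rewrite -(sol lI mI lm).2 //; apply: H => //; rewrite eq_sym.
Qed.

Lemma no_edge_crossing_sort u v l m : v \in nbrs u -> ~~ edge_crossing pi u v l m.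
Proof.
move=> vu; apply/negP=> /andP[p1 p2].
have [_ _ sym] := nbrs_rotation I; have uv : u \in nbrs v by have := sym u v; rewrite /adj vu.
have lm : l != m by apply/eqP=> E; move: p1; rewrite /precedes E ltnn andbF.
have /andP[] : (m \in lines I) && uses_edge u v m.
  by rewrite -(mem_layout _ sort_layout vu); case/andP: p1.
have /andP[] : (l \in lines I) && uses_edge u v l.
  rewrite -(mem_layout _ sort_layout vu) -index_mem; case/andP: p1 => mp lt.
  by apply: ltn_trans lt _; rewrite index_mem.
move=> lI lu mI mu; move: p1 p2; rewrite !precedes_sort // 1?uses_edgeC //.
by rewrite (compat_edge (sol lI mI lm).1 lu mu) => ->.
Qed.

Lemma no_vertex_crossing_sort u l m : ~ vertex_crossing pi u l m.
Proof.
move=> /(vertex_crossing_alternates sort_layout)[lI mI lm alt].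
have [cE cV cS _ _ cM] := (sol lI mI lm).1.
have [[a [b [ab al bl]]] [c [d [cd cm dm]]]] := alternates_ports sort_layout lI mI lm alt.
move: alt; have L := sort_layout.
have split v x y : x != v -> y != v -> x != y -> uses_edge u v l -> uses_edge u v m ->
    uses_edge u x l -> uses_edge u y m -> ~ alternates pi u l m.
  move=> xv yv xy vl vm xl ym; rewrite (alternates_split L lI mI lm xv yv xy) //.
  by rewrite precedes_sort // (cS u v x y) // eqxx.
have par v w : v != w -> uses_edge u v l -> uses_edge u v m ->
    uses_edge u w l -> uses_edge u w m -> ~ alternates pi u l m.
  move=> vw vl vm wl wm; rewrite (alternates_parallel L lI mI lm vw) //.
  by rewrite !precedes_sort // (cV u v w) //; case: R.
have ba : b != a by rewrite eq_sym.
have dc : d != c by rewrite eq_sym.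
case: (eqVneq a c) => [ac|ac].
  subst c; case: (eqVneq b d) => [bd|bd]; first by subst d; apply: (par a b).
  exact: (split a b d).
case: (eqVneq a d) => [ad|ad].
  subst d; case: (eqVneq b c) => [bc|bc]; first by subst c; apply: (par a b).
  exact: (split a b c).
case: (eqVneq b c) => [bc|bc]; first by subst c; apply: (split b a d).
case: (eqVneq b d) => [bd|bd]; first by subst d; apply: (split b a c).
have U : uniq [:: a; b; c; d] by rewrite /= !inE !negb_or ab ac ad bc bd cd.
by rewrite (alternates_disjoint L lI mI lm U) // (cM u a b c d) // eqxx.
Qed.

(** Sides relate a terminal to intermediate lines only. Terminals of different sides are put in
    order through any intermediate line [z] of the port, so the classes 0, 1, 2 (left, middle,
    right) increase along the port. *)
Lemma periphery_sort u v : v \in nbrs u -> periphery_condition pi u v.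
Proof.
move=> vu; have L := sort_layout.
pose t := pi u v; have U : uniq t := layout_uniq L vu.
have tE n : n \in t -> [/\ n \in lines I, uses_edge u v n &
    intermediate n u = ~~ terminal n u].
  by rewrite mem_layout // => /andP[nI nu]; rewrite (line_terminalVintermediate nu).
pose left n := terminal n u && ~~ s n u.
(* Without an intermediate line the whole port is one terminal block. *)
case: (boolP (has (fun n => intermediate n u) t)) => [/hasP[z zt zi]|]; last first.
  move=> /hasPn H; exists t, [::], [::]; split; rewrite ?cats0 //.
  by apply/allP=> n nt; have := H n nt; have [_ _ ->] := tE n nt; rewrite negbK.
pose cls n : nat := if terminal n u then (if s n u then 2 else 0) else 1.
have cls_sorted n k : n \in t -> k \in t -> index n t < index k t ->
    cls n = 1 \/ cls k = 1 -> cls n <= cls k.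
  move=> nt kt nk; have [nI nu ni] := tE n nt; have [kI ku ki] := tE k kt.
  have nNk : n != k by apply: contraTneq nk => ->; rewrite ltnn.
  have Rnk : R n k u v by rewrite -precedes_sort // /precedes kt nk.
  have C := (sol nI kI nNk).1; rewrite /cls; move: ni ki.
  case: (boolP (terminal n u)) => nt' ni; case: (boolP (terminal k u)) => kt' ki //=.
  - by case: ifP; case: ifP => _ _ [].
  - by move: Rnk; rewrite (compat_left C nu ku nt' ki) => /negPf->.
  by move: Rnk; rewrite (compat_right C nu ku ni kt') => ->.
have zc : cls z = 1.
  by rewrite /cls; have [_ _] := tE z zt; rewrite zi => /esym/negPf->.
have cls2 n : cls n <= 2 by rewrite /cls; case: (terminal n u) => //; case: (s n u).
have le_index n k : n \in t -> k \in t -> cls n < cls k -> index n t < index k t.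
  move=> nt kt.
  have zle x : x \in t -> cls x < 1 -> index x t < index z t.
    move=> xt xc; case: (ltngtP (index x t) (index z t)) => // [zx|/(index_inj x xt zt) E].
      by have := cls_sorted _ _ zt xt zx (or_introl zc); rewrite zc; lia.
    by move: xc; rewrite E zc.
  have zge x : x \in t -> 1 < cls x -> index z t < index x t.
    move=> xt xc; case: (ltngtP (index z t) (index x t)) => // [zx|/(index_inj x zt xt) E].
      by have := cls_sorted _ _ xt zt zx (or_intror zc); rewrite zc; lia.
    by move: xc; rewrite -E zc.
  have := cls2 k; move=> k2 lt; case: (ltngtP (cls n) 1) => n1;
    case: (ltngtP (cls k) 1) => k1; try lia.
  - exact: ltn_trans (zle _ nt n1) (zge _ kt k1).
  - case: (ltngtP (index n t) (index k t)) => // [kn|/(index_inj n nt kt) E].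
      by have := cls_sorted _ _ kt nt kn (or_introl k1); lia.
    by move: lt; rewrite E ltnn.
  - case: (ltngtP (index n t) (index k t)) => // [kn|/(index_inj n nt kt) E].
      by have := cls_sorted _ _ kt nt kn (or_intror n1); lia.
    by move: lt; rewrite E ltnn.
have tsorted : sorted (fun n k => cls n <= cls k) t.
  apply/(sortedP z) => i it; rewrite leqNgt; apply/negP => /le_index.
  rewrite !mem_nth //; last exact: ltnW.
  by rewrite !index_uniq // => [/(_ isT isT)|]; lia.
have splitE : t = [seq n <- t | cls n == 0] ++ [seq n <- t | cls n == 1] ++
    [seq n <- t | cls n == 2].
  elim: (t) tsorted => // n t' IHt' /= pt.
  have tr : transitive (fun n k : line => cls n <= cls k) by move=> ? ? ?; apply: leq_trans.
  have {}IHt' := IHt' (path_sorted pt).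
  move: pt; rewrite (path_sortedE tr) => /andP[/allP cl _].
  have empty i : i < cls n -> [seq k <- t' | cls k == i] = [::].
    move=> ic; apply/eqP; rewrite -[_ == _]negbK -has_filter; apply/hasPn => k kt'.
    by have := cl k kt'; lia.
  have := cls2 n.
  case E: (cls n) empty => [|[|[|]]] //= empty _.
  - by rewrite {1}IHt'.
  - by move: IHt'; rewrite (empty 0) //= => {1}->.
  by move: IHt'; rewrite (empty 0) // (empty 1) //= => {1}->.
exists [seq n <- t | cls n == 0], [seq n <- t | cls n == 1], [seq n <- t | cls n == 2].
split=> //; apply/allP => n; rewrite mem_filter => /andP[cn /tE[_ _]]; move: cn.
- by rewrite /cls; case: (terminal n u).
- by rewrite /cls; case: (terminal n u) => //; case: (s n u).
by rewrite /cls; case: (terminal n u).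
Qed.

Lemma layout_of_solution : has_crossing_free_periphery_layout I.
Proof.
exists pi; split; last exact: periphery_sort.
split; last by move=> u l m; apply: no_vertex_crossing_sort.
  split; first exact: sort_layout.
  by move=> u l m /no_vertex_crossing_sort.
by move=> u v l m vu; apply: no_edge_crossing_sort.
Qed.

End ToLayout.

End Solutions.


(** * Symmetry of the constraints; lines as edge sets *)

Lemma turn_swap u v a b : v \in nbrs u -> a \in nbrs u -> b \in nbrs u ->
  a != v -> b != v -> a != b -> turn u v a b = ~~ turn u v b a.
Proof.
move=> vu au bu av bv ab; rewrite /turn /cyclic3.
have ne := @index_nbrs_neq u.
move: (ne _ _ au vu av) (ne _ _ bu vu bv) (ne _ _ au bu ab).
by move: (index v _) (index a _) (index b _); lia.
Qed.

(** For disjoint ports the clause is symmetric because [a], [b] separate [c], [d] on a circle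
    exactly when [c], [d] separate [a], [b]. *)
Lemma compatible_swap s l m r : l \in lines I -> m \in lines I ->
  compatible s m l r -> compatible s l m (fun u v => ~~ r u v).
Proof.
move=> lI mI [cE cV cS cL cR cM]; split.
- by move=> u v lu mu; rewrite cE.
- by move=> u v w vw lv mv lw mw; rewrite (cV u v w) // negbK.
- move=> u v b c bv cv bc lv mv lb mc; have cb : c != b by rewrite eq_sym.
  have [[vu bu] cu] := (uses_edge_adj lI lv, uses_edge_adj lI lb, uses_edge_adj mI mc).
  by rewrite (cS u v c b) // [RHS]turn_swap.
- by move=> u v lu mu lt mi; rewrite (cR u v).
- by move=> u v lu mu li mt; rewrite (cL u v) // negbK.
move=> u a b c d; rewrite /= !inE !negb_or.
move=> /and4P[/and3P[ab ac ad] /andP[bc bd] cd _] la lb mc md.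
have U : uniq [:: c; d; a; b].
  rewrite /= !inE !negb_or cd ab (eq_sym c a) (eq_sym c b) (eq_sym d a) (eq_sym d b).
  by rewrite ac ad bc bd.
have := cM u c d a b U mc md la lb.
have [au bu] := (uses_edge_adj lI la, uses_edge_adj lI lb).
have [cu du] := (uses_edge_adj mI mc, uses_edge_adj mI md).
have ne := @index_nbrs_neq u.
move: (ne _ _ au bu ab) (ne _ _ au cu ac) (ne _ _ au du ad) (ne _ _ bu cu bc)
  (ne _ _ bu du bd) (ne _ _ cu du cd).
rewrite /turn /cyclic3; move: (index a _) (index b _) (index c _) (index d _).
move=> {ne au bu cu du} i j k h; case: (ltngtP i j) => // ij _; case: (ltngtP i k) => // ik _;
case: (ltngtP i h) => // ih _; case: (ltngtP j k) => // jk _;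
case: (ltngtP j h) => // jh _; case: (ltngtP k h) => // kh _; rewrite /= => // _; exfalso;
  move: ij ik ih jk jh kh; clear; lia.
Qed.

Lemma uses_edge_rev u v l : uses_edge u v (rev l) = uses_edge u v l.
Proof.
by rewrite /uses_edge -[[:: u; v]]revK -[[:: v; u]]revK !infix_rev orbC.
Qed.

Lemma terminal_rev u l : terminal (rev l) u = terminal l u.
Proof. by rewrite /terminal revK orbC. Qed.

(* Traverses a line from its terminal [x], in either direction. *)
Lemma line_ind p x x' (P : V -> V -> Prop) : uniq p -> terminal p x ->
  uses_edge x x' p -> P x x' ->
  (forall u v w, u != w -> uses_edge v u p -> uses_edge v w p -> P u v -> P v w) ->
  (forall u v, uses_edge u v p -> P u v \/ P v u) /\
  (forall y y', terminal p y -> y != x -> uses_edge y y' p -> P y' y).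
Proof.
move=> + + + Px.
(* Reading [p] backwards if necessary, [x] is its first vertex. *)
wlog hx : p / index x p = 0 => [H|] Up tx xx' step; last first.
  have P_nth i : i.+1 < size p -> P (nth x p i) (nth x p i.+1).
    elim: i => [|i IHi] ip.
      rewrite -{1}hx nth_index ?(uses_edge_mem xx') //.
      move: xx'; rewrite uses_edge_index // hx /= orbF => /and3P[_ x'p /eqP <-].
      by rewrite nth_index.
    have i1 := ltnW ip; have i0 := ltnW i1.
    apply: (step (nth x p i)); last exact: IHi.
    - by rewrite nth_uniq // ltn_eqF.
    - by rewrite uses_edge_index // !index_uniq // !mem_nth // eqxx orbT.
    by rewrite uses_edge_index // !index_uniq // !mem_nth // eqxx.
  have edge u v : u \in p -> v \in p -> index v p = (index u p).+1 -> P u v.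
    move=> up vp E; have := P_nth (index u p).
    by rewrite -E index_mem !nth_index // => /(_ vp).
  split=> [u v|y y' ty yx yy'].
    rewrite uses_edge_index // => /and3P[up vp /orP[] /eqP E].
      by left; apply: edge.
    by right; apply: edge.
  move: ty yy'; rewrite terminal_index // uses_edge_index //.
  move=> /andP[_ ty] /and3P[yp y'p E]; apply: edge => //.
  have : index y p != 0.
    by apply: contra yx => /eqP E0; apply/eqP/(index_eq yp); rewrite hx.
  by move: y'p ty E; rewrite -index_mem; index_lia.
case: (eqVneq (index x p) 0) => [hx|hx]; first exact: H.
have [|||||E1 E2] := H (rev p); rewrite ?rev_uniq ?terminal_rev ?uses_edge_rev //.
- move: tx; rewrite /terminal; case: (lastP p) hx => // s z.
  rewrite rev_rcons /= => hx; have -> : (ohead (rcons s z) == Some x) = false.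
    by apply/negbTE/eqP => E; move: hx; case: (s) E => [|a t] /= [->]; rewrite eqxx.
  by move/eqP=> [->]; rewrite eqxx.
- by move=> u v w uw; rewrite !uses_edge_rev; apply: step.
split=> [u v|y y']; first by move: (E1 u v); rewrite uses_edge_rev.
by move: (E2 y y'); rewrite terminal_rev uses_edge_rev.
Qed.

(** By induction along [p]: its next edge is an edge of [q], and it cannot lead back to the
    predecessor on [q], a vertex that [p] has already visited. *)
Lemma same_edges_prefix p q x : uniq p -> uniq q ->
  ohead p = Some x -> ohead q = Some x ->
  (forall u v, uses_edge u v p -> uses_edge u v q) ->
  forall i, i < size p -> i < size q /\ nth x q i = nth x p i.
Proof.
move=> Up Uq hp hq sub; elim/ltn_ind => -[|i] IHi ip.
  by move: hp hq; case: (p) => [|? ?] //; case: (q) => [|? ?] //= [->] [->].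
have [iq Ei] := IHi i (ltnSn i) (ltnW ip).
have : uses_edge (nth x p i) (nth x p i.+1) q.
  have ip' := ltnW ip; apply: sub.
  by rewrite uses_edge_index // !index_uniq // !mem_nth // eqxx.
rewrite uses_edge_index // -Ei index_uniq // => /and3P[_ yq /orP[] /eqP E].
  by split; [rewrite -E index_mem | rewrite -[in LHS]E nth_index].
have ltE : index (nth x p i.+1) q < i.+1 by rewrite ltnS [leqRHS]E leqnSn.
have [jq Ej] := IHi _ ltE (ltn_trans ltE ip).
move: Ej; rewrite nth_index // => /eqP; rewrite nth_uniq // => [/eqP Ej|].
  by move: ltE; rewrite -Ej ltnn.
exact: ltn_trans ltE ip.
Qed.

(** A path with an edge is determined by its edges up to reversal, and the lines never list a path
    together with its reverse. The edge [xy] excludes one-vertex paths, which all have the same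
    empty edge set. *)
Lemma same_edges_eq p q x y : p \in lines I -> q \in lines I ->
  uses_edge x y p -> (forall u v, uses_edge u v p = uses_edge u v q) -> p = q.
Proof.
move=> pI qI xyp E; have [Up Uq] := (line_uniq pI, line_uniq qI).
have same_head t z : uniq t -> ohead p = Some z -> ohead t = Some z ->
    (forall u v, uses_edge u v p = uses_edge u v t) -> p = t.
  move=> Ut hp ht Et; have Etp u v : uses_edge u v p -> uses_edge u v t by rewrite Et.
  have Ept u v : uses_edge u v t -> uses_edge u v p by rewrite Et.
  have pt := same_edges_prefix Up Ut hp ht Etp.
  have tp := same_edges_prefix Ut Up ht hp Ept.
  apply: (@eq_from_nth _ z) => [|i /pt[_ ->] //].
  apply/eqP; rewrite eqn_leq; apply/andP; split; rewrite leqNgt; apply/negP.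
    by move/pt; rewrite ltnn => -[].
  by move/tp; rewrite ltnn => -[].
case Ep : p (xyp) => [|a [|b p']].
- by move/uses_edge_mem.
- move=> xy; have xa := uses_edge_mem xy.
  have ya := xy; rewrite uses_edgeC in ya.
  have := uses_edge_neq pI; rewrite Ep => /(_ _ _ xy).
  by move: xa (uses_edge_mem ya); rewrite !inE => /eqP-> /eqP->; rewrite eqxx.
rewrite -Ep => _; have ab : uses_edge a b p by rewrite /uses_edge Ep /infix /= !eqxx prefix0s.
have hp : ohead p = Some a by rewrite Ep.
have ta : terminal p a by rewrite /terminal hp eqxx.
(* The end [a] of [p] is also an end of [q]: a second port of [q] there would be a second port of
   [p]. *)
have : terminal q a.
  apply/negPn/negP => iq; have abq : uses_edge a b q by rewrite -E.
  have ia : intermediate q a by rewrite (line_terminalVintermediate abq).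
  have [w wb] := intermediate_port (line_uniq qI) ia abq; rewrite -E => aw.
  by move: wb; rewrite (terminal_port pI ta ab aw) eqxx.
case/orP=> /eqP hq; first exact: same_head hq E.
case: (eqVneq p q) => // pq; have := lines_not_rev pI qI pq.
rewrite (same_head (rev q) a) ?eqxx ?rev_uniq // => u v.
by rewrite uses_edge_rev E.
Qed.


(** * Cyclic triples and the stretches they share *)

Section CyclicTriples.

Lemma two_terminals p x y z : uniq p -> x != y ->
  terminal p x -> terminal p y -> terminal p z -> z = x \/ z = y.
Proof.
move=> Up xy; rewrite !terminal_index //.
move=> /andP[xp ex] /andP[yp ey] /andP[zp ez].
have ne : index x p != index y p by apply: contra xy => /eqP/(index_eq xp)->.
have [E|E] : index z p = index x p \/ index z p = index y p.
  by move: ex ey ez ne; index_lia.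
- by left; apply: index_eq zp E.
by right; apply: index_eq zp E.
Qed.

(** Followed from [x], the path [q] stays on [p]: as long as [p] continues, its next edge is the
    only way on for [q], and where [p] ends [q] ends too. *)
Lemma same_ends_edges p q x x' y : uniq p -> q \in lines I ->
  x != y -> terminal p x -> terminal p y -> terminal q x -> terminal q y ->
  uses_edge x x' p -> (forall u v, uses_edge u v p -> uses_edge u v q) ->
  forall u v, uses_edge u v q -> uses_edge u v p.
Proof.
move=> Up qI xy px py qx qy xx'p sub u v uvq.
have [|H _] := @line_ind q x x' (fun u v => uses_edge u v p) (line_uniq qI) qx
  (sub _ _ xx'p) xx'p; last by case: (H u v uvq) => //; rewrite uses_edgeC.
move=> a b c ac baq bcq abp.
case: (boolP (terminal p b)) => [pb|ib].
  have qb : terminal q b by case: (two_terminals Up xy px py pb) => ->.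
  by move: ac; rewrite (terminal_port qI qb baq bcq) eqxx.
have bap : uses_edge b a p by rewrite uses_edgeC.
have ib' : intermediate p b by rewrite (line_terminalVintermediate bap).
have [d da bdp] := intermediate_port Up ib' bap.
have ad : a != d by rewrite eq_sym.
have [ca|cd] := ports_le2 qI ad (sub _ _ bap) (sub _ _ bdp) bcq.
  by move: ac; rewrite ca eqxx.
by rewrite cd.
Qed.

Variables (s : line -> V -> bool) (R : line -> line -> V -> V -> bool).
Hypothesis sol : solution s R.

(** Equal truth values cover both orientations of the cycle, so the notion is preserved where an
    edge or a vertex reverses all three orders. *)
Definition cyclic_triple l m n u v : Prop :=
  [/\ uses_edge u v l, uses_edge u v m, uses_edge u v n,
      R l m u v = R m n u v & R m n u v = R n l u v].

Lemma cyclic_rot l m n u v : cyclic_triple l m n u v -> cyclic_triple m n l u v.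
Proof. by case=> ul um un E1 E2; split; rewrite // -E2. Qed.

Section Triple.

Variables l m n : line.
Hypotheses (lI : l \in lines I) (mI : m \in lines I) (nI : n \in lines I).
Hypotheses (lm : l != m) (mn : m != n) (nl : n != l).

Lemma cyclic_swap u v : cyclic_triple l m n u v -> cyclic_triple m l n u v.
Proof.
case=> ul um un E1 E2; split=> //.
- rewrite (sol lI mI lm).2 // (_ : R l n u v = ~~ R n l u v) ?E1 ?E2 //.
  by rewrite (sol nI lI nl).2.
by rewrite (sol nI lI nl).2 // (sol mI nI mn).2 // E2.
Qed.

Lemma cyclic_edge u v : cyclic_triple l m n u v -> cyclic_triple l m n v u.
Proof.
case=> ul um un E1 E2.
have [[cl _] [cm _]] := (sol lI mI lm, sol mI nI mn); have [cn _] := sol nI lI nl.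
split; rewrite 1?uses_edgeC // (compat_edge cm um un).
  by rewrite (compat_edge cl ul um) E1.
by rewrite (compat_edge cn un ul) E2.
Qed.

(** If [l] ended alone, both others would lie on the same side of it, whereas a cycle puts one on
    each side. *)
Lemma cyclic_terminal u v : cyclic_triple l m n u v -> terminal l u ->
  terminal m u || terminal n u.
Proof.
case=> ul um un E1 E2 lu; apply/negPn; rewrite negb_or; apply/negP=> /andP[mu nu].
have mi : intermediate m u by rewrite (line_terminalVintermediate um).
have ni : intermediate n u by rewrite (line_terminalVintermediate un).
have := compat_left (sol lI mI lm).1 ul um lu mi.
have := compat_right (sol nI lI nl).1 un ul ni lu.
by rewrite E1 E2 => ->; case: (s l u).
Qed.

(** If [n] turned off alone, the rotation would place it on the same side of [l] and of [m]. *)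
Lemma cyclic_parallel u v w : cyclic_triple l m n u v ->
  intermediate l u -> intermediate m u -> intermediate n u ->
  w != v -> uses_edge u w l -> uses_edge u w m -> uses_edge u w n.
Proof.
case=> ul um un E1 E2 li mi ni wv wl wm.
have [z zv zn] := intermediate_port (line_uniq nI) ni un.
case: (eqVneq w z) => [->//|wz]; have zw : z != w by rewrite eq_sym.
have := compat_split (sol mI nI mn).1 wv zv wz um un wm zn.
have := compat_split (sol nI lI nl).1 zv wv zw un ul zn wl.
have [[vu wu] zu] := (uses_edge_adj lI ul, uses_edge_adj lI wl, uses_edge_adj nI zn).
by rewrite -E2 => ->; rewrite turn_swap //; case: turn.
Qed.

End Triple.

Definition triple_ends l m n u : Prop :=
  [\/ terminal l u /\ terminal m u, terminal m u /\ terminal n u |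
      terminal n u /\ terminal l u].

(** When all three lines go on and part, their orders are those of three ports read from [v] around
    [u], which is a linear order; when two stay together, [cyclic_parallel] brings in the third. *)
Lemma cyclic_step l m n u v : l \in lines I -> m \in lines I -> n \in lines I ->
  l != m -> m != n -> n != l -> cyclic_triple l m n u v ->
  triple_ends l m n u \/ exists2 w, w != v & cyclic_triple l m n u w.
Proof.
move=> lI mI nI lm mn nl C; have C1 := cyclic_rot C; have C2 := cyclic_rot C1.
have [ul um un E1 E2] := C.
case: (boolP (terminal l u)) => lu.
  left; case/orP: (cyclic_terminal lI mI nI lm nl C lu) => tu.
    exact: Or31.
  exact: Or33.
case: (boolP (terminal m u)) => mu.
  left; case/orP: (cyclic_terminal mI nI lI mn lm C1 mu) => tu.
    exact: Or32.
  exact: Or31.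
case: (boolP (terminal n u)) => nu.
  left; case/orP: (cyclic_terminal nI lI mI nl mn C2 nu) => tu.
    exact: Or33.
  exact: Or32.
right.
have li : intermediate l u by rewrite (line_terminalVintermediate ul).
have mi : intermediate m u by rewrite (line_terminalVintermediate um).
have ni : intermediate n u by rewrite (line_terminalVintermediate un).
have [a av al] := intermediate_port (line_uniq lI) li ul.
have [b bv bm] := intermediate_port (line_uniq mI) mi um.
have [c cv cn] := intermediate_port (line_uniq nI) ni un.
have cont w : w != v -> uses_edge u w l -> uses_edge u w m -> uses_edge u w n ->
    exists2 w, w != v & cyclic_triple l m n u w.
  move=> wv wl wm wn; have vw : v != w by rewrite eq_sym.
  have := compat_vertex (sol lI mI lm).1 vw ul um wl wm.
  have := compat_vertex (sol mI nI mn).1 vw um un wm wn.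
  have := compat_vertex (sol nI lI nl).1 vw un ul wn wl.
  move=> e1 e2 e3; exists w => //; split=> //; apply: negb_inj.
    by rewrite -e2 -e3.
  by rewrite -e1 -e2.
case: (eqVneq a b) => [ab|ab].
  by subst b; apply: (cont a) => //; apply: (cyclic_parallel lI mI nI mn nl C).
case: (eqVneq b c) => [bc|bc].
  by subst c; apply: (cont b) => //; apply: (cyclic_parallel mI nI lI nl lm C1).
case: (eqVneq c a) => [ca|ca].
  by subst c; apply: (cont a) => //; apply: (cyclic_parallel nI lI mI lm mn C2).
have := compat_split (sol lI mI lm).1 av bv ab ul um al bm.
have := compat_split (sol mI nI mn).1 bv cv bc um un bm cn.
have := compat_split (sol nI lI nl).1 cv av ca un ul cn al.
rewrite -E2 -E1 => -> e1 e2; move: e1 e2.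
have ne := @index_nbrs_neq u.
have [[au bu] [cu vu]] := ((uses_edge_adj lI al, uses_edge_adj mI bm),
  (uses_edge_adj nI cn, uses_edge_adj lI ul)).
move: (ne _ _ au vu av) (ne _ _ bu vu bv) (ne _ _ cu vu cv) (ne _ _ au bu ab)
  (ne _ _ bu cu bc) (ne _ _ cu au ca); rewrite /turn /cyclic3.
move: (index v _) (index a _) (index b _) (index c _) => h i j k; clear => ih jh kh ij jk ki.
case: (ltngtP h i) ih => // ? _; case: (ltngtP h j) jh => // ? _;
case: (ltngtP h k) kh => // ? _; case: (ltngtP i j) ij => // ? _;
case: (ltngtP j k) jk => // ? _; case: (ltngtP k i) ki => // ? _; rewrite //= => *;
  exfalso; lia.
Qed.

(** From the given edge the triple is followed along [l] in both directions; at the latest an end of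
    [l] stops it, since there is no further port. *)
Lemma cyclic_stretch l m n u v : l \in lines I -> m \in lines I -> n \in lines I ->
  l != m -> m != n -> n != l -> cyclic_triple l m n u v ->
  exists (w : seq V) x0, [/\ 1 < size w, uniq w,
    forall i, i.+1 < size w -> cyclic_triple l m n (nth x0 w i) (nth x0 w i.+1),
    triple_ends l m n (nth x0 w 0) & triple_ends l m n (nth x0 w (size w).-1)].
Proof.
move=> lI mI nI lm mn nl; pose K i := i.+1 < size l /\
  cyclic_triple l m n (nth u l i) (nth u l i.+1).
have Ul := line_uniq lI.
have next_index i w : i < size l -> uses_edge (nth u l i) w l ->
    (i.+1 < size l /\ w = nth u l i.+1) \/ (0 < i /\ w = nth u l i.-1).
  move=> il; rewrite uses_edge_index // index_uniq // => /and3P[_ wl /orP[] /eqP E].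
    by left; rewrite -E index_mem nth_index.
  by right; rewrite E /= nth_index.
have lend k : K k -> exists k0, [/\ k0 <= k, forall i, k0 <= i <= k -> K i &
    triple_ends l m n (nth u l k0)].
  elim: k => [|k IHk] Kk; have [ks C] := Kk.
    exists 0; split=> // [i|]; first by rewrite leqn0 => /eqP->.
    case: (cyclic_step lI mI nI lm mn nl C) => // -[w wv [wl _ _ _ _]].
    have [[_ E]|[]//] := next_index _ _ (ltnW ks) wl.
    by move: wv; rewrite E eqxx.
  have [|[w wv C']] := cyclic_step lI mI nI lm mn nl C.
    by exists k.+1; split=> // i /andP[i1 i2]; rewrite (_ : i = k.+1) //; lia.
  have [wl _ _ _ _] := C'; have [[_ E]|[_ E]] := next_index _ _ (ltnW ks) wl.
    by move: wv; rewrite E eqxx.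
  have /IHk[k0 [k0k Ki e]] : K k.
    by split; [exact: ltnW | rewrite E in C'; apply: cyclic_edge C'].
  exists k0; split=> // [|i /andP[k0i]]; first exact: leqW.
  by rewrite leq_eqVlt => /orP[/eqP->|ik] //; apply: Ki; rewrite k0i.
have rend j : forall k, size l - k = j -> K k -> exists k1, [/\ k <= k1,
    forall i, k <= i <= k1 -> K i & triple_ends l m n (nth u l k1.+1)].
  elim: j => [|j IHj] k jk Kk; have [ks C] := Kk; first by move: ks jk; clear; lia.
  have [|[w wv C']] := cyclic_step lI mI nI lm mn nl (cyclic_edge lI mI nI lm mn nl C).
    by exists k; split=> // i /andP[i1 i2]; rewrite (_ : i = k) //; lia.
  have [wl _ _ _ _] := C'; have [[ws E]|[_ E]] := next_index _ _ ks wl; last first.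
    by move: wv; rewrite E eqxx.
  have Kk1 : K k.+1 by split=> //; rewrite -E.
  have [|k1 [kk1 Ki e]] := IHj k.+1 _ Kk1; first by move: ks jk; clear; lia.
  exists k1; split=> // [|i /andP[]]; first exact: ltnW.
  by rewrite leq_eqVlt => /orP[/eqP<-|ki] //  ik; apply: Ki; rewrite ki.
move=> C; have [k Kk] : exists k, K k.
  have [ul _ _ _ _] := C; move: (ul); rewrite uses_edge_index //.
  move=> /and3P[ux vx /orP[] /eqP E].
    by exists (index u l); rewrite /K -E index_mem !nth_index.
  exists (index v l); rewrite /K -E index_mem !nth_index //; split=> //.
  exact: cyclic_edge.
have [k0 [k0k K0 e0]] := lend _ Kk; have [k1 [kk1 K1 e1]] := rend _ _ (erefl _) Kk.
have [k1s _] : K k1 by apply: K1; rewrite leqnn kk1.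
(* The vertices of [l] at positions [k0] to [k1.+1], since [K i] speaks of the edge from position
   [i] to [i.+1]. *)
pose w := take (k1.+2 - k0) (drop k0 l).
have sw : size w = k1.+2 - k0.
  by rewrite size_takel // size_drop leq_sub2r.
have nw i : i < size w -> nth u w i = nth u l (k0 + i).
  by rewrite sw => iw; rewrite nth_take // nth_drop.
have w2 : 1 < size w by rewrite sw; move: k0k kk1; clear; lia.
exists w, u; split=> //.
- by rewrite take_uniq // drop_uniq.
- move=> i iw; rewrite !nw ?(ltnW iw) // addnS.
  have bounds : k0 <= k0 + i <= k1 by move: iw; rewrite sw; clear; lia.
  case: (leqP (k0 + i) k) => h; [have [] // := K0 (k0 + i) _ | have [] // := K1 (k0 + i) _].
    by rewrite h leq_addr.
  by rewrite (ltnW h); case/andP: bounds.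
- by rewrite nw ?addn0 // ltnW.
rewrite nw; last by move: w2; clear; lia.
by rewrite (_ : _ + _ = k1.+1) // sw; move: k0k kk1; clear; lia.
Qed.

End CyclicTriples.

Lemma count_ltn (T : eqType) (a b : pred T) (s : seq T) (x : T) :
  x \in s -> a x -> ~~ b x -> subpred b a -> count b s < count a s.
Proof.
move=> + ax bx ba; elim: s => //= y s IHs; rewrite inE => /orP[/eqP<-|/IHs lt].
  by rewrite ax (negPf bx) add0n add1n ltnS sub_count.
rewrite -addnS leq_add //; first by case E: (b y) => //; rewrite (ba _ E).
Qed.

(** * Removing cyclic triples by changing the side of one terminal *)

Section Flip.

(** Sides are read clockwise at each terminal, so equal values at the two ends are geometrically
    opposite sides. A line running along [l] and beyond both of its ends forces different values. *)
Definition unbalanced (s : line -> V -> bool) l : bool :=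
  [exists x, exists y, [&& x != y, terminal l x, terminal l y & s l x == s l y]].

Variables (s : line -> V -> bool) (R : line -> line -> V -> V -> bool).
Hypothesis sol : solution s R.

(** [b] ends with [p] at [x] and goes on beyond [y], [c] the other way round; [x'] and [y'] are the
    neighbours of the two ends on [p]. *)
Record nested p b c x x' y y' : Prop := Nested {
  nestedI : [/\ p \in lines I, b \in lines I & c \in lines I];
  nested_neq : [/\ p != b, b != c & c != p];
  nested_p : [/\ terminal p x, terminal p y, x != y, uses_edge x x' p &
                uses_edge y y' p];
  nested_b : terminal b x /\ intermediate b y;
  nested_c : intermediate c x /\ terminal c y;
  nested_cyc u v : uses_edge u v p -> cyclic_triple R p b c u v }.

Lemma compatible_ext t l m r r' :
  (forall u v, uses_edge u v l -> uses_edge u v m -> r u v = r' u v) ->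
  compatible t l m r -> compatible t l m r'.
Proof.
move=> E [cE cV cS cL cR cM]; split=> //.
- move=> u v lu mu; have [lv mv] : uses_edge v u l /\ uses_edge v u m.
    by rewrite !(uses_edgeC v).
  by rewrite -(E u v lu mu) -(E v u lv mv); apply: cE.
- by move=> u v w vw lv mv lw mw; rewrite -(E u v lv mv) -(E u w lw mw); exact: cV.
- by move=> u v d e dv ev de lv mv ld me; rewrite -(E u v lv mv); exact: cS.
- by move=> u v lu mu lt mi; rewrite -(E u v lu mu); exact: (cL u v).
by move=> u v lu mu li mt; rewrite -(E u v lu mu); exact: (cR u v).
Qed.

Section Stretch.

Variables (w : seq V) (x0 : V).
Hypotheses (w2 : 1 < size w) (Uw : uniq w).

Let x := nth x0 w 0.
Let x' := nth x0 w 1.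
Let y := nth x0 w (size w).-1.
Let y' := nth x0 w (size w).-2.

Lemma stretch_first : uses_edge x x' w.
Proof. by rewrite uses_edge_index // !index_uniq // ?mem_nth // ltnW. Qed.

Lemma stretch_ends : [/\ x != y, terminal w x & terminal w y].
Proof.
have w0 := ltnW w2; have wl : (size w).-1 < size w by rewrite prednK.
split; first by rewrite nth_uniq //; move: w2; case: (size w) => [|[]].
  by rewrite terminal_index // mem_nth // index_uniq.
by rewrite terminal_index // mem_nth // index_uniq // prednK // eqxx orbT.
Qed.

Lemma stretch_edge (P : V -> V -> Prop) : (forall u v, P u v -> P v u) ->
  (forall i, i.+1 < size w -> P (nth x0 w i) (nth x0 w i.+1)) ->
  forall u v, uses_edge u v w -> P u v.
Proof.
move=> sym H u v; rewrite uses_edge_index // => /and3P[uw vw /orP[] /eqP E].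
  by have := H (index u w); rewrite -E index_mem !nth_index //; apply.
by have := H (index v w); rewrite -E index_mem !nth_index // => /(_ uw)/sym.
Qed.

Lemma stretch_line p : p \in lines I -> terminal p x -> terminal p y ->
  (forall u v, uses_edge u v w -> uses_edge u v p) ->
  forall u v, uses_edge u v p = uses_edge u v w.
Proof.
move=> pI px py sub u v; have [xy wx wy] := stretch_ends.
apply/idP/idP; last exact: sub.
exact: (same_ends_edges Uw pI xy wx wy px py stretch_first).
Qed.

Lemma stretch_line_uniq p q : p \in lines I -> q \in lines I ->
  terminal p x -> terminal p y -> terminal q x -> terminal q y ->
  (forall u v, uses_edge u v w -> uses_edge u v p) ->
  (forall u v, uses_edge u v w -> uses_edge u v q) -> p = q.
Proof.
move=> pI qI px py qx qy subp subq.
apply: (same_edges_eq pI qI (subp _ _ stretch_first)) => u v.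
by rewrite (stretch_line pI) // (stretch_line qI).
Qed.

Lemma nested_of_stretch p b c :
  p \in lines I -> b \in lines I -> c \in lines I -> p != b -> b != c -> c != p ->
  (forall u v, uses_edge u v w -> cyclic_triple R p b c u v) ->
  terminal p x -> terminal p y -> terminal b x -> terminal c y ->
  nested p b c x x' y y'.
Proof.
move=> pI bI cI pb bc cp C px py bx cy; have [xy wx wy] := stretch_ends.
have subp u v : uses_edge u v w -> uses_edge u v p by case/C.
have subb u v : uses_edge u v w -> uses_edge u v b by case/C.
have subc u v : uses_edge u v w -> uses_edge u v c by case/C.
have ww : uses_edge y y' w.
  have s2 : (size w).-2 < size w by move: w2; case: (size w) => [|[]] //= n _; apply: leqW.
  have s1 : (size w).-1 < size w by rewrite prednK // ltnW.
  rewrite uses_edge_index // !index_uniq // !mem_nth //=.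
  by move: w2; case: (size w) => [|[]] //= n _; rewrite eqxx orbT.
split=> //; first by split=> //; apply: subp => //; apply: stretch_first.
- split=> //; rewrite (line_terminalVintermediate (subb _ _ ww)); apply/negP=> b_y.
  by move: pb; rewrite (stretch_line_uniq pI bI) ?eqxx.
- split=> //; rewrite (line_terminalVintermediate (subc _ _ stretch_first)).
  by apply/negP=> cx; move: cp; rewrite (stretch_line_uniq cI pI) ?eqxx.
by move=> u v; rewrite (stretch_line pI px py subp) => /C.
Qed.

End Stretch.

(** Two of the three lines end at either end of the stretch. The two pairs differ, so exactly one
    line is in both and serves as [p]; the cases list which one. *)
Lemma nested_of_cyclic l m n u v : l \in lines I -> m \in lines I -> n \in lines I ->
  l != m -> m != n -> n != l -> cyclic_triple R l m n u v ->
  exists p b c x x' y y', nested p b c x x' y y'.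
Proof.
move=> lI mI nI lm mn nl C.
have [w [x0 [w2 Uw Cw X Y]]] := cyclic_stretch sol lI mI nI lm mn nl C.
have ml : m != l by rewrite eq_sym.
have nm : n != m by rewrite eq_sym.
have ln : l != n by rewrite eq_sym.
have Clmn a b : uses_edge a b w -> cyclic_triple R l m n a b.
  apply: (@stretch_edge w x0 Uw (cyclic_triple R l m n)) => // c d.
  exact: (cyclic_edge sol).
have Cmnl a b : uses_edge a b w -> cyclic_triple R m n l a b by move/Clmn/cyclic_rot.
have Cnlm a b : uses_edge a b w -> cyclic_triple R n l m a b by move/Cmnl/cyclic_rot.
have Cmln a b : uses_edge a b w -> cyclic_triple R m l n a b.
  by move/Clmn/(cyclic_swap sol lI mI nI lm mn nl).
have Cnml a b : uses_edge a b w -> cyclic_triple R n m l a b.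
  by move/Cmnl/(cyclic_swap sol mI nI lI mn nl lm).
have Clnm a b : uses_edge a b w -> cyclic_triple R l n m a b.
  by move/Cnlm/(cyclic_swap sol nI lI mI nl lm mn).
have subl a b : uses_edge a b w -> uses_edge a b l by case/Clmn.
have subm a b : uses_edge a b w -> uses_edge a b m by case/Clmn.
have subn a b : uses_edge a b w -> uses_edge a b n by case/Clmn.
case: X => -[X1 X2]; case: Y => -[Y1 Y2].
- by move: lm; rewrite (stretch_line_uniq w2 Uw lI mI X1 Y1) ?eqxx.
- exists m, l, n, (nth x0 w 0), (nth x0 w 1), (nth x0 w (size w).-1),
    (nth x0 w (size w).-2).
  exact: nested_of_stretch.
- exists l, m, n, (nth x0 w 0), (nth x0 w 1), (nth x0 w (size w).-1),
    (nth x0 w (size w).-2).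
  exact: nested_of_stretch.
- exists m, n, l, (nth x0 w 0), (nth x0 w 1), (nth x0 w (size w).-1),
    (nth x0 w (size w).-2).
  exact: nested_of_stretch.
- by move: mn; rewrite (stretch_line_uniq w2 Uw mI nI X1 Y1) ?eqxx.
- exists n, m, l, (nth x0 w 0), (nth x0 w 1), (nth x0 w (size w).-1),
    (nth x0 w (size w).-2).
  exact: nested_of_stretch.
- exists l, n, m, (nth x0 w 0), (nth x0 w 1), (nth x0 w (size w).-1),
    (nth x0 w (size w).-2).
  exact: nested_of_stretch.
- exists n, l, m, (nth x0 w 0), (nth x0 w 1), (nth x0 w (size w).-1),
    (nth x0 w (size w).-2).
  exact: nested_of_stretch.
by move: nl; rewrite (stretch_line_uniq w2 Uw nI lI X1 Y1) ?eqxx.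
Qed.

Section FlipOne.

Variables (p b c : line) (x x' y y' : V).
Hypothesis N : nested p b c x x' y y'.

(** The reversals along the edge and across the vertex cancel. *)
Lemma nested_along m u v w : m \in lines I -> m != p -> u != w ->
  uses_edge v u p -> uses_edge v w p -> uses_edge v u m -> uses_edge v w m ->
  R p m v w = R p m u v.
Proof.
move=> mI mp uw up wp um wm; have [[pI _ _] _ _ _ _ _] := N.
have [[cE cV _ _ _ _] _] : compatible s p m (R p m) /\ True.
  by split=> //; apply: (sol pI mI _).1; rewrite eq_sym.
by rewrite (cE v u) // -(cV v w u) // eq_sym.
Qed.

(** At [x] the line [c] passes between [p] and [b], because the triple is cyclic. The order of [p]
    and [b] is carried along [p] to [y], where [b] passes and determines the side of [p]. *)
Lemma nested_sides : s b x = ~~ s p x /\ s p x = s p y.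
Proof.
case: N => -[pI bI cI] [pb bc cp] [px py xy xx' yy'] [bx iby] [icx cy] C.
have [xp xb xc E1 E2] := C _ _ xx'.
have Epc := compat_right (sol cI pI cp).1 xc xp icx px.
have Ebc := compat_left (sol bI cI bc).1 xb xc bx icx.
have sb : s b x = ~~ s p x by rewrite -[LHS]negbK -Ebc E2 Epc.
split=> //; have bp : b != p by rewrite eq_sym.
have pbp u v : uses_edge u v p -> uses_edge u v b by case/C.
have yx : y != x by rewrite eq_sym.
have [||_ /(_ y y' py yx yy') H] := @line_ind p x x'
  (fun u v => R p b u v = s p x) (line_uniq pI) px xx'.
- by rewrite E1 E2 Epc.
- move=> u v w uw up wp <-.
  by apply: (nested_along bI bp uw up wp); apply: pbp.
have C1 := (sol pI bI pb).1.
rewrite -H -[LHS]negbK -(compat_edge C1 _ (pbp _ _ _)) 1?uses_edgeC //.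
by rewrite (compat_left C1 yy' (pbp _ _ yy') py iby) negbK.
Qed.

(* The side of [p] at [x] only matters for lines that leave the stretch nowhere and
   end at [y] together with [p]. *)
Lemma nested_loose m : m \in lines I -> m != p -> intermediate m x ->
  uses_edge x x' m -> (forall u v, uses_edge u v p -> uses_edge u v m) /\ terminal m y.
Proof.
move=> mI mp imx xx'm; have [sb sp] := nested_sides.
case: (N) => -[pI bI cI] [pb bc cp] [px py xy xx' yy'] [bx iby] [icx cy] C.
have pm : p != m by rewrite eq_sym.
have bm : b != m by apply: contraTneq imx => <-; rewrite /intermediate bx andbF.
have [Cp Cb] := ((sol pI mI pm).1, (sol bI mI bm).1).
have pbp u v : uses_edge u v p -> uses_edge u v b by case/C.
(* Along [p], the line [m] stays between [p] and [b], which lie on different sides of it at [x]. *)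
pose P u v := [/\ uses_edge u v m, R p m u v = ~~ s p x & R b m u v = s p x].
have yx : y != x by rewrite eq_sym.
have [||sub /(_ y y' py yx yy') Pyy'] := @line_ind p x x' P (line_uniq pI) px xx'.
- split=> //; first by rewrite (compat_left Cp xx' xx'm px imx).
  by rewrite (compat_left Cb (pbp _ _ xx') xx'm bx imx) sb negbK.
- move=> u v w uw up wp [um Epm Ebm].
  have um' : uses_edge v u m by rewrite uses_edgeC.
  have bu := pbp _ _ up; have bw := pbp _ _ wp.
  have Rp : R p m v u = s p x by rewrite (compat_edge Cp) ?Epm ?negbK // uses_edgeC.
  have Rb : R b m v u = ~~ s p x by rewrite (compat_edge Cb) ?Ebm // uses_edgeC.
  have ipv : intermediate p v.
    rewrite (line_terminalVintermediate up); apply/negP=> pv.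
    by move: uw; rewrite (terminal_port pI pv up wp) eqxx.
  have ibv : intermediate b v.
    rewrite (line_terminalVintermediate bu); apply/negP=> bv.
    by move: uw; rewrite (terminal_port bI bv bu bw) eqxx.
  (* Both [p] and [b] pass [v], so a line ending there would have the same order with both. *)
  case: (boolP (terminal m v)) => [mv|].
    move: Rp Rb; rewrite (compat_right Cp up um' ipv mv) (compat_right Cb bu um' ibv mv).
    by move=> ->; case: (s p x).
  rewrite -(line_terminalVintermediate um') => imv.
  have [q qu qm] := intermediate_port (line_uniq mI) imv um'.
  have wu : w != u by rewrite eq_sym.
  case: (eqVneq w q) => [E|wq].
    subst q; split=> //; first by rewrite (compat_vertex Cp wu) // Rp.
    by rewrite (compat_vertex Cb wu) // Rb negbK.
  (* Turning off from [p] and [b] at once, [m] would again have the same order with both. *)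
  move: Rp Rb; rewrite (compat_split Cp wu qu wq up um' wp qm).
  by rewrite (compat_split Cb wu qu wq bu um' bw qm) => ->; case: (s p x).
have contained u v : uses_edge u v p -> uses_edge u v m.
  by case/sub=> -[//]; rewrite uses_edgeC.
split=> //; have [yy'm Epm _] := Pyy'.
(* If [m] went on beyond [y], its order with [p] would force different sides of [p] at [x] and [y],
   contrary to [sp]. *)
apply/negPn; rewrite -(line_terminalVintermediate (contained _ _ yy')); apply/negP=> imy.
have := compat_left Cp yy' (contained _ _ yy') py imy.
rewrite (compat_edge Cp (u := y')) ?Epm ?negbK //; last by rewrite uses_edgeC.
by rewrite -sp; case: (s p x).
Qed.

(** The lines whose order with [p] is dictated by the side of [p] at [x]. *)
Let flips m : bool :=
  [&& m \in lines I, m != p, intermediate m x & uses_edge x x' m].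

Definition flip_side l z : bool := s l z (+) ((l == p) && (z == x)).

Definition flip_order l m u v : bool :=
  R l m u v (+) ((l == p) && flips m) (+) ((m == p) && flips l).

Lemma flip_compatible_other l m : l \in lines I -> m \in lines I -> l != m ->
  l != p -> m != p -> compatible flip_side l m (flip_order l m).
Proof.
move=> lI mI lm lp mp; have [cE cV cS cL cR cM] := (sol lI mI lm).1.
have E u v : flip_order l m u v = R l m u v.
  by rewrite /flip_order (negPf lp) (negPf mp) !addbF.
have [El Em] : (forall z, flip_side l z = s l z) /\ (forall z, flip_side m z = s m z).
  by rewrite /flip_side (negPf lp) (negPf mp); split=> z; rewrite addbF.
split=> *; rewrite ?E ?El ?Em; eauto.
Qed.

(** For a flipped [m] all of [p] lies in [m], so the two never part, and both end at [y]; the only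
    side in play is that of [p] at [x]. For any other [m] the clauses never consult this side. *)
Lemma flip_compatible m : m \in lines I -> m != p ->
  compatible flip_side p m (flip_order p m).
Proof.
move=> mI mp; have [[pI _ _] _ [px py xy xx' yy'] _ _ _] := N.
have pm : p != m by rewrite eq_sym.
have [cE cV cS cL cR cM] := (sol pI mI pm).1.
have Em z : flip_side m z = s m z by rewrite /flip_side (negPf mp) addbF.
case: (boolP (flips m)) => [fm|nfm]; last first.
  have E u v : flip_order p m u v = R p m u v.
    by rewrite /flip_order eqxx (negPf nfm) (negPf mp) !addbF.
  split; try by move=> *; rewrite ?E ?Em; eauto.
  move=> u v pu mu pt mi; rewrite E (cL u v) // /flip_side eqxx.
  case: (eqVneq u x) => [ux|_]; last by rewrite addbF.
  subst u; case/negP: nfm; rewrite /flips mI mp mi.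
  by rewrite (terminal_port pI px xx' pu).
have [_ _ imx xx'm] := and4P fm; have [sub my] := nested_loose mI mp imx xx'm.
have E u v : flip_order p m u v = ~~ R p m u v.
  by rewrite /flip_order eqxx fm (negPf mp) addbF addbT.
split.
- by move=> u v pu mu; rewrite !E cE.
- by move=> u v w vw pv mv pw mw; rewrite !E (cV u v w).
- move=> u v a d av dv ad pv mv pa md.
  have va : v != a by rewrite eq_sym.
  have [dv'|da] := ports_le2 mI va (sub _ _ pv) (sub _ _ pa) md.
    by move: dv; rewrite dv' eqxx.
  by move: ad; rewrite da eqxx.
- move=> u v pu mu pt mi; rewrite E (cL u v) // /flip_side eqxx.
  have [->|uy] := two_terminals (line_uniq pI) xy px py pt; first by rewrite eqxx addbT.
  by move: mi; rewrite uy /intermediate my andbF.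
- move=> u v pu mu pi mt.
  have [w wv pw] := intermediate_port (line_uniq pI) pi pu.
  by move: wv; rewrite (terminal_port mI mt (sub _ _ pu) (sub _ _ pw)) eqxx.
exact: cM.
Qed.

Lemma flip_order_swap l m u v : l \in lines I -> m \in lines I -> l != m ->
  uses_edge u v l -> uses_edge u v m -> flip_order m l u v = ~~ flip_order l m u v.
Proof.
move=> lI mI lm lu mu; rewrite /flip_order (sol lI mI lm).2 //.
by rewrite !addNb addbAC.
Qed.

Lemma flip_solution : solution flip_side flip_order.
Proof.
move=> l m lI mI lm; split; last by move=> *; apply: flip_order_swap.
have ml : m != l by rewrite eq_sym.
have [pI _ _] := nestedI N.
case: (eqVneq l p) => [lp|lp]; first by rewrite lp in ml *; apply: flip_compatible.
case: (eqVneq m p) => [mp|mp]; last exact: flip_compatible_other.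
subst m; apply: compatible_ext (compatible_swap lI pI (flip_compatible lI lp)).
by move=> u v lu pu; rewrite -flip_order_swap.
Qed.

(** Only [p] changes, and at just one of its two ends, so [p] leaves the count. *)
Lemma flip_unbalanced :
  count (unbalanced flip_side) (lines I) < count (unbalanced s) (lines I).
Proof.
have [_ sp] := nested_sides; have [[pI _ _] _ [px py xy _ _] _ _ _] := N.
have sub l : unbalanced flip_side l -> unbalanced s l && (l != p).
  case: (eqVneq l p) => [->|lp]; last first.
    move=> /existsP[a /existsP[d H]]; rewrite andbT; apply/existsP; exists a.
    by apply/existsP; exists d; move: H; rewrite /flip_side (negPf lp) !addbF.
  move=> /existsP[a /existsP[d /and4P[ad ta td]]]; rewrite /flip_side !eqxx /=.
  have yx : (y == x) = false by rewrite eq_sym (negPf xy).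
  have [E|E] := two_terminals (line_uniq pI) xy px py ta;
  have [F|F] := two_terminals (line_uniq pI) xy px py td;
  move: ad; rewrite E F ?eqxx // ?yx sp => _; rewrite addbF addbT.
    by case: (s p y).
  by case: (s p y).
have up : unbalanced s p.
  by apply/existsP; exists x; apply/existsP; exists y; rewrite xy px py sp eqxx.
apply: (count_ltn pI up) => [|l /sub/andP[] //].
by apply/negP=> /sub; rewrite eqxx andbF.
Qed.

End FlipOne.

End Flip.


Lemma acyclic_solution (s : line -> V -> bool) (R : line -> line -> V -> V -> bool) :
  solution s R -> exists s' R', solution s' R' /\
  forall u v l m n, l \in lines I -> m \in lines I ->
  n \in lines I -> l != m -> m != n -> n != l ->
  uses_edge u v l -> uses_edge u v m -> uses_edge u v n ->
  R' l m u v -> R' m n u v -> R' l n u v.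
Proof.
have [k] := ubnP (count (unbalanced s) (lines I)).
elim: k s R => // k IHk s R; rewrite ltnS => sk sol.
case: (classic (exists p b c x x' y y', nested R p b c x x' y y')) => [|none].
  case=> [p [b [c [x [x' [y [y' N]]]]]]].
  exact: IHk (leq_trans (flip_unbalanced sol N) sk) (flip_solution sol N).
exists s, R; split=> // u v l m n lI mI nI lm mn nl lu mu nu Rlm Rmn.
apply/negPn/negP => Rln; apply: none.
apply: (nested_of_cyclic sol lI mI nI lm mn nl (u := u) (v := v)).
have ln : l != n by rewrite eq_sym.
by split; rewrite ?Rlm // (sol l n lI nI ln).2 // Rmn (negPf Rln).
Qed.

Theorem layout_iff_solution :
  has_crossing_free_periphery_layout I <->
  exists (s : line -> V -> bool) (R : line -> line -> V -> V -> bool), solution s R.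
Proof.
split=> [[pi [cf per]]|[s [R /acyclic_solution[s' [R' [sol acy]]]]]].
  by have [[L _] _ _] := cf; apply: solution_of_layout per.
exact: layout_of_solution sol acy.
Qed.


(** * Compatibility of two lines as the outcome of a walk *)

Definition code v : nat := (val v).+1.
Definition pc l u : nat := pcode (map val l) (val u).
Definition nc l u : nat := ncode (map val l) (val u).

Lemma code_inj : injective code.
Proof. by move=> u v [] /val_inj. Qed.

Lemma index_val (s : seq V) u : index (val u) (map val s) = index u s.
Proof. exact: index_map val_inj _ _. Qed.

Lemma mem_val (s : seq V) u : (val u \in map val s) = (u \in s).
Proof. exact: mem_map val_inj _ _. Qed.

Lemma pcE l u : pc l u =
  if (u \in l) && (0 < index u l) then code (nth u l (index u l).-1) else 0.
Proof.
rewrite /pc /pcode index_val mem_val; case: andP => // -[ul iu].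
by rewrite (nth_map u) //; move: ul; rewrite -index_mem; apply: leq_ltn_trans (leq_pred _).
Qed.

Lemma ncE l u : nc l u =
  if (u \in l) && ((index u l).+1 < size l) then code (nth u l (index u l).+1) else 0.
Proof.
rewrite /nc /ncode index_val mem_val size_map; case: andP => // -[ul iu].
by rewrite (nth_map u).
Qed.

Section Line.

Variable l : line.
Hypothesis Ul : uniq l.

Lemma uses_edge_code u v : uses_edge u v l = (code v == pc l u) || (code v == nc l u).
Proof.
rewrite uses_edge_index // pcE ncE; case: (boolP (u \in l)) => //= ul.
have szu := ul; rewrite -index_mem in szu.
apply/andP/orP => [[vl /orP[] /eqP E]|].
- by right; rewrite -E index_mem vl nth_index.
- by left; rewrite E /= nth_index.
case; case: ifP => // iu /eqP/code_inj ->; rewrite mem_nth ?index_uniq ?eqxx //.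
- by rewrite prednK // eqxx orbT.
- exact: leq_ltn_trans (leq_pred _) szu.
exact: leq_ltn_trans (leq_pred _) szu.
Qed.

Lemma pc_decode u : pc l u != 0 -> exists v, pc l u = code v.
Proof. by rewrite pcE; case: ifP => // _ _; exists (nth u l (index u l).-1). Qed.

Lemma nc_decode u : nc l u != 0 -> exists v, nc l u = code v.
Proof. by rewrite ncE; case: ifP => // _ _; exists (nth u l (index u l).+1). Qed.

Lemma pc_neq_nc u : pc l u != 0 -> pc l u != nc l u.
Proof.
rewrite pcE ncE; case: ifP => // /andP[ul iu] _; case: ifP => // /andP[_ iu1].
apply/eqP=> /code_inj /eqP; rewrite nth_uniq //; first by move: iu; clear; index_lia.
by rewrite (leq_ltn_trans (leq_pred _)) // index_mem.
Qed.

Lemma terminal_code u : u \in l -> terminal l u = (pc l u == 0) || (nc l u == 0).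
Proof.
move=> ul; have := ul; rewrite -index_mem terminal_index // pcE ncE ul /=.
case: (index u l) => [|i] // iu.
move: iu; rewrite leq_eqVlt => /orP[/eqP->|lt].
  by rewrite eqxx ltnn.
by rewrite lt (ltn_eqF lt).
Qed.

End Line.

(* The code of the neighbour of [u] on [l] other than [v], [0] if there is none. *)
Definition far l u v : nat := other (code v) (pc l u) (nc l u).

Lemma far_terminal l u v : uniq l -> uses_edge u v l ->
  (far l u v == 0) = terminal l u.
Proof.
move=> Ul uv; rewrite terminal_code ?(uses_edge_mem uv) // /far /other.
move: uv; rewrite uses_edge_code // => /orP[] /eqP E; rewrite -E ?eqxx //.
case: (eqVneq (code v) (pc l u)) => [E2|_]; last by case: (pc l u == 0).
by have := pc_neq_nc Ul (u := u); rewrite -E2 -E eqxx => /(_ isT).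
Qed.

Lemma far_port l u v w : uniq l -> uses_edge u v l -> w != v -> uses_edge u w l ->
  far l u v = code w.
Proof.
move=> Ul + wv; rewrite !uses_edge_code // /far /other => uv uw.
have cwv : code w != code v by apply: contra wv => /eqP/code_inj->.
have [E|ne] := eqVneq (code v) (pc l u); first by move: uw; rewrite -E (negPf cwv) => /eqP.
move: uv uw; rewrite (negPf ne) /= => /eqP<-.
by rewrite (negPf cwv) orbF => /eqP.
Qed.

Definition rank u (c : nat) : nat := index c.-1 (map val (nbrs u)).

Lemma rank_code u v : rank u (code v) = index v (nbrs u).
Proof. exact: index_val. Qed.

Section Pair.

Variables (l m : line) (na nb : nat) (f : nat -> bool) (s : line -> V -> bool).
Hypotheses (lI : l \in lines I) (mI : m \in lines I) (lm : l != m).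
Hypotheses (na0 : na != 0) (nb0 : nb != 0) (f1 : f 1 = false).
Hypothesis fl : forall u, terminal l u -> f (na + (pc l u != 0)) = s l u.
Hypothesis fm : forall u, terminal m u -> f (nb + (pc m u != 0)) = s m u.

Let Ul := line_uniq lI.
Let Um := line_uniq mI.

(** The value of [l] before [m] at the port of [u] towards [v], when their common stretch ends at
    [u]. *)
Definition port_literal u v : literal :=
  split_literal (na + (pc l u != 0)) (nb + (pc m u != 0)) (far l u v) (far m u v)
    (cyclic3 (rank u (code v)) (rank u (far m u v)) (rank u (far l u v))).

Let ev u := vertex_event (rank u) na nb (pc l u) (nc l u) (pc m u) (nc m u).

Lemma shares_code u v : shares (pc l u) (nc l u) (code v) = uses_edge u v l.
Proof. by rewrite uses_edge_code. Qed.

Lemma literal_left u v : uses_edge u v l -> uses_edge u v m -> terminal l u ->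
  intermediate m u ->
  (port_literal u v).1 <> 0 /\ lit_val f (port_literal u v) = ~~ s l u.
Proof.
move=> ul um lt mi; rewrite /port_literal /split_literal far_terminal // lt.
rewrite far_terminal // -[terminal m u]negbK -(line_terminalVintermediate um) mi /=.
by rewrite /lit_val /= fl // addbT; split=> // /eqP; rewrite addn_eq0 (negPf na0).
Qed.

Lemma literal_right u v : uses_edge u v l -> uses_edge u v m -> intermediate l u ->
  terminal m u ->
  (port_literal u v).1 <> 0 /\ lit_val f (port_literal u v) = s m u.
Proof.
move=> ul um li mt; rewrite /port_literal /split_literal far_terminal //.
rewrite -[terminal l u]negbK -(line_terminalVintermediate ul) li far_terminal // mt /=.
by rewrite /lit_val /= fm // addbF; split=> // /eqP; rewrite addn_eq0 (negPf nb0).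
Qed.

Lemma literal_split u v b c : b != v -> c != v -> uses_edge u v l -> uses_edge u v m ->
  uses_edge u b l -> uses_edge u c m ->
  (port_literal u v).1 <> 0 /\ lit_val f (port_literal u v) = turn u v c b.
Proof.
move=> bv cv ul um ub uc; rewrite /port_literal /split_literal.
rewrite (far_port Ul ul bv ub) (far_port Um um cv uc) /= !rank_code /lit_val /= f1.
by [].
Qed.

Lemma literal_none u v : uses_edge u v l -> uses_edge u v m -> terminal l u ->
  terminal m u -> (port_literal u v).1 = 0.
Proof.
move=> ul um lt mt; rewrite /port_literal /split_literal.
by rewrite !far_terminal // lt mt.
Qed.

Lemma literal_compatible r u v : compatible s l m r ->
  uses_edge u v l -> uses_edge u v m ->
  (forall w, w != v -> uses_edge u w l -> ~~ uses_edge u w m) ->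
  (port_literal u v).1 <> 0 -> r u v = lit_val f (port_literal u v).
Proof.
move=> C ul um nsh; case: (boolP (terminal l u)) => tl; case: (boolP (terminal m u)) => tm.
- by rewrite literal_none.
- have im : intermediate m u by rewrite (line_terminalVintermediate um).
  by rewrite (literal_left ul um tl im).2 (compat_left C ul um).
- have il : intermediate l u by rewrite (line_terminalVintermediate ul).
  by rewrite (literal_right ul um il tm).2 (compat_right C ul um).
have im : intermediate m u by rewrite (line_terminalVintermediate um).
have il : intermediate l u by rewrite (line_terminalVintermediate ul).
have [b bv ub] := intermediate_port Ul il ul.
have [c cv uc] := intermediate_port Um im um.
have bc : b != c by apply: contraNneq (nsh b bv ub) => ->.
by rewrite (literal_split bv cv ul um ub uc).2 (compat_split C bv cv bc).
Qed.

Lemma shares_decode u c : c = pc m u \/ c = nc m u -> shares (pc l u) (nc l u) c ->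
  exists v, [/\ c = code v, uses_edge u v l & uses_edge u v m].
Proof.
move=> cm sh; have [c0 _] := andP sh; have [v E] : exists v, c = code v.
  by case: cm c0 => ->; [apply: pc_decode | apply: nc_decode].
exists v; split=> //; first by rewrite -shares_code -E.
by rewrite uses_edge_code // -E; case: cm => ->; rewrite eqxx ?orbT.
Qed.

Lemma event_parallel u v w : v != w -> uses_edge u v l -> uses_edge u w l ->
  uses_edge u v m -> uses_edge u w m -> ev u = Cont.
Proof.
move=> vw lv lw mv mw; rewrite /ev /vertex_event.
have cvw : code v != code w by apply: contra vw => /eqP/code_inj->.
have [-> ->] : shares (pc l u) (nc l u) (pc m u) /\ shares (pc l u) (nc l u) (nc m u).
  move: mv mw; rewrite !uses_edge_code // => /orP[] /eqP Ev /orP[] /eqP Ew.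
  - by move: cvw; rewrite Ev Ew eqxx.
  - by rewrite -Ev -Ew !shares_code.
  - by rewrite -Ev -Ew !shares_code.
  by move: cvw; rewrite Ev Ew eqxx.
by [].
Qed.

Lemma event_end u v : uses_edge u v l -> uses_edge u v m ->
  (forall w, w != v -> uses_edge u w l -> ~~ uses_edge u w m) ->
  ev u = if code v == pc m u then Stop (port_literal u v)
         else Start (port_literal u v).
Proof.
move=> lv mv nsh; rewrite /ev /vertex_event.
have nshc c : c = pc m u \/ c = nc m u -> c != code v ->
    shares (pc l u) (nc l u) c = false.
  move=> cm cv; apply/negP => /(shares_decode cm)[w [E lw mw]].
  have wv : w != v by apply: contraNneq cv => <-; rewrite E.
  by have := nsh w wv lw; rewrite mw.
have farE : far m u v = if code v == pc m u then nc m u else pc m u by [].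
case: (eqVneq (code v) (pc m u)) farE => [E|E] farE.
  rewrite -{1}E shares_code lv nshc; last first.
  - by rewrite E eq_sym pc_neq_nc // -E.
  - by right.
  by rewrite /end_literal /port_literal /far -/(far m u v) farE -E.
move: mv; rewrite uses_edge_code // (negPf E) /= => /eqP E2.
rewrite nshc; [|by left|by rewrite eq_sym].
by rewrite -{1}E2 shares_code lv /end_literal /port_literal /far -/(far m u v) farE -E2.
Qed.

Lemma cyclic3_rev x y z : x != y -> y != z -> x != z ->
  cyclic3 z y x = ~~ cyclic3 x y z.
Proof.
rewrite /cyclic3; case: (ltngtP x y) => // ? _; case: (ltngtP y z) => // ? _;
case: (ltngtP x z) => // ? _; rewrite //=; clear; lia.
Qed.

Lemma turn_rev u a b c : a != b -> b != c -> a != c -> uses_edge u a l ->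
  uses_edge u b m -> uses_edge u c l -> turn u c b a = ~~ turn u a b c.
Proof.
move=> ab bc ac la mb lc; apply: cyclic3_rev; apply/eqP.
- by move/(index_inj a (uses_edge_adj lI la) (uses_edge_adj mI mb)) => E; rewrite E eqxx in ab.
- by move/(index_inj a (uses_edge_adj mI mb) (uses_edge_adj lI lc)) => E; rewrite E eqxx in bc.
by move/(index_inj a (uses_edge_adj lI la) (uses_edge_adj lI lc)) => E; rewrite E eqxx in ac.
Qed.

(** Reversing [l] negates both turns and reversing [m] exchanges them, so the outcome does not
    depend on the directions in which the lines are read. *)
Lemma event_meet u a b c d : uniq [:: a; b; c; d] ->
  uses_edge u a l -> uses_edge u b l -> uses_edge u c m -> uses_edge u d m ->
  ev u = Meet (turn u a c b != turn u a d b).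
Proof.
rewrite /= !inE !negb_or => /and4P[/and3P[ab ac ad] /andP[bc bd] cd _] la lb mc md.
have code_neq x y : x != y -> code x != code y.
  by apply: contra => /eqP/code_inj->.
have notl x : (code x == pc l u) || (code x == nc l u) -> x != a -> x != b -> False.
  rewrite -uses_edge_code // => lx xa xb.
  by have [E|E] := ports_le2 lI ab la lb lx; [move: xa|move: xb]; rewrite E eqxx.
have nshc c' x : c' = code x -> x != a -> x != b -> shares (pc l u) (nc l u) c' = false.
  by move=> -> xa xb; apply/negP=> /andP[_ /notl]; apply.
have [ca cb] : c != a /\ c != b by rewrite (eq_sym c a) (eq_sym c b).
have [da db] : d != a /\ d != b by rewrite (eq_sym d a) (eq_sym d b).
have Cab := code_neq _ _ ab; have Ccd := code_neq _ _ cd.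
have El : (pc l u = code a /\ nc l u = code b) \/ (pc l u = code b /\ nc l u = code a).
  move: la lb; rewrite !uses_edge_code // => /orP[] /eqP E /orP[] /eqP E'.
  - by move: Cab; rewrite E E' eqxx.
  - by left.
  - by right.
  by move: Cab; rewrite E E' eqxx.
have Em : (pc m u = code c /\ nc m u = code d) \/ (pc m u = code d /\ nc m u = code c).
  move: mc md; rewrite !uses_edge_code // => /orP[] /eqP E /orP[] /eqP E'.
  - by move: Ccd; rewrite E E' eqxx.
  - by left.
  - by right.
  by move: Ccd; rewrite E E' eqxx.
have -> : ev u = Meet (cyclic3 (rank u (pc l u)) (rank u (pc m u)) (rank u (nc l u)) !=
    cyclic3 (rank u (pc l u)) (rank u (nc m u)) (rank u (nc l u))).
  rewrite /ev /vertex_event.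
  have -> : shares (pc l u) (nc l u) (pc m u) = false.
    by case: Em => -[E _]; apply: nshc E _ _.
  have -> : shares (pc l u) (nc l u) (nc m u) = false.
    by case: Em => -[_ E]; apply: nshc E _ _.
  by case: El => -[-> ->]; case: Em => -[-> ->].
congr Meet; have rev e : e != a -> e != b -> uses_edge u e m ->
    turn u b e a = ~~ turn u a e b.
  by move=> ea eb me; apply: turn_rev; rewrite // eq_sym.
case: El => -[-> ->]; case: Em => -[-> ->]; rewrite !rank_code -!/(turn _ _ _ _) ?rev //.
- by rewrite eq_sym.
- by case: turn; case: turn.
by case: turn; case: turn.
Qed.

(** [a] and [b] are the values before and after [u]. They are taken to be false off the common
    stretches, so that [Idle] and [Meet] keep the value. *)
Lemma compatible_event r u a b : compatible s l m r ->
  (forall v, pc m u = code v -> a = uses_edge u v l && r v u) ->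
  (pc m u = 0 -> a = false) ->
  (forall v, nc m u = code v -> b = uses_edge u v l && r u v) ->
  (nc m u = 0 -> b = false) -> event_ok f (ev u) a b.
Proof.
move=> C ap a0 bn b0; have pn := @pc_neq_nc m Um u.
have ports v w : code v = pc m u \/ code v = nc m u -> w != v -> uses_edge u w m ->
    code w = if code v == pc m u then nc m u else pc m u.
  move=> cv wv; rewrite uses_edge_code //.
  have cwv : code w != code v by apply: contra wv => /eqP/code_inj->.
  case: (eqVneq (code v) (pc m u)) => [Ev|nv] /orP[] /eqP Ew //.
    by rewrite Ev Ew eqxx in cwv.
  by case: cv => E; [rewrite E eqxx in nv | rewrite E Ew eqxx in cwv].
case: (boolP (shares (pc l u) (nc l u) (pc m u))) => shp.
  have [v [E lv mv]] := shares_decode (or_introl erefl) shp.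
  have {ap} -> : a = r v u by rewrite (ap v) // lv.
  case: (boolP (shares (pc l u) (nc l u) (nc m u))) => shn.
    have [w [E' lw mw]] := shares_decode (or_intror erefl) shn.
    have vw : v != w.
      by apply: contraTneq (pn _) => [vw|]; rewrite E ?E' ?vw ?eqxx //; case: (pn).
    rewrite (event_parallel vw) //= (bn w) // lw /= (compat_edge C lv mv).
    by rewrite (compat_vertex C vw) // negbK.
  have nsh w : w != v -> uses_edge u w l -> ~~ uses_edge u w m.
    move=> wv lw; apply: contra shn => mw.
    by rewrite -(_ : code w = nc m u) ?shares_code // (ports v w) ?E ?eqxx //; left.
  rewrite (event_end lv mv nsh) E eqxx /= => L0.
  by rewrite (compat_edge C lv mv) (literal_compatible C lv mv nsh L0).
have {ap a0} -> : a = false.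
  case: (eqVneq (pc m u) 0) => [/a0|/(pc_decode)[v E]] //.
  rewrite (ap v E); apply/negbTE; rewrite negb_and; apply/orP; left.
  by rewrite -shares_code -E.
case: (boolP (shares (pc l u) (nc l u) (nc m u))) => shn.
  have [v [E lv mv]] := shares_decode (or_intror erefl) shn.
  have vp : code v != pc m u by apply: contraNneq shp => <-; rewrite shares_code.
  have nsh w : w != v -> uses_edge u w l -> ~~ uses_edge u w m.
    move=> wv lw; apply: contra shp => mw.
    rewrite -(_ : code w = pc m u) ?shares_code // (ports v w) ?(negPf vp) //.
    by right.
  rewrite (event_end lv mv nsh) (negPf vp) /= => L0.
  by rewrite (bn v E) lv (literal_compatible C lv mv nsh L0).
have {bn b0} -> : b = false.
  case: (eqVneq (nc m u) 0) => [/b0|/(nc_decode)[v E]] //.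
  rewrite (bn v E); apply/negbTE; rewrite negb_and; apply/orP; left.
  by rewrite -shares_code -E.
case: (boolP [&& pc l u != 0, nc l u != 0, pc m u != 0 & nc m u != 0]) => [|nz]; last first.
  by rewrite /ev /vertex_event (negPf shp) (negPf shn) (negPf nz).
case/and4P=> p1 n1 p2 n2; have := (pc_neq_nc Ul p1, pc_neq_nc Um p2).
have [[a' Ea] [b' Eb]] := (pc_decode p1, nc_decode n1).
have [[c' Ec] [d' Ed]] := (pc_decode p2, nc_decode n2).
have [la lb] : uses_edge u a' l /\ uses_edge u b' l.
  by rewrite !uses_edge_code // Ea Eb !eqxx orbT.
have [mc md] : uses_edge u c' m /\ uses_edge u d' m.
  by rewrite !uses_edge_code // Ec Ed !eqxx orbT.
have nl e : ~~ shares (pc l u) (nc l u) (code e) -> e != a' /\ e != b'.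
  by rewrite shares_code => ne; split; apply: contraNneq ne => ->.
have [ca cb] : c' != a' /\ c' != b' by apply: nl; rewrite -Ec.
have [da db] : d' != a' /\ d' != b' by apply: nl; rewrite -Ed.
rewrite Ea Eb Ec Ed => -[ab cd].
have {ab} ab : a' != b' by apply: contra ab => /eqP->.
have {cd} cd : c' != d' by apply: contra cd => /eqP->.
have U : uniq [:: a'; b'; c'; d'].
  rewrite /= !inE !negb_or ab cd (eq_sym a' c') (eq_sym a' d') (eq_sym b' c').
  by rewrite (eq_sym b' d') ca cb da db.
by rewrite (event_meet U) //= (compat_meet C U) // eqxx.
Qed.

Lemma index_pc (p : line) u v : uniq p -> code v = pc p u ->
  index u p = (index v p).+1 /\ code u = nc p v.
Proof.
move=> Up; rewrite pcE; case: ifP => // /andP[up iu] /code_inj E.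
have iv : index v p = (index u p).-1.
  by rewrite E index_uniq // (leq_ltn_trans (leq_pred _)) // index_mem.
have vp : v \in p by rewrite E mem_nth // (leq_ltn_trans (leq_pred _)) // index_mem.
by rewrite ncE vp iv prednK // index_mem up nth_index.
Qed.

Lemma index_nc (p : line) u v : uniq p -> code v = nc p u ->
  index v p = (index u p).+1 /\ code u = pc p v.
Proof.
move=> Up; rewrite ncE; case: ifP => // /andP[up iu] /code_inj E.
have iv : index v p = (index u p).+1 by rewrite E index_uniq.
have vp : v \in p by rewrite E mem_nth.
by rewrite pcE vp iv /= nth_index.
Qed.

(** One value per edge of [m] gives the order at the forward port and, negated, at the backward
    port. So the edge clause holds by construction, and the events supply the others. *)
Lemma compatible_of_events (x : nat -> bool) :
  (forall u, u \in m -> event_ok f (ev u) (x (index u m)) (x (index u m).+1)) ->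
  exists r, compatible s l m r.
Proof.
move=> ok.
pose r u v := if code v == pc m u then ~~ x (index u m) else x (index u m).+1.
exists r; have endE u v : uses_edge u v l -> uses_edge u v m ->
    (forall w, w != v -> uses_edge u w l -> ~~ uses_edge u w m) ->
    (port_literal u v).1 <> 0 -> r u v = lit_val f (port_literal u v).
  move=> lv mv nsh L0; have := ok u (uses_edge_mem mv).
  rewrite (event_end lv mv nsh) /r; case: eqP => _ /= /(_ L0) -> //.
  by rewrite negbK.
split.
- move=> u v lu mu; rewrite /r; move: (mu); rewrite uses_edge_code // => /orP[] /eqP E.
    have [iu Eu] := index_pc Um E; rewrite E eqxx Eu iu negbK.
    by case: eqP => // E'; have := @pc_neq_nc m Um v; rewrite -E' -Eu eqxx => /(_ isT).
  have [iv Eu] := index_nc Um E; rewrite -Eu eqxx iv.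
  by case: eqP => // E'; have := @pc_neq_nc m Um u; rewrite -E' -E eqxx => /(_ isT).
- move=> u v w vw lv mv lw mw; have := ok u (uses_edge_mem mv).
  rewrite (event_parallel vw lv lw mv mw) /= /r => ->.
  have cvw : code v != code w by apply: contra vw => /eqP/code_inj->.
  move: mv mw; rewrite !uses_edge_code // => /orP[] /eqP Ev /orP[] /eqP Ew.
  + by move: cvw; rewrite Ev Ew eqxx.
  + by rewrite Ev eqxx -Ev eq_sym (negPf cvw).
  + by rewrite Ew eqxx -Ew (negPf cvw) negbK.
  by move: cvw; rewrite Ev Ew eqxx.
- move=> u v b c bv cv bc lv mv lb mc.
  have [L0 <-] := literal_split bv cv lv mv lb mc; apply: endE => // w wv lw.
  apply/negP=> mw; have vb : v != b by rewrite eq_sym.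
  have vc : v != c by rewrite eq_sym.
  have [E|E] := ports_le2 lI vb lv lb lw; first by move: wv; rewrite E eqxx.
  have [E'|E'] := ports_le2 mI vc mv mc mw; first by move: wv; rewrite E' eqxx.
  by move: bc; rewrite -E E' eqxx.
- move=> u v lv mv lt mi; have [L0 <-] := literal_left lv mv lt mi.
  apply: endE => // w wv lw.
  by move: wv; rewrite (terminal_port lI lt lv lw) eqxx.
- move=> u v lv mv li mt; have [L0 <-] := literal_right lv mv li mt.
  apply: endE => // w wv lw; apply: contra wv => mw.
  by rewrite (terminal_port mI mt mv mw).
move=> u a b c d U la lb mc md; have := ok u (uses_edge_mem mc).
by rewrite (event_meet U) //= => -[/negbFE/eqP].
Qed.

Lemma events_of_compatible r : compatible s l m r -> exists x : nat -> bool,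
  forall u, u \in m -> event_ok f (ev u) (x (index u m)) (x (index u m).+1).
Proof.
move=> C.
(* [x i] is the order at the port of the predecessor on [m] towards the vertex of index [i]; [has]
   finds the two vertices, and the value is false without them. *)
pose x i := has (fun u => [&& u \in m, index u m == i &
  has (fun v => [&& code v == pc m u, uses_edge u v l & r v u]) m]) m.
have xE u v : u \in m -> code v = pc m u -> x (index u m) = uses_edge u v l && r v u.
  move=> um E; have vm : v \in m.
    by apply: (@uses_edge_mem v u); rewrite uses_edgeC uses_edge_code // E eqxx.
  apply/hasP/andP => [[u' _ /and3P[u'm /eqP iu' /hasP[v' _ /and3P[/eqP E' lv' rv']]]]|[lv rv]].
    have Eu : u' = u by apply: index_eq u'm iu'.
    by subst u'; move: E'; rewrite -E => /code_inj Ev; subst v'.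
  exists u => //; rewrite um eqxx /=; apply/hasP; exists v => //.
  by rewrite E eqxx lv.
exists x => u um; apply: compatible_event C _ _ _ _.
- by move=> v E; apply: xE.
- move=> E; apply/negbTE/hasPn => u' _; apply/negP=> /and3P[u'm /eqP iu' /hasP[v _]].
  by rewrite (index_eq u'm iu') E.
- move=> v E; have [iv Ev] := index_nc Um (esym E).
  have um' : uses_edge u v m by rewrite uses_edge_code // E eqxx orbT.
  rewrite -iv (xE v u) 1?uses_edgeC // (@uses_edge_mem v u) //.
  by rewrite uses_edgeC.
move=> E; apply/negbTE/hasPn => u' _; apply/negP=> /and3P[u'm /eqP iu' /hasP[v _]].
move=> /and3P[/eqP E' _ _]; have [iu'' Eu] := index_pc Um E'.
have vm : v \in m by rewrite -index_mem -ltnS -iu'' ltnW // ltnS index_mem.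
move: iu'; rewrite iu'' => -[] /(index_eq vm) Ev.
by move: E; rewrite -Ev -Eu.
Qed.

End Pair.


(** * The system of equations of an instance *)

Definition rotation_lists : seq (seq nat) := [seq map val (nbrs u) | u <- enum V].
Definition line_lists : seq (seq nat) := [seq map val l | l <- lines I].

Lemma ranking_rank u c : ranking rotation_lists (val u) c = rank u c.
Proof.
by rewrite /ranking /rotation_lists (nth_map u) ?size_enum_ord ?ltn_ord // ?nth_ord_enum.
Qed.

Lemma pair_eqs_compatible (f : nat -> bool) (s : line -> V -> bool) a b :
  f 1 = false -> a < b -> b < size (lines I) ->
  (forall l u, l \in lines I -> terminal l u ->
     f ((index l (lines I)).*2.+2 + (pc l u != 0)) = s l u) ->
  all (sat f) (pair_eqs rotation_lists line_lists a b) <->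
  exists r, compatible s (nth [::] (lines I) a) (nth [::] (lines I) b) r.
Proof.
move=> f1 ab bs fs; have a_s := ltn_trans ab bs.
set l := nth [::] _ a; set m := nth [::] _ b.
have [lI mI] : l \in lines I /\ m \in lines I by rewrite !mem_nth.
have lm : l != m by rewrite nth_uniq ?lines_uniq // ltn_eqF.
have fl u : terminal l u -> f ((a + a).+2 + (pc l u != 0)) = s l u.
  by move=> lt; rewrite -fs // index_uniq ?lines_uniq // addnn.
have fm u : terminal m u -> f ((b + b).+2 + (pc m u != 0)) = s m u.
  by move=> mt; rewrite -fs // index_uniq ?lines_uniq // addnn.
rewrite /pair_eqs /line_lists !(nth_map [::]) // -/l -/m.
have u0 : V by case: (m) (lines_simple mI) => // u.
have -> : pair_events (ranking rotation_lists) (a + a).+2 (b + b).+2 (map val l) (map val m)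
  = [seq vertex_event (rank (nth u0 m i)) (a + a).+2 (b + b).+2 (pc l (nth u0 m i))
     (nc l (nth u0 m i)) (pc m (nth u0 m i)) (nc m (nth u0 m i)) | i <- iota 0 (size m)].
  rewrite /pair_events -{3}(mkseq_nth u0 m) /mkseq -!map_comp; apply: eq_map => i /=.
  rewrite /vertex_event /end_literal.
  by rewrite -[X in _ = X]/(vertex_event _ _ _ _ _ _ _) /vertex_event /end_literal !ranking_rank.
have Um := line_uniq mI.
rewrite walk_eqs_sat; split=> [[x ok]|[r C]].
  apply: (compatible_of_events lI mI _ _ f1 fl fm (x := x)) => // u um.
  by have := ok (index u m); rewrite index_mem nth_index //; apply.
have [x ok] := events_of_compatible lI mI (isT : (a + a).+2 != 0)
  (isT : (b + b).+2 != 0) f1 fl fm C.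
by exists x => i im; have := ok _ (mem_nth u0 im); rewrite index_uniq.
Qed.

(** Once the sides are fixed the pairs are independent, so the relations can be chosen pair by pair,
    for lines in increasing index and by reversal otherwise. *)
Lemma satisfiable_solution : satisfiable (all_eqs rotation_lists line_lists) <->
  exists (s : line -> V -> bool) (R : line -> line -> V -> V -> bool), solution s R.
Proof.
have szl : size line_lists = size (lines I) by rewrite size_map.
split=> [[f [f1 /all_eqs_sat H]]|[s [R sol]]].
  pose s l u := f ((index l (lines I)).*2.+2 + (pc l u != 0)).
  have ex a b : exists r, a < b -> b < size (lines I) ->
      compatible s (nth [::] (lines I) a) (nth [::] (lines I) b) r.
    case: (boolP ((a < b) && (b < size (lines I)))) => [/andP[ab bs]|nab]; last first.
      by exists (fun _ _ => false) => ab bs; case/negP: nab; rewrite ab.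
    have [||r C] := (@pair_eqs_compatible f s a b f1 ab bs _).1 _ => //.
      by apply: H; rewrite ?szl.
    by exists r.
  have [r0 Hr0] := choice _ (fun a => choice _ (ex a)).
  have lineK l : l \in lines I -> nth [::] (lines I) (index l (lines I)) = l.
    exact: nth_index.
  pose R l m u v := let: (i, j) := (index l (lines I), index m (lines I)) in
    if i < j then r0 i j u v else ~~ r0 j i u v.
  exists s, R => l m lI mI lm; rewrite /R.
  have bl := lI; have bm := mI; rewrite -index_mem in bl; rewrite -index_mem in bm.
  case: (ltngtP (index l (lines I)) (index m (lines I))) => [ij|ij|E].
  - split; first by have := Hr0 _ _ ij bm; rewrite !lineK.
    by [].
  - split; last by move=> u v _ _; rewrite negbK.
    by have := Hr0 _ _ ij bl; rewrite !lineK //; apply: compatible_swap.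
  by move: lm; rewrite -(lineK l lI) E lineK // eqxx.
(* Inverse of the numbering of variables: [(i - 2)./2] is the line, and an odd [i] belongs to the
   terminal that has a predecessor. *)
pose f i := if i < 2 then false else let l := nth [::] (lines I) (i - 2)./2 in
  has (fun u => [&& terminal l u, odd i == (pc l u != 0) & s l u]) l.
exists f; split=> //; apply/all_eqs_sat => a b ab; rewrite szl => bs.
have a_s := ltn_trans ab bs.
apply/(pair_eqs_compatible (s := s) _ ab bs) => //; last first.
  exists (R (nth [::] (lines I) a) (nth [::] (lines I) b)).
  by apply: (sol _ _ _ _ _).1; rewrite ?mem_nth // nth_uniq ?lines_uniq // ltn_eqF.
move=> l u lI lt; rewrite /f addSn /= subn2 /= addnC.
have -> : ((pc l u != 0) + (index l (lines I)).*2)./2 = index l (lines I).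
  by rewrite half_bit_double.
rewrite nth_index // oddD odd_double addbF negbK oddb.
have ul : u \in l by move: lt; rewrite terminal_index ?line_uniq // => /andP[].
apply/hasP/idP => [[u' u'l /and3P[lt' E su']]|su]; last first.
  by exists u; rewrite // lt su eqxx.
suff <- : u' = u by [].
apply: (index_eq u'l); have Ul := line_uniq lI.
move: lt lt' E; rewrite !terminal_index // ul u'l /= !pcE // ul u'l /=.
have := ul; have := u'l; rewrite -!index_mem.
by case: (index u l) => [|i]; case: (index u' l) => [|j] //=; lia.
Qed.

End Instance.

(** * Bounded-loop programs *)

(* MathComp shadows [Mem] and [Sub]. *)
Import Defs.

Definition set_reg (r v : nat) (s : state) : state :=
  State (upd (regs s) r v) (heap s).

Definition set_mem (a v : nat) (s : state) : state :=
  State (regs s) (upd (heap s) a v).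

(* Loops count a register up to a bound, so that the result and the running time are
   total functions of the initial state; [well_formed] keeps the body from changing
   the counter and the bound. *)
Inductive prog :=
| PSkip
| PAsg of nat & expr
| PSto of expr & expr
| PSeq of prog & prog
| PIf of expr & prog & prog
| PFor of nat & nat & prog.

(** Truncated subtraction turns the guard into the test [r < h]. *)
Fixpoint compile (p : prog) : cmd :=
  match p with
  | PSkip => Skip
  | PAsg r e => Assign r e
  | PSto e1 e2 => Store e1 e2
  | PSeq p1 p2 => Seq (compile p1) (compile p2)
  | PIf e p1 p2 => If e (compile p1) (compile p2)
  | PFor r h p1 => While (Sub (Reg h) (Reg r))
      (Seq (compile p1) (Assign r (Add (Reg r) (Const 1))))
  end.

Fixpoint writes (p : prog) : seq nat :=
  match p with
  | PSkip | PSto _ _ => [::]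
  | PAsg r _ => [:: r]
  | PSeq p1 p2 | PIf _ p1 p2 => writes p1 ++ writes p2
  | PFor r _ p1 => r :: writes p1
  end.

Fixpoint stores (p : prog) : bool :=
  match p with
  | PSkip | PAsg _ _ => false
  | PSto _ _ => true
  | PSeq p1 p2 | PIf _ p1 p2 => stores p1 || stores p2
  | PFor _ _ p1 => stores p1
  end.

Fixpoint well_formed (p : prog) : bool :=
  match p with
  | PSeq p1 p2 | PIf _ p1 p2 => well_formed p1 && well_formed p2
  | PFor r h p1 => [&& r != h, r \notin writes p1, h \notin writes p1 & well_formed p1]
  | _ => true
  end.

Definition incr (r : nat) (s : state) : state := set_reg r (regs s r + 1) s.

Fixpoint run (p : prog) (s : state) : state :=
  match p with
  | PSkip => s
  | PAsg r e => set_reg r (eval s e) s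
  | PSto e1 e2 => set_mem (eval s e1) (eval s e2) s
  | PSeq p1 p2 => run p2 (run p1 s)
  | PIf e p1 p2 => if eval s e != 0 then run p1 s else run p2 s
  | PFor r h p1 => iter (regs s h - regs s r) (fun s' => incr r (run p1 s')) s
  end.

Fixpoint time (p : prog) (s : state) : nat :=
  match p with
  | PSkip => 1
  | PAsg _ e => (expr_cost e).+1
  | PSto e1 e2 => (expr_cost e1 + expr_cost e2).+1
  | PSeq p1 p2 => time p1 s + time p2 (run p1 s)
  | PIf e p1 p2 => (expr_cost e + if eval s e != 0 then time p1 s else time p2 s).+1
  (* An iteration adds 3 for the guard, 4 for the increment and 1 for the loop itself; the final
     failing test costs 4. *)
  | PFor r h p1 => \sum_(i < regs s h - regs s r)
      (time p1 (iter i (fun s' => incr r (run p1 s')) s) + 8) + 4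
  end.

Fixpoint loop_free (p : prog) : bool :=
  match p with
  | PSeq p1 p2 | PIf _ p1 p2 => loop_free p1 && loop_free p2
  | PFor _ _ _ => false
  | _ => true
  end.

Fixpoint cost (p : prog) : nat :=
  match p with
  | PSkip => 1
  | PAsg _ e => (expr_cost e).+1
  | PSto e1 e2 => (expr_cost e1 + expr_cost e2).+1
  | PSeq p1 p2 => cost p1 + cost p2
  | PIf e p1 p2 => (expr_cost e + maxn (cost p1) (cost p2)).+1
  | PFor _ _ _ => 0
  end.

Lemma regs_set_reg r v s q : regs (set_reg r v s) q = if q == r then v else regs s q.
Proof. by []. Qed.

Lemma run_frame p s q : q \notin writes p -> regs (run p s) q = regs s q.
Proof.
elim: p s => //= [r e|p1 IH1 p2 IH2|e p1 IH1 p2 IH2|r h p1 IH1] s.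
- by rewrite inE /upd => /negPf->.
- by rewrite mem_cat negb_or => /andP[q1 q2]; rewrite IH2 ?IH1.
- by rewrite mem_cat negb_or => /andP[q1 q2]; case: ifP => _; rewrite ?IH2 ?IH1.
rewrite inE negb_or => /andP[qr q1]; elim: (_ - _) => //= n IHn.
by rewrite /upd (negPf qr) IH1.
Qed.

Lemma run_heap p s : ~~ stores p -> heap (run p s) = heap s.
Proof.
elim: p s => //= [p1 IH1 p2 IH2|e p1 IH1 p2 IH2|r h p1 IH1] s.
- by rewrite negb_or => /andP[q1 q2]; rewrite IH2 ?IH1.
- by rewrite negb_or => /andP[q1 q2]; case: ifP => _; rewrite ?IH2 ?IH1.
by move=> q1; elim: (_ - _) => //= n IHn; rewrite IH1.
Qed.

Lemma time_cost p s : loop_free p -> time p s <= cost p.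
Proof.
elim: p s => //= [p1 IH1 p2 IH2|e p1 IH1 p2 IH2] s /andP[l1 l2].
  by rewrite leq_add ?IH1 ?IH2.
by rewrite ltnS leq_add2l leq_max; case: ifP => _; rewrite ?IH1 ?IH2 ?orbT.
Qed.

Lemma exec_compile p s : well_formed p -> exec (compile p) s (run p s) (time p s).
Proof.
elim: p s => [|r e|e1 e2|p1 IH1 p2 IH2|e p1 IH1 p2 IH2|r h p1 IH1] s /=.
- by move=> _; constructor.
- by move=> _; constructor.
- by move=> _; constructor.
- by case/andP=> w1 w2; apply: ExecSeq (IH1 _ w1) (IH2 _ w2).
- case/andP=> w1 w2; case: eqP => [e0|/eqP e0] /=.
    by apply: ExecIfFalse => //; apply: IH2.
  by apply: ExecIfTrue => //; apply: IH1.
case/and4P=> rh rN hN w1; move En: (regs s h - regs s r) => n.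
elim: n s En => [|n IHn] s En.
  rewrite big_ord0 add0n; apply: (@ExecWhileFalse (Sub (Reg h) (Reg r))).
  by rewrite /= En.
rewrite iterSr big_ord_recl /=.
set s1 := incr r (run p1 s).
have En1 : regs s1 h - regs s1 r = n.
  rewrite /s1 /incr !regs_set_reg eqxx eq_sym (negPf rh) !run_frame //; lia.
have W := IHn _ En1.
have X : exec (Seq (compile p1) (Assign r (Add (Reg r) (Const 1)))) s s1 (time p1 s + 4).
  by apply: ExecSeq (IH1 s w1) _; apply: ExecAssign.
have e0 : eval s (Sub (Reg h) (Reg r)) != 0 by rewrite /= En.
apply: (eq_rect _ (exec _ _ _) (ExecWhileTrue e0 X W)) => /=.
have -> : \sum_(i < n) (time p1 (iter (bump 0 i) (fun s' => incr r (run p1 s')) s) + 8) =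
    \sum_(i < n) (time p1 (iter i (fun s' => incr r (run p1 s')) s1) + 8).
  by apply: eq_bigr => i _; rewrite /bump add1n iterSr.
by move: (\sum_(i < n) _) (time p1 s); clear; lia.
Qed.

(** The third argument of the invariant is the time spent so far, without the final failing test, so
    amortised bounds can be carried through a loop. *)
Lemma for_rule (Inv : nat -> state -> nat -> Prop) r h p s :
  well_formed (PFor r h p) -> regs s r <= regs s h -> Inv (regs s r) s 0 ->
  (forall s' t, regs s r <= regs s' r < regs s h ->
    (forall q, q \notin r :: writes p -> regs s' q = regs s q) ->
    Inv (regs s' r) s' t ->
    Inv (regs s' r).+1 (incr r (run p s')) (t + time p s' + 8)) ->
  exists t, time (PFor r h p) s = t + 4 /\ Inv (regs s h) (run (PFor r h p) s) t.
Proof.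
move=> /= /and4P[rh rN hN w1] le I0 step.
exists (\sum_(i < regs s h - regs s r)
  (time p (iter i (fun s' => incr r (run p s')) s) + 8)); split=> //.
suff H n : n <= regs s h - regs s r ->
    let s' := iter n (fun s' => incr r (run p s')) s in
    [/\ regs s' r = regs s r + n, forall q, q \notin r :: writes p -> regs s' q = regs s q &
     Inv (regs s r + n) s'
       (\sum_(i < n) (time p (iter i (fun s' => incr r (run p s')) s) + 8))].
  by have [_ _] := H _ (leqnn _); rewrite subnKC.
elim: n => [|n IHn] ns /=; first by rewrite addn0 big_ord0.
have [rn fr In] := IHn (ltnW ns).
set s' := iter n _ _ in rn fr In *.
split.
- by rewrite /upd eqxx run_frame // rn -addnA addn1.
- move=> q qN; have := qN; rewrite inE negb_or => /andP[qr qp].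
  by rewrite /upd (negPf qr) run_frame // fr.
rewrite big_ord_recr /= -/s' addnS -rn addnA; apply: step => //.
  by rewrite rn; move: ns le; clear; lia.
by rewrite rn.
Qed.

(** * Union-find with parities *)

(** Expressible on the machine by truncated subtraction; it vanishes exactly on equal arguments, and
    on bits it is exclusive or. *)
Definition dist (a b : nat) : nat := a - b + (b - a).

Lemma dist_eq0 a b : (dist a b == 0) = (a == b).
Proof. rewrite /dist; lia. Qed.

Lemma dist_le1 a b : a <= 1 -> b <= 1 -> dist a b <= 1.
Proof. rewrite /dist; lia. Qed.

Lemma dist_addb a b : a <= 1 -> b <= 1 -> (dist a b == 1) = (a == 1) (+) (b == 1).
Proof. by case: a => [|[]]; case: b => [|[]]. Qed.

Section UnionFind.

Variable N : nat.

(* [comp i] is the representative of [i] and [par i] the parity relating the two. *)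
Implicit Types (comp par : nat -> nat) (f : nat -> bool).

(** The forest is kept flat: [comp] is idempotent, so a lookup is a single access and a merge
    rewrites the whole array. *)
Definition uf_wf comp par : Prop := forall i, i < N ->
  [/\ comp i < N, comp (comp i) = comp i, par i <= 1 & par (comp i) = 0].

Definition uf_sat comp par f : Prop := forall i, i < N ->
  f i = f (comp i) (+) (par i == 1).

Definition roots comp : nat := count (fun i => comp i == i) (iota 0 N).

Definition merge_comp comp x y i := if comp i == y then x else comp i.
Definition merge_par comp par y d i := if comp i == y then dist (par i) d else par i.

Section Merge.

Variables (comp par : nat -> nat) (e1 e2 c : nat).
Hypotheses (wf : uf_wf comp par) (e1N : e1 < N) (e2N : e2 < N) (c1 : c <= 1).

Let x := comp e1.
Let y := comp e2.
(** The parity of [y] relative to [x] that the equation [e1 + e2 = c] asks for; when [x] and [y]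
    agree, a nonzero [d] is a contradiction. *)
Let d := dist (dist (par e1) (par e2)) c.

Lemma merge_d : d <= 1 /\ (d == 1) = (par e1 == 1) (+) (par e2 == 1) (+) (c == 1).
Proof.
have [[_ _ p1 _] [_ _ p2 _]] := (wf e1N, wf e2N).
by rewrite /d; split; rewrite ?dist_addb ?dist_le1.
Qed.

Lemma merge_same f : x = y -> uf_sat comp par f ->
  (f e1 (+) f e2 == (c == 1)) = (d == 0).
Proof.
move=> xy S; rewrite (S _ e1N) (S _ e2N) -/x -/y xy.
have [d1 dE] := merge_d; have -> : (d == 0) = ~~ (d == 1) by case: (d) d1 => [|[]].
rewrite dE; case: (f y); case: (par e1 == 1); case: (par e2 == 1); by case: (c == 1).
Qed.

Hypothesis xy : x != y.

Lemma merge_wf : uf_wf (merge_comp comp x y) (merge_par comp par y d).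
Proof.
have [[xN xx _ px] [yN yy _ py]] := (wf e1N, wf e2N); have [d1 _] := merge_d.
move=> i iN; have [iN' ii pi pii] := wf iN; rewrite /merge_comp /merge_par.
have cx : comp x == y = false by rewrite /x xx -/x (negPf xy).
case: (eqVneq (comp i) y) => [E|ne]; first by rewrite cx dist_le1.
by rewrite ii (negPf ne).
Qed.

Lemma merge_sat f : uf_sat (merge_comp comp x y) (merge_par comp par y d) f <->
  uf_sat comp par f /\ (f e1 (+) f e2 == (c == 1)).
Proof.
have [[xN xx p1 px] [yN yy p2 py]] := (wf e1N, wf e2N); have [d1 dE] := merge_d.
rewrite /merge_comp /merge_par; split=> [S|[S /eqP E] i iN].
  have S1 : f e1 = f x (+) (par e1 == 1) by rewrite (S _ e1N) -/x (negPf xy).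
  have S2 : f e2 = f x (+) ((par e2 == 1) (+) (d == 1)).
    by rewrite (S _ e2N) -/y eqxx dist_addb.
  have Sy : f y = f x (+) (d == 1).
    by rewrite (S _ yN) /y yy eqxx py dist_addb.
  split=> [i iN|]; last first.
    rewrite S1 S2 dE; case: (f x); case: (par e1 == 1); case: (par e2 == 1);
    by case: (c == 1).
  have [_ _ pi _] := wf iN.
  rewrite (S _ iN); case: (eqVneq (comp i) y) => [->|//]; rewrite dist_addb // Sy.
  by case: (f x); case: (par i == 1); case: (d == 1).
have [_ _ pi _] := wf iN; rewrite (S _ iN).
case: (eqVneq (comp i) y) => [->|//]; rewrite dist_addb // dE -E.
rewrite (S _ e1N) (S _ e2N) -/x -/y.
by case: (f x); case: (f y); case: (par e1 == 1); case: (par e2 == 1); case: (par i == 1).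
Qed.

Lemma merge_roots : roots (merge_comp comp x y) < roots comp.
Proof.
have [[xN xx p1 px] [yN yy p2 py]] := (wf e1N, wf e2N).
apply: (@count_ltn _ _ _ _ y).
- by rewrite mem_iota.
- by rewrite /y yy.
- by rewrite /merge_comp /y yy eqxx -/y.
move=> i /=; rewrite /merge_comp; case: (eqVneq (comp i) y) => [E|//] /eqP xi.
by move: E xy; rewrite -xi /x xx -/x => ->; rewrite eqxx.
Qed.

End Merge.

(** The parities themselves satisfy everything recorded, and adding a constant, here the parity of
    node 1, preserves this. *)
Lemma uf_sat_consistent comp par : 1 < N -> uf_wf comp par ->
  exists f, f 1 = false /\ uf_sat comp par f.
Proof.
move=> N1 wf; exists (fun i => (par i == 1) (+) (par 1 == 1)); split; first exact: addbb.
by move=> i /wf[_ _ _ ->]; rewrite addbC.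
Qed.

End UnionFind.

Notation "p1 ;; p2" := (PSeq p1 p2) (at level 60, right associativity).

Definition Dist (e1 e2 : expr) : expr := Add (Sub e1 e2) (Sub e2 e1).
Definition at_ (r : nat) (e : expr) : expr := Mem (Add (Reg r) e).

(* Registers 1 to 9 are fixed by the setup: addresses of the input rows, of the
   scratch arrays, and sizes.  The pair [r_cn], [r_cp] is the current literal of a walk,
   and [r_e1], [r_e2], [r_ec] is the equation to be merged. *)
Notation r_ans := 0 (only parsing).
Notation r_nb := 1 (only parsing).
Notation r_loff := 2 (only parsing).
Notation r_line := 3 (only parsing).
Notation r_L := 4 (only parsing).
Notation r_pos := 5 (only parsing).
Notation r_rank := 6 (only parsing).
Notation r_comp := 7 (only parsing).
Notation r_par := 8 (only parsing).
Notation r_N := 9 (only parsing).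
Notation r_bad := 10 (only parsing).
Notation r_a := 11 (only parsing).
Notation r_b := 12 (only parsing).
Notation r_k := 13 (only parsing).
Notation r_sa := 14 (only parsing).
Notation r_ea := 15 (only parsing).
Notation r_sb := 16 (only parsing).
Notation r_eb := 17 (only parsing).
Notation r_u := 18 (only parsing).
Notation r_p := 19 (only parsing).
Notation r_m := 20 (only parsing).
Notation r_me := 21 (only parsing).
Notation r_p1 := 22 (only parsing).
Notation r_n1 := 23 (only parsing).
Notation r_p2 := 24 (only parsing).
Notation r_n2 := 25 (only parsing).
Notation r_A := 26 (only parsing).
Notation r_qA := 27 (only parsing).
Notation r_B := 28 (only parsing).
Notation r_qB := 29 (only parsing).
Notation r_v := 30 (only parsing).
Notation r_q1 := 31 (only parsing).
Notation r_q2 := 32 (only parsing).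
Notation r_nn := 33 (only parsing).
Notation r_np := 34 (only parsing).
Notation r_c := 35 (only parsing).
Notation r_cn := 36 (only parsing).
Notation r_cp := 37 (only parsing).
Notation r_e1 := 38 (only parsing).
Notation r_e2 := 39 (only parsing).
Notation r_ec := 40 (only parsing).
Notation r_x := 41 (only parsing).
Notation r_y := 42 (only parsing).
Notation r_d := 43 (only parsing).
Notation r_i := 44 (only parsing).

Definition merge_body : prog :=
  PIf (Dist (at_ r_comp (Reg r_i)) (Reg r_y)) PSkip
    (PSto (Add (Reg r_comp) (Reg r_i)) (Reg r_x) ;;
     PSto (Add (Reg r_par) (Reg r_i)) (Dist (at_ r_par (Reg r_i)) (Reg r_d))).

Definition merge_load : prog :=
  PAsg r_x (at_ r_comp (Reg r_e1)) ;;
  PAsg r_y (at_ r_comp (Reg r_e2)) ;;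
  PAsg r_d (Dist (Dist (at_ r_par (Reg r_e1)) (at_ r_par (Reg r_e2))) (Reg r_ec)) ;;
  PAsg r_i (Const 0).

Definition merge_prog : prog :=
  PIf (Reg r_e1) (PIf (Reg r_e2)
    (merge_load ;;
     PIf (Dist (Reg r_x) (Reg r_y)) (PFor r_i r_N merge_body)
       (PIf (Reg r_d) (PAsg r_bad (Const 1)) PSkip)) PSkip) PSkip.

Lemma run_seq p1 p2 s : run (p1 ;; p2) s = run p2 (run p1 s).
Proof. by []. Qed.

Lemma time_seq p1 p2 s : time (p1 ;; p2) s = time p1 s + time p2 (run p1 s).
Proof. by []. Qed.

Lemma run_if e p1 p2 s :
  run (PIf e p1 p2) s = if eval s e != 0 then run p1 s else run p2 s.
Proof. by []. Qed.

Lemma time_if e p1 p2 s : time (PIf e p1 p2) s =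
  (expr_cost e + if eval s e != 0 then time p1 s else time p2 s).+1.
Proof. by []. Qed.

Section MergeProg.

Variables (N C P : nat).
Hypothesis CP : C + N <= P.

Definition uf_regs (s : state) : Prop :=
  [/\ regs s r_comp = C, regs s r_par = P & regs s r_N = N].

Lemma merge_loop s x y d : uf_regs s -> regs s r_i = 0 -> regs s r_x = x ->
  regs s r_y = y -> regs s r_d = d ->
  let s' := run (PFor r_i r_N merge_body) s in
  [/\ forall i, i < N -> heap s' (C + i) = merge_comp (fun j => heap s (C + j)) x y i,
      forall i, i < N -> heap s' (P + i) =
        if heap s (C + i) == y then dist (heap s (P + i)) d else heap s (P + i),
      forall a, ~~ (C <= a < C + N) -> ~~ (P <= a < P + N) -> heap s' a = heap s a &
      time (PFor r_i r_N merge_body) s <= 60 * N + 4].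
Proof.
move=> [rC rP rN] ri rx ry rd s'.
(* 60 covers one pass through the body together with the loop overhead of 8. *)
pose Inv k s' t := [/\ t <= 60 * k,
  forall i, i < N -> heap s' (C + i) = if i < k then
     merge_comp (fun j => heap s (C + j)) x y i else heap s (C + i),
  forall i, i < N -> heap s' (P + i) = if i < k then
     if heap s (C + i) == y then dist (heap s (P + i)) d else heap s (P + i)
     else heap s (P + i) &
  forall a, ~~ (C <= a < C + N) -> ~~ (P <= a < P + N) -> heap s' a = heap s a].
have [||s1 t lt fr [tk H1 H2 H3]|t [-> [tN H1 H2 H3]]] := @for_rule Inv r_i r_N merge_body
  s isT _ _ _.
- by rewrite ri rN.
- by rewrite ri; split.
- move: lt; rewrite ri rN => /= kN.
  have [rC1 rP1] : regs s1 r_comp = C /\ regs s1 r_par = P by rewrite !fr.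
  have [rx1 ry1] : regs s1 r_x = x /\ regs s1 r_y = y by rewrite !fr.
  have rd1 : regs s1 r_d = d by rewrite fr.
  move: kN H1 H2; set k := regs s1 r_i => kN H1 H2.
  have tc : t + time merge_body s1 + 8 <= 60 * k.+1.
    have := time_cost s1 (isT : loop_free merge_body).
    by rewrite [cost _]/=; move: (time _ _) tk; clear; lia.
  have cond : eval s1 (Dist (at_ r_comp (Reg r_i)) (Reg r_y)) = dist (heap s (C + k)) y.
    by rewrite /= rC1 ry1 -/k H1 // ltnn.
  have ne i j : i < N -> j < N -> (C + i == P + j) = false.
    by move=> iN jN; apply/eqP; move: CP iN jN; clear; lia.
  have hb a : heap (run merge_body s1) a = if heap s (C + k) == y then
      if a == P + k then dist (heap s (P + k)) d else if a == C + k then x else heap s1 a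
      else heap s1 a.
    rewrite -[run _ _]/(if eval s1 (Dist (at_ r_comp (Reg r_i)) (Reg r_y)) != 0 then s1
      else _) cond dist_eq0.
    case: (eqVneq (heap s (C + k)) y) => //= _.
    by rewrite /upd rC1 rP1 rx1 rd1 -/k (eq_sym (P + k)) ne // H2 // ltnn.
  split=> // [i iN|i iN|a aC aP]; rewrite [heap _]/= hb.
  - rewrite ne // H1 // ltnS (leq_eqVlt i k) eqn_add2l /merge_comp.
    by case: (eqVneq i k) => [->|_] /=; rewrite ?ltnn ?if_same //; case: ifP.
  - rewrite eqn_add2l (eq_sym _ (C + k)) ne // H2 // ltnS (leq_eqVlt i k).
    by case: (eqVneq i k) => [->|_] /=; rewrite ?ltnn ?if_same //; case: ifP.
  have /negPf-> : a != P + k by apply: contraNneq aP => ->; move: kN; clear; lia.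
  have /negPf-> : a != C + k by apply: contraNneq aC => ->; move: kN; clear; lia.
  by rewrite H3 // if_same.
rewrite rN in tN H1 H2 *; split=> //.
- by move=> i iN; rewrite H1 // iN.
- by move=> i iN; rewrite H2 // iN.
by rewrite leq_add2r.
Qed.

Definition comp_of (s : state) (i : nat) : nat := heap s (C + i).
Definition par_of (s : state) (i : nat) : nat := heap s (P + i).

Definition solved (qs : seq equation) (s : state) : Prop :=
  uf_wf N (comp_of s) (par_of s) /\
  forall f, all (sat f) qs <-> regs s r_bad = 0 /\ uf_sat N (comp_of s) (par_of s) f.

(* Every merging pass removes a root, which pays for it. *)
Definition potential (s : state) : nat := (60 * N + 4) * roots N (comp_of s).

Lemma uf_sat_ext comp par comp' par' f :
  (forall i, i < N -> comp i = comp' i) -> (forall i, i < N -> par i = par' i) ->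
  uf_sat N comp par f -> uf_sat N comp' par' f.
Proof. by move=> Ec Ep S i iN; rewrite -Ec // -Ep //; apply: S. Qed.

Lemma uf_wf_ext comp par comp' par' :
  (forall i, i < N -> comp i = comp' i) -> (forall i, i < N -> par i = par' i) ->
  uf_wf N comp par -> uf_wf N comp' par'.
Proof.
by move=> Ec Ep wf i iN; have [cN cc p1 p0] := wf i iN; rewrite -!Ec // -!Ep.
Qed.

Lemma roots_ext comp comp' :
  (forall i, i < N -> comp i = comp' i) -> roots N comp = roots N comp'.
Proof.
by move=> Ec; apply: eq_in_count => i; rewrite mem_iota add0n => /= iN; rewrite Ec.
Qed.

Lemma solved_void qs q s : (q.1.1 == 0) || (q.1.2 == 0) -> solved qs s ->
  solved (rcons qs q) s.
Proof.
move=> q0 [wf S]; split=> // f; rewrite all_rcons -S.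
suff -> : sat f q by [].
by rewrite /sat; case/orP: q0 => ->; rewrite ?implybT.
Qed.

(** At a void equation [r_e2] and [r_ec] may be stale, so they are described for a nonzero first
    node only. The 100 pays for the loop-free part, a drop of the potential for the loop. *)
Lemma merge_prog_spec s qs (q : equation) : uf_regs s -> solved qs s ->
  regs s r_e1 = q.1.1 ->
  (q.1.1 != 0 -> [/\ regs s r_e2 = q.1.2, regs s r_ec = nat_of_bool q.2,
     q.1.1 < N & q.1.2 < N]) ->
  let s' := run merge_prog s in
  [/\ solved (rcons qs q) s',
      forall a, ~~ (C <= a < C + N) -> ~~ (P <= a < P + N) -> heap s' a = heap s a &
      time merge_prog s + potential s' <= 100 + potential s].
Proof.
move=> [rC rP rN] sol E1 H s'.
case: (eqVneq q.1.1 0) H => [q0 _|q0 /(_ isT)[E2 Ec e1N e2N]].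
  rewrite /s' /merge_prog run_if time_if [eval _ _]/= E1 q0 /=.
  by split=> //; [apply: solved_void; rewrite ?q0 | rewrite leq_add2r].
case: (eqVneq q.1.2 0) => [q0'|q0'].
  rewrite /s' /merge_prog run_if time_if [eval _ _]/= E1 q0.
  rewrite run_if time_if [eval _ _]/= E2 q0' /=.
  by split=> //; [apply: solved_void => //; rewrite q0' eqxx orbT | rewrite leq_add2r].
pose x := comp_of s q.1.1; pose y := comp_of s q.1.2.
pose d := dist (dist (par_of s q.1.1) (par_of s q.1.2)) q.2.
have [wf S] := sol; have c1 : q.2 <= 1 by case: q.2.
have cE : (nat_of_bool q.2 == 1) = q.2 by case: q.2.
have satE f : sat f q = (f q.1.1 (+) f q.1.2 == (nat_of_bool q.2 == 1)).
  by rewrite /sat q0 q0' cE.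
have [s1 s1E] : exists s1, s1 = run merge_load s by exists (run merge_load s).
have [x1 y1 d1] : [/\ regs s1 r_x = x, regs s1 r_y = y & regs s1 r_d = d].
  by rewrite s1E /= /upd /= rC rP E1 E2 Ec.
have i1 : regs s1 r_i = 0 by rewrite s1E.
have h1 : heap s1 = heap s by rewrite s1E run_heap.
have t1 : time merge_load s <= 56 by apply: leq_trans (time_cost s (isT :
  loop_free merge_load)) _.
have fr r : r \notin writes merge_load -> regs s1 r = regs s r by rewrite s1E;
  apply: run_frame.
have s'E : s' = if x == y then if d == 0 then s1 else set_reg r_bad 1 s1
    else run (PFor r_i r_N merge_body) s1.
  rewrite /s' /merge_prog run_if [eval _ _]/= E1 q0 run_if [eval _ _]/= E2 q0' run_seq -s1E.
  rewrite run_if [eval _ _]/= x1 y1 -[_ - _ + _]/(dist x y) dist_eq0.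
  by case: (eqVneq x y) => //= _; rewrite d1; case: (d == 0).
have tE : time merge_prog s <= 80 + if x == y then 0 else time (PFor r_i r_N merge_body) s1.
  rewrite /merge_prog time_if [eval _ _]/= E1 q0 time_if [eval _ _]/= E2 q0' time_seq -s1E.
  rewrite time_if [eval _ _]/= x1 y1 -[_ - _ + _]/(dist x y) dist_eq0.
  rewrite [expr_cost (Reg _)]/= [expr_cost (Dist _ _)]/=.
  move: t1; move: (time merge_load s) (time (PFor _ _ _) s1) => T1 T2 t1.
  case: (eqVneq x y) => /= _; last by move: t1; clear; lia.
  by rewrite d1; case: (d == 0) => /=; move: t1; clear; lia.
have co_s1 i : comp_of s1 i = comp_of s i by rewrite /comp_of h1.
have pa_s1 i : par_of s1 i = par_of s i by rewrite /par_of h1.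
have b1 : regs s1 r_bad = regs s r_bad by apply: fr.
case: (eqVneq x y) s'E tE => [xy|xy] s'E tE.
  have heapE : heap s' = heap s by rewrite s'E; case: ifP => _; rewrite -h1.
  have co i : comp_of s' i = comp_of s i by rewrite /comp_of heapE.
  have pa i : par_of s' i = par_of s i by rewrite /par_of heapE.
  split; last 2 first.
  - by move=> a _ _; rewrite heapE.
  - rewrite /potential (roots_ext (fun i _ => co i)) leq_add2r.
    by apply: leq_trans tE _.
  split; first by apply: uf_wf_ext wf => i _; rewrite ?co ?pa.
  move=> f; rewrite all_rcons satE; split.
    case/andP=> Eq /S[bad0 Sf].
    move: Eq; rewrite (merge_same wf e1N e2N c1 xy Sf) -/d => d0.
    split; first by rewrite s'E d0 b1.
    by apply: uf_sat_ext Sf => i _; rewrite ?co ?pa.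
  case=> bad0 Sf'; have d0 : d == 0 by move: bad0; rewrite s'E; case: eqP.
  have Sf : uf_sat N (comp_of s) (par_of s) f.
    by apply: uf_sat_ext Sf' => i _; rewrite ?co ?pa.
  rewrite (merge_same wf e1N e2N c1 xy Sf) d0 /=; apply/S; split=> //.
  by move: bad0; rewrite s'E d0 b1.
have ufr : uf_regs s1 by split; rewrite fr.
have [H1 H2 H3 H4] := merge_loop ufr i1 x1 y1 d1; rewrite -s'E in H1 H2 H3.
have co i : i < N -> merge_comp (comp_of s) x y i = comp_of s' i.
  by move=> iN; rewrite /comp_of H1 // /merge_comp -/(comp_of s1 i) co_s1.
have pa i : i < N -> merge_par (comp_of s) (par_of s) y d i = par_of s' i.
  move=> iN; rewrite /par_of H2 // -/(comp_of s1 i) co_s1 -/(par_of s1 i) pa_s1.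
  by rewrite /merge_par.
split; last 2 first.
- by move=> a aC aP; rewrite H3 // h1.
- have := merge_roots wf e1N e2N xy; rewrite (roots_ext co) /potential.
  move: (roots N (comp_of s')) (roots N (comp_of s)) tE H4 => r' r tE H4 rr.
  have le : (60 * N + 4) * r'.+1 <= (60 * N + 4) * r by rewrite leq_mul2l rr orbT.
  move: le tE H4; rewrite mulnS; move: (_ * r') (_ * r) (time _ _) (time _ _).
  by clear; lia.
split; first exact: uf_wf_ext co pa (merge_wf wf e1N e2N c1 xy).
have badE : regs s' r_bad = regs s r_bad by rewrite s'E run_frame.
move=> f; rewrite all_rcons satE badE; split.
  case/andP=> Eq /S[bad0 Sf]; split=> //.
  by apply: uf_sat_ext co pa _; apply/(merge_sat wf e1N e2N c1 xy).
case=> bad0 Sf'.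
have /(merge_sat wf e1N e2N c1 xy)[Sf ->] : uf_sat N
    (merge_comp (comp_of s) x y) (merge_par (comp_of s) (par_of s) y d) f.
  by apply: uf_sat_ext Sf' => i iN; rewrite ?co ?pa.
by apply/S.
Qed.

End MergeProg.

(** * The decision program *)

Lemma run_asg r e s : run (PAsg r e) s = set_reg r (eval s e) s.
Proof. by []. Qed.

Lemma run_skip s : run PSkip s = s.
Proof. by []. Qed.

Lemma run_sto e1 e2 s : run (PSto e1 e2) s = set_mem (eval s e1) (eval s e2) s.
Proof. by []. Qed.

Definition runE := (run_seq, run_if, run_asg, run_skip, run_sto).

Opaque run time.

(** * Programs for the event at one vertex *)

Definition shares_prog (v ra rq : nat) : prog :=
  PAsg ra (Const 0) ;;
  PIf (Reg v)
    (PIf (Dist (Reg v) (Reg r_p1))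
       (PIf (Dist (Reg v) (Reg r_n1)) PSkip (PAsg ra (Const 1) ;; PAsg rq (Reg r_p1)))
       (PAsg ra (Const 1) ;; PAsg rq (Reg r_n1)))
    PSkip.

Definition less_prog (x y : nat) : prog :=
  PIf (Sub (at_ r_rank (Reg y)) (at_ r_rank (Reg x)))
    (PAsg r_c (Add (Reg r_c) (Const 1))) PSkip.

(** At most two of the three comparisons hold, so their number minus one, truncated, is the truth
    value of [cyclic3]. *)
Definition cyclic_prog (x y z : nat) : prog :=
  PAsg r_c (Const 0) ;; less_prog x y ;; less_prog y z ;; less_prog z x ;;
  PAsg r_c (Sub (Reg r_c) (Const 1)).

Definition variable_prog (line code : nat) : prog :=
  PAsg r_nn (Add (Add (Reg line) (Reg line)) (Const 2)) ;;
  PIf (Reg code) (PAsg r_nn (Add (Reg r_nn) (Const 1))) PSkip.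

Definition literal_prog : prog :=
  PIf (Reg r_q1)
    (PIf (Reg r_q2)
      (PAsg r_nn (Const 1) ;; cyclic_prog r_v r_q2 r_q1 ;; PAsg r_np (Reg r_c))
      (variable_prog r_b r_p2 ;; PAsg r_np (Const 0)))
    (PIf (Reg r_q2)
      (variable_prog r_a r_p1 ;; PAsg r_np (Const 1))
      (PAsg r_nn (Const 0) ;; PAsg r_np (Const 0))).

Definition stop_prog : prog :=
  PAsg r_v (Reg r_p2) ;; PAsg r_q1 (Reg r_qA) ;; PAsg r_q2 (Reg r_n2) ;; literal_prog ;;
  PAsg r_e1 (Reg r_cn) ;; PAsg r_e2 (Reg r_nn) ;;
  PAsg r_ec (Sub (Const 1) (Dist (Reg r_cp) (Reg r_np))) ;;
  PAsg r_cn (Const 0) ;; PAsg r_cp (Const 0).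

Definition start_prog : prog :=
  PAsg r_v (Reg r_n2) ;; PAsg r_q1 (Reg r_qB) ;; PAsg r_q2 (Reg r_p2) ;; literal_prog ;;
  PAsg r_cn (Reg r_nn) ;; PAsg r_cp (Reg r_np).

Definition meet_prog : prog :=
  PAsg r_e1 (Const 1) ;; PAsg r_e2 (Const 1) ;;
  cyclic_prog r_p1 r_p2 r_n1 ;; PAsg r_np (Reg r_c) ;;
  cyclic_prog r_p1 r_n2 r_n1 ;; PAsg r_ec (Dist (Reg r_np) (Reg r_c)).

Definition branch_prog : prog :=
  PIf (Reg r_A)
    (PIf (Reg r_B) PSkip stop_prog)
    (PIf (Reg r_B) start_prog
      (PIf (Reg r_p1) (PIf (Reg r_n1) (PIf (Reg r_p2) (PIf (Reg r_n2)
         meet_prog PSkip) PSkip) PSkip) PSkip)).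

Definition event_prog : prog :=
  shares_prog r_p2 r_A r_qA ;; shares_prog r_n2 r_B r_qB ;; PAsg r_e1 (Const 0) ;;
  branch_prog.

Lemma shares_spec v ra rq s : v != ra -> r_p1 != ra -> r_n1 != ra -> ra != rq ->
  let s' := run (shares_prog v ra rq) s in
  let p1 := regs s r_p1 in let n1 := regs s r_n1 in
  regs s' ra = shares p1 n1 (regs s v) /\
  (shares p1 n1 (regs s v) -> regs s' rq = other (regs s v) p1 n1).
Proof.
move=> va pa na aq s' p1 n1; rewrite {}/s' /shares_prog !runE.
rewrite [eval _ (Reg v)]/= /upd (negPf va) /shares /other.
case: (eqVneq (regs s v) 0) => [v0|v0] /=; first by rewrite /upd eqxx.
rewrite -!/(dist _ _) !dist_eq0 /upd (negPf va) (negPf pa) (negPf na) -/p1 -/n1.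
case: (eqVneq (regs s v) p1) => [E|E] /=.
  by rewrite /upd ?eqxx ?(negPf aq) ?(negPf na).
case: (eqVneq (regs s v) n1) => [E'|E'] /=.
  by rewrite /upd ?eqxx ?(negPf aq) ?(negPf pa).
by rewrite /upd ?eqxx.
Qed.

Definition rank_of (s : state) (c : nat) : nat := heap s (regs s r_rank + c).

Lemma less_spec x y s : x != r_c -> y != r_c ->
  regs (run (less_prog x y) s) r_c =
  regs s r_c + (rank_of s (regs s x) < rank_of s (regs s y)).
Proof.
move=> xc yc; rewrite /less_prog !runE /= subn_eq0 -ltnNge -!/(rank_of _ _).
by case: (_ < _); rewrite ?addn0.
Qed.

Lemma less_frame x y s z : z != r_c ->
  rank_of (run (less_prog x y) s) (regs (run (less_prog x y) s) z) =
  rank_of s (regs s z).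
Proof. by move=> zc; rewrite /rank_of run_heap // !run_frame //= inE. Qed.

Lemma cyclic_spec x y z s : x != r_c -> y != r_c -> z != r_c ->
  regs (run (cyclic_prog x y z) s) r_c =
  cyclic3 (rank_of s (regs s x)) (rank_of s (regs s y)) (rank_of s (regs s z)).
Proof.
move=> xc yc zc; rewrite /cyclic_prog !run_seq.
set s0 := run (PAsg r_c (Const 0)) s; have rk w : w != r_c ->
    rank_of s0 (regs s0 w) = rank_of s (regs s w).
  by move=> wc; rewrite /rank_of /s0 run_asg /= /upd (negPf wc).
have c0 : regs s0 r_c = 0 by [].
move: s0 rk c0 => s0 rk c0.
have dec t : regs (run (PAsg r_c (Sub (Reg r_c) (Const 1))) t) r_c = regs t r_c - 1 by [].
rewrite dec !less_spec // !less_frame // !rk // c0 /cyclic3 add0n.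
move: (rank_of s _) (rank_of s _) (rank_of s _) => i j k; clear.
by case: (ltngtP i j) => ?; case: (ltngtP j k) => ?; case: (ltngtP k i) => ?; lia.
Qed.

Lemma variable_spec line cd s : line != r_nn -> cd != r_nn ->
  regs (run (variable_prog line cd) s) r_nn =
  (regs s line + regs s line).+2 + (regs s cd != 0).
Proof.
move=> lnn cnn; rewrite /variable_prog !runE /= /upd /= (negPf cnn).
by case: (regs s cd == 0); rewrite /= /upd /= addn2 ?addn0.
Qed.

Lemma literal_spec s :
  let s' := run literal_prog s in
  let x := split_literal ((regs s r_a + regs s r_a).+2 + (regs s r_p1 != 0))
    ((regs s r_b + regs s r_b).+2 + (regs s r_p2 != 0)) (regs s r_q1) (regs s r_q2)
    (cyclic3 (rank_of s (regs s r_v)) (rank_of s (regs s r_q2)) (rank_of s (regs s r_q1))) in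
  regs s' r_nn = x.1 /\ regs s' r_np = x.2.
Proof.
rewrite /literal_prog run_if [eval _ _]/= /split_literal.
case: (eqVneq (regs s r_q1) 0) => q1 /=; rewrite run_if [eval _ _]/=;
case: (eqVneq (regs s r_q2) 0) => q2 /=.
- by rewrite !runE.
- rewrite run_seq run_asg /= /upd /=; split=> //.
  by rewrite -[RHS](variable_spec (line := r_a) (cd := r_p1)).
- rewrite run_seq run_asg /= /upd /=; split=> //.
  by rewrite -[RHS](variable_spec (line := r_b) (cd := r_p2)).
rewrite run_seq (run_seq (cyclic_prog _ _ _)) (run_asg r_np) /= /upd /=.
by split=> /=; [rewrite run_frame | rewrite cyclic_spec].
Qed.

(** Intermediate states are introduced by existentials and described by a few frame facts, so that
    simplification does not meet nested runs of programs. *)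
Lemma event_spec s cur :
  regs s r_cn = cur.1 -> regs s r_cp = nat_of_bool cur.2 ->
  let p1 := regs s r_p1 in let n1 := regs s r_n1 in
  let p2 := regs s r_p2 in let n2 := regs s r_n2 in
  let e := vertex_event (rank_of s) (regs s r_a + regs s r_a).+2
    (regs s r_b + regs s r_b).+2 p1 n1 p2 n2 in
  let s' := run event_prog s in
  let step := walk_step cur e in
  [/\ regs s' r_cn = step.1.1, regs s' r_cp = nat_of_bool step.1.2,
      regs s' r_e1 = step.2.1.1 &
      step.2.1.1 != 0 -> regs s' r_e2 = step.2.1.2 /\ regs s' r_ec = nat_of_bool step.2.2].
Proof.
move=> cn cp p1 n1 p2 n2 e s' step.
have [s1 s1E] : exists s1, s1 = run (shares_prog r_p2 r_A r_qA) s by eexists.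
have [s2 s2E] : exists s2, s2 = run (shares_prog r_n2 r_B r_qB) s1 by eexists.
have fr1 r : r \notin writes (shares_prog r_p2 r_A r_qA) -> regs s1 r = regs s r.
  by move=> rN; rewrite s1E run_frame.
have fr2 r : r \notin writes (shares_prog r_n2 r_B r_qB) -> regs s2 r = regs s1 r.
  by move=> rN; rewrite s2E run_frame.
have [A1 qA1] := @shares_spec r_p2 r_A r_qA s isT isT isT isT.
have [B1 qB1] := @shares_spec r_n2 r_B r_qB s1 isT isT isT isT.
rewrite -s1E -/p1 -/n1 -/p2 in A1 qA1; rewrite -s2E !fr1 // -/p1 -/n1 -/n2 in B1 qB1.
have h2 : heap s2 = heap s by rewrite s2E run_heap // s1E run_heap.
have [s3 s3E] : exists s3, s3 = set_reg r_e1 0 s2 by eexists.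
have s'E : s' = run branch_prog s3.
  by rewrite /s' /event_prog run_seq -s1E run_seq -s2E run_seq run_asg [eval _ _]/= -s3E.
have h3 : heap s3 = heap s by rewrite s3E.
have fr3 r : r != r_e1 -> regs s3 r = regs s2 r.
  by move=> re; rewrite s3E /= /upd (negPf re).
have rk c : rank_of s3 c = rank_of s c by rewrite /rank_of h3 fr3 // fr2 // fr1.
have [P1 N1] : regs s3 r_p1 = p1 /\ regs s3 r_n1 = n1 by rewrite !(fr3, fr2, fr1).
have [P2 N2] : regs s3 r_p2 = p2 /\ regs s3 r_n2 = n2 by rewrite !(fr3, fr2, fr1).
have [CN CP] : regs s3 r_cn = cur.1 /\ regs s3 r_cp = nat_of_bool cur.2.
  by rewrite !(fr3, fr2, fr1).
have [RA RB] : regs s3 r_A = shares p1 n1 p2 /\ regs s3 r_B = shares p1 n1 n2.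
  by rewrite !fr3 // B1 fr2.
have QA : shares p1 n1 p2 -> regs s3 r_qA = other p2 p1 n1.
  by move=> sh; rewrite fr3 // fr2 // qA1.
have QB : shares p1 n1 n2 -> regs s3 r_qB = other n2 p1 n1.
  by move=> sh; rewrite fr3 // qB1.
have [aa bb] : regs s3 r_a = regs s r_a /\ regs s3 r_b = regs s r_b.
  by rewrite !(fr3, fr2, fr1).
have e13 : regs s3 r_e1 = 0 by rewrite s3E.
move: s' s'E => s' ->; rewrite {}/step {}/e /vertex_event.
move: s1E s2E s3E fr1 fr2 fr3 A1 B1 qA1 qB1 => _ _ _ _ _ _ _ _ _ _.
rewrite /branch_prog run_if [eval _ _]/= RA.
case: (boolP (shares p1 n1 p2)) => shA /=; rewrite run_if [eval _ _]/= RB.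
  case: (boolP (shares p1 n1 n2)) => shB /=; first by rewrite run_skip; split.
  rewrite /stop_prog 3!(run_seq (PAsg _ _)) 3!run_asg (run_seq literal_prog).
  set s4 := set_reg r_q2 _ _.
  have [] : [/\ regs s4 r_v = p2, regs s4 r_q1 = other p2 p1 n1, regs s4 r_q2 = n2 &
      forall r, r \notin [:: r_v; r_q1; r_q2] -> regs s4 r = regs s3 r].
    rewrite /s4 /= /upd /= P2 N2 QA //; split=> // r.
    by rewrite !inE !negb_or => /and3P[/negPf-> /negPf-> /negPf->].
  have : forall c, rank_of s4 c = rank_of s c by move=> c; rewrite -rk.
  move: s4 => s4 rk4 v4 q14 q24 fr4.
  have [] := literal_spec s4; rewrite v4 q14 q24 !fr4 // P1 P2 aa bb !rk4.
  have := fun r rN => @run_frame literal_prog s4 r rN.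
  move: (run literal_prog s4) => s5 fr5 nn5 np5.
  rewrite !runE /= /upd /= nn5 np5 !fr5 // !fr4 // CN CP.
  split=> // _; split=> //.
  by rewrite -/(dist _ _); case: (cur.2); case: (split_literal _ _ _ _ _).2.
case: (boolP (shares p1 n1 n2)) => shB /=.
  rewrite /start_prog 3!(run_seq (PAsg _ _)) 3!run_asg (run_seq literal_prog).
  set s4 := set_reg r_q2 _ _.
  have [] : [/\ regs s4 r_v = n2, regs s4 r_q1 = other n2 p1 n1, regs s4 r_q2 = p2 &
      forall r, r \notin [:: r_v; r_q1; r_q2] -> regs s4 r = regs s3 r].
    rewrite /s4 /= /upd /= P2 N2 QB //; split=> // r.
    by rewrite !inE !negb_or => /and3P[/negPf-> /negPf-> /negPf->].
  have : forall c, rank_of s4 c = rank_of s c by move=> c; rewrite -rk.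
  move: s4 => s4 rk4 v4 q14 q24 fr4.
  have [] := literal_spec s4; rewrite v4 q14 q24 !fr4 // P1 P2 aa bb !rk4.
  have := fun r rN => @run_frame literal_prog s4 r rN.
  move: (run literal_prog s4) => s5 fr5 nn5 np5.
  by rewrite !runE /= /upd /= nn5 np5 !fr5 // !fr4.
rewrite run_if [eval _ _]/= P1; case: (eqVneq p1 0) => /= p10.
  by rewrite run_skip; split.
rewrite run_if [eval _ _]/= N1; case: (eqVneq n1 0) => /= n10.
  by rewrite run_skip; split.
rewrite run_if [eval _ _]/= P2; case: (eqVneq p2 0) => /= p20.
  by rewrite run_skip; split.
rewrite run_if [eval _ _]/= N2; case: (eqVneq n2 0) => /= n20.
  by rewrite run_skip; split.
rewrite /meet_prog 2!(run_seq (PAsg _ _)) 2!run_asg.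
set s4 := set_reg r_e2 _ _.
have fr4 r : r \notin [:: r_e1; r_e2] -> regs s4 r = regs s3 r.
  by rewrite !inE !negb_or /s4 /= /upd => /andP[/negPf-> /negPf->].
have [e14 e24] : regs s4 r_e1 = 1 /\ regs s4 r_e2 = 1 by [].
have h4 : heap s4 = heap s by [].
move: s4 fr4 e14 e24 h4 => s4 fr4 e14 e24 h4.
have rk4 c : rank_of s4 c = rank_of s c by rewrite -rk /rank_of h4 h3 fr4.
rewrite run_seq (run_seq (PAsg _ _)) (run_seq (cyclic_prog _ _ _)).
have := @cyclic_spec r_p1 r_p2 r_n1 s4 isT isT isT.
have := @run_heap (cyclic_prog r_p1 r_p2 r_n1) s4 isT.
have := fun r rN => @run_frame (cyclic_prog r_p1 r_p2 r_n1) s4 r rN.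
move: (run (cyclic_prog r_p1 r_p2 r_n1) s4) => s5 fr5 h5.
rewrite !fr4 // P1 P2 N1 !rk4 => c5; rewrite (run_asg r_np).
set s6 := set_reg r_np _ s5.
have fr6 r : r != r_np -> regs s6 r = regs s5 r by move=> rn; rewrite /s6 /= /upd (negPf rn).
have h6 : heap s6 = heap s by rewrite /s6 /= h5.
have np6 : regs s6 r_np = cyclic3 (rank_of s p1) (rank_of s p2) (rank_of s n1).
  by rewrite /s6 /= /upd /= c5.
move: s6 fr6 h6 np6 => s6 fr6 h6 np6.
have rk6 c : rank_of s6 c = rank_of s c by rewrite -rk /rank_of h6 h3 fr6 // fr5 // fr4.
have := @cyclic_spec r_p1 r_n2 r_n1 s6 isT isT isT.
have := fun r rN => @run_frame (cyclic_prog r_p1 r_n2 r_n1) s6 r rN.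
move: (run (cyclic_prog r_p1 r_n2 r_n1) s6) => s7 fr7.
rewrite !(fr6, fr5, fr4) // P1 N1 N2 !rk6 => c7.
rewrite run_asg /= /upd /= c7 !fr7 // np6 !fr6 // !fr5 // e14 e24 !fr4 // CN CP.
split=> // _; split=> //; rewrite -/(dist _ _).
by case: (cyclic3 _ _ _); case: (cyclic3 _ _ _).
Qed.

Lemma event_heap s : heap (run event_prog s) = heap s.
Proof. exact: run_heap. Qed.

(** The address of a neighbour in its row serves as its rank: [cyclic3] is unchanged when all ranks
    are shifted by the start of the row. *)
Definition rank_body : prog :=
  PSto (Add (Reg r_rank) (Add (Mem (Reg r_m)) (Const 1))) (Reg r_m).

Definition rank_prog : prog :=
  PAsg r_m (Add (Reg r_nb) (Mem (Add (Const 3) (Reg r_u)))) ;;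
  PAsg r_me (Add (Reg r_nb) (Mem (Add (Const 4) (Reg r_u)))) ;;
  PFor r_m r_me rank_body.

Definition neighbour_prog (p lo hi dp dn : nat) : prog :=
  PIf (Sub (Reg p) (Reg lo)) (PAsg dp (Add (Mem (Sub (Reg p) (Const 1))) (Const 1)))
    (PAsg dp (Const 0)) ;;
  PIf (Sub (Reg hi) (Add (Reg p) (Const 1)))
    (PAsg dn (Add (Mem (Add (Reg p) (Const 1))) (Const 1))) (PAsg dn (Const 0)).

Definition common_prog : prog :=
  rank_prog ;;
  neighbour_prog r_p r_sa r_ea r_p1 r_n1 ;; neighbour_prog r_k r_sb r_eb r_p2 r_n2 ;;
  event_prog ;; merge_prog.

(* The position stored for [r_u] may stem from an earlier line, so it is checked. *)
Definition guard_prog : prog :=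
  PIf (Sub (Add (Reg r_p) (Const 1)) (Reg r_sa))
    (PIf (Sub (Reg r_ea) (Reg r_p))
      (PIf (Dist (Mem (Reg r_p)) (Reg r_u)) PSkip common_prog) PSkip) PSkip.

Definition vertex_prog : prog :=
  PAsg r_u (Mem (Reg r_k)) ;;
  PAsg r_p (at_ r_pos (Reg r_u)) ;;
  guard_prog.

Definition pair_init : prog :=
  PAsg r_sb (Add (Reg r_line) (Mem (Add (Reg r_loff) (Reg r_b)))) ;;
  PAsg r_eb (Add (Reg r_line) (Mem (Add (Add (Reg r_loff) (Reg r_b)) (Const 1)))) ;;
  PAsg r_cn (Const 0) ;; PAsg r_cp (Const 0) ;; PAsg r_k (Reg r_sb).

Definition pair_prog : prog := pair_init ;; PFor r_k r_eb vertex_prog.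

Definition position_body : prog := PSto (Add (Reg r_pos) (Mem (Reg r_k))) (Reg r_k).

Definition line_init : prog :=
  PAsg r_sa (Add (Reg r_line) (Mem (Add (Reg r_loff) (Reg r_a)))) ;;
  PAsg r_ea (Add (Reg r_line) (Mem (Add (Add (Reg r_loff) (Reg r_a)) (Const 1)))) ;;
  PAsg r_k (Reg r_sa).

Definition line_prog : prog :=
  line_init ;;
  PFor r_k r_ea position_body ;;
  PAsg r_b (Add (Reg r_a) (Const 1)) ;;
  PFor r_b r_L pair_prog.

(** The offsets of the rows begin at cell 3 and are one more than the vertices, so the rows begin at
    4 plus their number. The length of the input, kept in [r_pos], is also the size reserved for
    each of the four scratch arrays behind it; it exceeds the number of vertices and is at least the
    number of union-find nodes. *)
Definition setup_prog : prog :=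
  PAsg r_nb (Add (Const 4) (Mem (Const 0))) ;;
  PAsg r_loff (Add (Reg r_nb) (Mem (Add (Const 3) (Mem (Const 0))))) ;;
  PAsg r_L (Mem (Const 2)) ;;
  PAsg r_line (Add (Add (Reg r_loff) (Reg r_L)) (Const 1)) ;;
  PAsg r_pos (Add (Reg r_line) (Mem (Add (Reg r_loff) (Reg r_L)))) ;;
  PAsg r_rank (Add (Reg r_pos) (Reg r_pos)) ;;
  PAsg r_comp (Add (Reg r_rank) (Reg r_pos)) ;;
  PAsg r_par (Add (Reg r_comp) (Reg r_pos)) ;;
  PAsg r_N (Add (Add (Reg r_L) (Reg r_L)) (Const 2)).

Definition singleton_body : prog := PSto (Add (Reg r_comp) (Reg r_i)) (Reg r_i).

Definition body_prog : prog :=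
  setup_prog ;;
  PFor r_i r_N singleton_body ;;
  PFor r_a r_L line_prog ;;
  PAsg r_ans (Sub (Const 1) (Reg r_bad)).

(** Without edges or without lines the time allowed is constant, so these cases are answered before
    the union-find arrays are initialised. *)
Definition main_prog : prog :=
  PIf (Mem (Const 1)) (PIf (Mem (Const 2)) body_prog (PAsg r_ans (Const 1)))
    (PAsg r_ans (Const 1)).

Lemma main_well_formed : well_formed main_prog.
Proof. by vm_compute. Qed.

(** * Correctness and running time of the program *)

Lemma cyclic3_shift k x y z : cyclic3 (k + x) (k + y) (k + z) = cyclic3 x y z.
Proof. by rewrite /cyclic3 !ltn_add2l. Qed.

(** Ranks enter only through cyclic comparisons of actual neighbours, so a common offset cancels and
    the cell of code 0 may hold anything. *)
Lemma vertex_event_shift (k : nat) (rk rk' : nat -> nat) na nb p1 n1 p2 n2 :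
  (forall c, c \in [:: p1; n1; p2; n2] -> c != 0 -> rk' c = k + rk c) ->
  vertex_event rk' na nb p1 n1 p2 n2 = vertex_event rk na nb p1 n1 p2 n2.
Proof.
move=> E; have Ep1 : p1 != 0 -> rk' p1 = k + rk p1 by apply: E; rewrite !inE eqxx.
have En1 : n1 != 0 -> rk' n1 = k + rk n1 by apply: E; rewrite !inE eqxx orbT.
have Ep2 : p2 != 0 -> rk' p2 = k + rk p2 by apply: E; rewrite !inE eqxx !orbT.
have En2 : n2 != 0 -> rk' n2 = k + rk n2 by apply: E; rewrite !inE eqxx !orbT.
have lit v q : (v != 0 -> rk' v = k + rk v) -> (q != 0 -> rk' q = k + rk q) ->
    shares p1 n1 v -> end_literal rk' na nb p1 n1 p2 v q = end_literal rk na nb p1 n1 p2 v q.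
  move=> Ev Eq /andP[v0 _]; rewrite /end_literal /split_literal.
  case: (eqVneq (other v p1 n1) 0) => // o0; case: (eqVneq q 0) => // q0.
  have Eo : rk' (other v p1 n1) = k + rk (other v p1 n1).
    by move: o0; rewrite /other; case: (v == p1).
  by rewrite Ev // Eq // Eo cyclic3_shift.
rewrite /vertex_event; case: (boolP (shares p1 n1 p2)) => sp.
  by case: (boolP (shares p1 n1 n2)) => sn //; rewrite lit.
case: (boolP (shares p1 n1 n2)) => sn; first by rewrite lit.
case: (boolP [&& _, _, _ & _]) => // /and4P[p10 n10 p20 n20].
by rewrite Ep1 // En1 // Ep2 // En2 // !cyclic3_shift.
Qed.

(** This lets the program skip a vertex that is not on the first line. *)
Lemma vertex_event_absent rk na nb p2 n2 : vertex_event rk na nb 0 0 p2 n2 = Idle.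
Proof.
by rewrite /vertex_event /shares; case: (eqVneq p2 0) => // _; case: (eqVneq n2 0).
Qed.

Lemma neighbour_spec p lo hi dp dn l start i s : uniq l -> i < size l ->
  [/\ p != dp, hi != dp, dp != dn & lo != dp] ->
  regs s p = start + i -> regs s lo = start -> regs s hi = start + size l ->
  (forall j, j < size l -> heap s (start + j) = nth 0 l j) ->
  let s' := run (neighbour_prog p lo hi dp dn) s in
  regs s' dp = pcode l (nth 0 l i) /\ regs s' dn = ncode l (nth 0 l i).
Proof.
move=> Ul il [pd hd dd ld] rp rlo rhi hl s'.
rewrite /pcode /ncode mem_nth // index_uniq //= {}/s' /neighbour_prog run_seq.
set s1 := run _ s.
have fr r : r != dp -> regs s1 r = regs s r.
  by move=> rd; rewrite /s1 run_frame //= !inE negb_or rd.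
have h1 : heap s1 = heap s by rewrite /s1 run_heap.
have d1 : regs s1 dp = if 0 < i then (nth 0 l i.-1).+1 else 0.
  rewrite /s1 !runE /= rp rlo addKn; case: i il {rp} => [|i] il /=; first by rewrite /upd eqxx.
  by rewrite /upd eqxx -addnBA // subn1 /= hl ?addn1 // ltnW.
move: s1 fr h1 d1 => s1 fr h1 d1; rewrite !runE /= !fr // rhi rp.
have -> : start + i + 1 = start + i.+1 by rewrite addn1 addnS.
rewrite subnDl subn_eq0 -ltnNge.
by case: ifP => lt; rewrite /= /upd eqxx (negPf dd) d1 // h1 hl ?addn1.
Qed.

Section Memory.

(* [w] is the input: its cells from [3] and [LO] on delimit the rows of [rot] and [ls],
   which are stored from [NB] and [LI] on. *)
Variables (w : nat -> nat) (W NB LO LI N : nat) (rot ls : seq (seq nat)).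

Notation row u := (nth [::] rot u).
Notation line a := (nth [::] ls a).

Definition stored (off data : nat) (ss : seq (seq nat)) : Prop :=
  forall u, u < size ss ->
  [/\ w (off + u) + size (nth [::] ss u) = w (off + u.+1),
      off + u.+1 < W, data + w (off + u.+1) <= W &
      forall k, k < size (nth [::] ss u) -> w (data + w (off + u) + k) = nth 0 (nth [::] ss u) k].

Hypothesis rot_stored : stored 3 NB rot.
Hypothesis ls_stored : stored LO LI ls.
Hypothesis rot_size : size rot < W.
Hypothesis N_small : N <= W.
Hypothesis N_size : N = (size ls + size ls).+2.
Hypothesis rot_uniq : forall r, r \in rot -> uniq r /\ forall v, v \in r -> v < size rot.
Hypothesis ls_uniq : forall l, l \in ls -> uniq l /\ forall u, u \in l ->
  u < size rot /\ forall c, c != 0 -> c = pcode l u \/ c = ncode l u -> c.-1 \in row u.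

Definition consts (s : state) : Prop :=
  [/\ regs s r_nb = NB, regs s r_loff = LO, regs s r_line = LI, regs s r_L = size ls &
   [/\ regs s r_pos = W, regs s r_rank = W + W, regs s r_comp = W + W + W,
       regs s r_par = W + W + W + W & regs s r_N = N]].

Definition input (s : state) : Prop := forall a, a < W -> heap s a = w a.

Definition line_start a := LI + w (LO + a).

Definition positions a (s : state) : Prop :=
  forall i, i < size (line a) -> heap s (W + nth 0 (line a) i) = line_start a + i.

Definition line_a a (s : state) : Prop :=
  [/\ regs s r_a = a, regs s r_sa = line_start a & regs s r_ea = line_start a + size (line a)].

Definition line_b b (s : state) : Prop :=
  [/\ regs s r_b = b, regs s r_sb = line_start b & regs s r_eb = line_start b + size (line b)].

Lemma consts_ext s s' : (forall q, q < 10 -> regs s' q = regs s q) -> consts s -> consts s'.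
Proof. by move=> E [? ? ? ? [? ? ? ? ?]]; split; rewrite ?E //; split; rewrite ?E. Qed.

Lemma consts_run p s : all (leq 10) (writes p) -> consts s -> consts (run p s).
Proof.
move=> /allP wp; apply: consts_ext => q q10; apply: run_frame.
by apply/negP => /wp; rewrite leqNgt q10.
Qed.

Lemma line_read s a k : input s -> a < size ls -> k < size (line a) ->
  heap s (line_start a + k) = nth 0 (line a) k.
Proof.
move=> inp a_s kl; have [E offW dW H] := ls_stored a_s; rewrite -H // inp //.
apply: leq_trans dW; rewrite -E /line_start -!addnA ltn_add2l ltn_add2l //.
Qed.

Lemma rank_spec s u : consts s -> input s -> u < size rot -> regs s r_u = u ->
  let s' := run rank_prog s in
  [/\ forall v, v \in row u -> rank_of s' v.+1 = NB + w (3 + u) + index v (row u),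
      forall x, ~~ (W + W <= x < W + W + W) -> heap s' x = heap s x &
      time rank_prog s <= 40 + 20 * size (row u)].
Proof.
move=> cs inp us ru s'; have [E offW dW H] := rot_stored us.
have [Ur vr] : uniq (row u) /\ forall v, v \in row u -> v < size rot.
  by apply: rot_uniq; rewrite mem_nth.
have [rNB _ _ _ [_ rRK _ _ _]] := cs.
pose s1 := set_reg r_me (NB + w (4 + u)) (set_reg r_m (NB + w (3 + u)) s).
have rs1 : run (PAsg r_me (Add (Reg r_nb) (Mem (Add (Const 4) (Reg r_u)))))
    (run (PAsg r_m (Add (Reg r_nb) (Mem (Add (Const 3) (Reg r_u))))) s) = s1.
  by rewrite !runE /= /upd /= ru rNB !inp //; apply: leq_trans offW; rewrite addnS.
have h1 : heap s1 = heap s by [].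
pose M := NB + w (3 + u).
have m1 : regs s1 r_m = M by [].
have me1 : regs s1 r_me = M + size (row u) by rewrite /M -addnA E addnS.
have rk1 : regs s1 r_rank = W + W by rewrite -rRK.
pose Inv m s' t := [/\ t <= 20 * (m - M),
  forall j, j < m - M -> heap s' (W + W + (nth 0 (row u) j).+1) = M + j &
  forall x, ~~ (W + W <= x < W + W + W) -> heap s' x = heap s x].
move: s1 rs1 h1 m1 me1 rk1 => s1 rs1 h1 m1 me1 rk1.
have MW : M + size (row u) <= W by move: dW; rewrite -E /M addnA.
have [|||t [tE [tN HN HX]]] := @for_rule Inv r_m r_me rank_body s1 isT.
- by rewrite m1 me1 leq_addr.
- by rewrite m1; split=> [|j|x _]; rewrite ?subnn ?h1.
- move=> s2 t; rewrite m1 me1; move Em : (regs s2 r_m) => m /andP[Mm mM] fr [tk Hj Hx].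
  have ms : m - M < size (row u) by rewrite ltn_subLR.
  have mW : m < W by apply: leq_trans mM MW.
  have hm : heap s2 m = nth 0 (row u) (m - M).
    rewrite Hx; last by move: mW; clear; lia.
    by rewrite inp // -(H _ ms) -/M subnKC.
  (* The code, one more than the vertex, still fits into an array of length [W], because
     [size rot < W]. *)
  have vW : (nth 0 (row u) (m - M)).+1 < W.
    by apply: leq_ltn_trans rot_size; apply: vr; apply: mem_nth.
  have rk2 : regs s2 r_rank = W + W by rewrite fr.
  have hb x : heap (run rank_body s2) x =
      if x == W + W + (nth 0 (row u) (m - M)).+1 then m else heap s2 x.
    by rewrite /rank_body run_sto /= /upd rk2 Em hm addn1.
  split.
  + have := time_cost s2 (isT : loop_free rank_body); rewrite [cost _]/= subSn //.
    by move: (time _ _) tk; clear; lia.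
  + move=> j; rewrite subSn // ltnS => jm; rewrite [heap _]/= hb eqn_add2l eqSS.
    case: (ltngtP j (m - M)) jm => // [jm _|-> _]; last by rewrite eqxx subnKC.
    rewrite nth_uniq ?(ltn_trans jm) // ltn_eqF //; exact: Hj.
  move=> x xW; rewrite [heap _]/= hb Hx //.
  by case: eqP => // Ex; move: xW vW; rewrite Ex; clear; lia.
have s'E : s' = run (PFor r_m r_me rank_body) s1.
  by rewrite /s' /rank_prog 2!run_seq rs1.
rewrite me1 addKn -s'E in tN HN HX; split=> //.
- have rk' : regs s' r_rank = W + W by rewrite s'E run_frame.
  move=> v vr'; rewrite /rank_of rk'.
  by have := HN (index v (row u)); rewrite index_mem nth_index // => /(_ vr') ->.
rewrite /rank_prog !time_seq rs1 tE.
have := time_cost s (isT : loop_free (PAsg r_m (Add (Reg r_nb) (Mem (Add (Const 3) (Reg r_u)))))).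
set s2 := run _ s.
have := time_cost s2 (isT : loop_free (PAsg r_me (Add (Reg r_nb) (Mem (Add (Const 4) (Reg r_u)))))).
by rewrite ![cost _]/=; move: (time _ _) (time _ _) tN; clear; lia.
Qed.

Notation C := (W + W + W).
Notation P := (W + W + W + W).

Lemma CP : C + N <= P.
Proof. by rewrite leq_add2l. Qed.

Lemma solved_ext qs s s' : (forall x, C <= x -> heap s' x = heap s x) ->
  regs s' r_bad = regs s r_bad -> solved N C P qs s ->
  solved N C P qs s' /\ potential N C s' = potential N C s.
Proof.
move=> hE bE [wf S].
have co i : comp_of C s i = comp_of C s' i by rewrite /comp_of hE // leq_addr.
have pa i : par_of P s i = par_of P s' i.
  by rewrite /par_of hE //; apply: leq_trans (leq_addr W C) (leq_addr i P).
split; last by rewrite /potential; congr (_ * _); apply: roots_ext => i _.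
split; first by apply: uf_wf_ext wf => i _.
move=> f; rewrite bE; split=> [/S[b0 Sf]|[b0 Sf]].
  by split=> //; apply: uf_sat_ext Sf => i _.
by apply/S; split=> //; apply: uf_sat_ext Sf => i _.
Qed.

Lemma walk_step_bound rk na nb p1 n1 p2 n2 (cur : literal) : 1 < N -> na.+1 < N ->
  nb.+1 < N -> cur.1 < N ->
  let st := walk_step cur (vertex_event rk na nb p1 n1 p2 n2) in
  [/\ st.1.1 < N, st.2.1.1 < N & st.2.1.2 < N].
Proof.
move=> N1 naN nbN cN.
have lit v q : (end_literal rk na nb p1 n1 p2 v q).1 < N.
  rewrite /end_literal /split_literal; case: eqP => _; case: eqP => _ //=.
  - exact: ltnW.
  - by apply: leq_ltn_trans naN; rewrite -addn1 leq_add2l; case: eqP.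
  by apply: leq_ltn_trans nbN; rewrite -addn1 leq_add2l; case: eqP.
have N0 := ltnW N1.
rewrite /vertex_event; case: (shares p1 n1 p2); case: (shares p1 n1 n2);
  rewrite /= ?lit; try by split.
by case: ifP => _; rewrite /=; split.
Qed.

Definition ready a b (cur : literal) qs s : Prop :=
  [/\ consts s, input s, positions a s, line_a a s & line_b b s] /\
  [/\ cur.1 < N, regs s r_cn = cur.1, regs s r_cp = nat_of_bool cur.2 & solved N C P qs s].

Definition event_at a b u : event :=
  vertex_event (ranking rot u) (a + a).+2 (b + b).+2
    (pcode (line a) u) (ncode (line a) u) (pcode (line b) u) (ncode (line b) u).

Section Vertex.

Variables (a b j : nat) (cur : literal) (qs : seq equation) (s : state).
Hypotheses (a_s : a < size ls) (b_s : b < size ls) (jb : j < size (line b)).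
Hypothesis rdy : ready a b cur qs s.
Hypothesis rk : regs s r_k = line_start b + j.

Let u := nth 0 (line b) j.
Let st := walk_step cur (event_at a b u).

Lemma common_spec : u \in line a -> regs s r_u = u ->
  regs s r_p = line_start a + index u (line a) ->
  let s' := run common_prog s in
  ready a b st.1 (rcons qs st.2) s' /\
  time common_prog s + potential N C s' <= 500 + 20 * size (row u) + potential N C s.
Proof.
move=> ua ru rp s'.
have [[cs inp pos [ra rsa rea] [rb rsb reb]] [cN rcn rcp sol]] := rdy.
have [laI lbI] : line a \in ls /\ line b \in ls by rewrite !mem_nth.
have [[Ua codea] [Ub codeb]] := (ls_uniq laI, ls_uniq lbI).
have ub : u \in line b by apply: mem_nth.
have [us pa] := codea _ ua; have [_ pb] := codeb _ ub.
have [H2 X2 T2] := rank_spec cs inp us ru.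
have [s2 s2E] : exists s2, s2 = run rank_prog s by eexists.
rewrite -s2E in H2 X2.
have fr2 r : r \notin writes rank_prog -> regs s2 r = regs s r by rewrite s2E;
  apply: run_frame.
have inp2 : input s2 by move=> x xW; rewrite X2 ?inp //; move: xW; clear; lia.
have pos2 : positions a s2.
  move=> i il; rewrite X2 ?pos //.
  have [vs _] := codea _ (mem_nth 0 il); have := ltn_trans vs rot_size.
  by move: (nth 0 _ i) => v; clear; lia.
have [sol2 pot2] : solved N C P qs s2 /\ potential N C s2 = potential N C s.
  apply: solved_ext => //; last by rewrite fr2.
  by move=> x Cx; rewrite X2 //; move: Cx; clear; lia.
have [s3 s3E] : exists s3, s3 = run (neighbour_prog r_p r_sa r_ea r_p1 r_n1) s2 by eexists.
have [s4 s4E] : exists s4, s4 = run (neighbour_prog r_k r_sb r_eb r_p2 r_n2) s3 by eexists.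
have h3 : heap s3 = heap s2 by rewrite s3E run_heap.
have h4 : heap s4 = heap s2 by rewrite s4E run_heap.
have fr3 r : r \notin [:: r_p1; r_n1] -> regs s3 r = regs s2 r.
  by move=> rN; rewrite s3E run_frame // /= !inE; move: rN;
    rewrite !inE !negb_or => /andP[-> ->].
have fr4 r : r \notin [:: r_p2; r_n2] -> regs s4 r = regs s3 r.
  by move=> rN; rewrite s4E run_frame // /= !inE; move: rN;
    rewrite !inE !negb_or => /andP[-> ->].
have [P1 N1] : regs s4 r_p1 = pcode (line a) u /\ regs s4 r_n1 = ncode (line a) u.
  rewrite !fr4 //; have il : index u (line a) < size (line a) by rewrite index_mem.
  have := @neighbour_spec r_p r_sa r_ea r_p1 r_n1 (line a) (line_start a) (index u (line
    a)) s2 Ua il.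
  rewrite -s3E nth_index // !fr2 //; apply=> //.
  by move=> k kl; apply: line_read.
have [P2 N2] : regs s4 r_p2 = pcode (line b) u /\ regs s4 r_n2 = ncode (line b) u.
  have := @neighbour_spec r_k r_sb r_eb r_p2 r_n2 (line b) (line_start b) j s3 Ub jb.
  rewrite -s4E !fr3 // !fr2 //; apply=> //.
  by move=> k kl; rewrite h3; apply: line_read.
have cn4 : regs s4 r_cn = cur.1 by rewrite fr4 // fr3 // fr2.
have cp4 : regs s4 r_cp = nat_of_bool cur.2 by rewrite fr4 // fr3 // fr2.
have [s5 s5E] : exists s5, s5 = run event_prog s4 by eexists.
have := event_spec cn4 cp4; cbv zeta; rewrite -s5E P1 N1 P2 N2.
have -> : regs s4 r_a = a by rewrite fr4 // fr3 // fr2.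
have -> : regs s4 r_b = b by rewrite fr4 // fr3 // fr2.
have rk4 : regs s4 r_rank = regs s2 r_rank by rewrite fr4 // fr3.
rewrite (@vertex_event_shift (NB + w (3 + u)) (ranking rot u)); last first.
  move=> c cin c0; rewrite /ranking -H2; last first.
    by move: cin; rewrite !inE => /or4P[] /eqP cE;
      [apply: (pa c c0) | apply: (pa c c0) | apply: (pb c c0) | apply: (pb c c0)];
      rewrite -cE; [left | right | left | right].
  by rewrite prednK ?lt0n // /rank_of rk4 h4.
rewrite -/(event_at a b u) -/st; case=> cn5 cp5 e15 eq5.
have fr5 r : r \notin writes event_prog -> regs s5 r = regs s4 r by rewrite s5E;
  apply: run_frame.
have h5 : heap s5 = heap s2 by rewrite s5E event_heap.
have [N_a N_b] : (a + a).+3 < N /\ (b + b).+3 < N.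
  by rewrite N_size; move: a_s b_s; clear; lia.
have N_1 : 1 < N by rewrite N_size.
have [c1N q1N q2N] := walk_step_bound (ranking rot u) (pcode (line a) u)
  (ncode (line a) u) (pcode (line b) u) (ncode (line b) u) N_1 N_a N_b cN.
have cs5 : consts s5.
  by rewrite s5E s4E s3E s2E; do 4!apply: consts_run => //.
have uf5 : uf_regs N C P s5 by case: cs5 => _ _ _ _ [_ _ ? ? ?]; split.
have [sol5 pot5] : solved N C P qs s5 /\ potential N C s5 = potential N C s2.
  by apply: solved_ext => //; [rewrite h5 | rewrite fr5 // fr4 // fr3].
have [|sol6 X6 T6] := merge_prog_spec CP uf5 sol5 e15.
  by move=> q0; have [? ?] := eq5 q0; split.
have s'E : s' = run merge_prog s5.
  by rewrite /s' /common_prog run_seq -s2E run_seq -s3E run_seq -s4E run_seq -s5E.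
rewrite -s'E in sol6 X6 T6.
have fr6 r : r \notin writes merge_prog -> regs s' r = regs s5 r by rewrite s'E;
  apply: run_frame.
have low x : x < C -> heap s' x = heap s2 x.
  move=> xC; rewrite X6 ?h5 //; apply/negP => /andP[le _]; move: xC le; clear; lia.
have frA r : r \in [:: r_a; r_b; r_sa; r_ea; r_sb; r_eb] -> regs s' r = regs s r.
  rewrite !inE => /or4P[/eqP->|/eqP->|/eqP->|/or3P[] /eqP->];
  by rewrite fr6 // fr5 // fr4 // fr3 // fr2.
split.
  split; split.
  - by rewrite s'E; apply: consts_run.
  - by move=> x xW; rewrite low ?inp2 //; move: xW; clear; lia.
  - move=> i il; rewrite low ?pos2 //.
    have [vs _] := codea _ (mem_nth 0 il); have := ltn_trans vs rot_size.
    by move: (nth 0 _ i) => v; clear; lia.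
  - by split; rewrite frA.
  - by split; rewrite frA.
  - by [].
  - by rewrite fr6.
  - by rewrite fr6.
  by [].
(* The 500 is made up of 40 for the ranks beyond their part in the degree, 40 for each of the two
   neighbour programs, 280 for the event and 100 for the merge. *)
have T3 : time (neighbour_prog r_p r_sa r_ea r_p1 r_n1) s2 <= 40.
  by rewrite (leq_trans (time_cost _ _)).
have T4 : time (neighbour_prog r_k r_sb r_eb r_p2 r_n2) s3 <= 40.
  by rewrite (leq_trans (time_cost _ _)).
have T5 : time event_prog s4 <= 280 by rewrite (leq_trans (time_cost _ _)).
rewrite /common_prog time_seq -s2E time_seq -s3E time_seq -s4E time_seq -s5E.
move: T2 T3 T4 T5 T6; rewrite pot5 pot2.
move: (potential N C s') (potential N C s) => p' p.
move: (time rank_prog s) (time (neighbour_prog _ _ _ _ _) s2) (time (neighbour_prog _ _ _ _ _) s3).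
move: (time event_prog s4) (time merge_prog s5) (size _); clear; lia.
Qed.

End Vertex.

Section Vertex.

Variables (a b j : nat) (cur : literal) (qs : seq equation) (s : state).
Hypotheses (a_s : a < size ls) (b_s : b < size ls) (jb : j < size (line b)).
Hypothesis rdy : ready a b cur qs s.
Hypothesis rk : regs s r_k = line_start b + j.

Let u := nth 0 (line b) j.
Let st := walk_step cur (event_at a b u).

Lemma vertex_spec : let s' := run vertex_prog s in
  ready a b st.1 (rcons qs st.2) s' /\
  time vertex_prog s + potential N C s' <= 600 + 20 * size (row u) + potential N C s.
Proof.
move=> s'; have [[cs inp pos [ra rsa rea] [rb rsb reb]] [cN rcn rcp sol]] := rdy.
have [laI lbI] : line a \in ls /\ line b \in ls by rewrite !mem_nth.
have [[Ua codea] [Ub codeb]] := (ls_uniq laI, ls_uniq lbI).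
have ub : u \in line b by apply: mem_nth.
have [us _] := codeb _ ub.
pose p := heap s (W + u).
have hu : heap s (regs s r_k) = u by rewrite rk line_read.
have [s1 s1E] : exists s1, s1 = set_reg r_p p (set_reg r_u u s) by eexists.
have rpos : regs s r_pos = W by case: cs => _ _ _ _ [].
have s1r : run (PAsg r_p (at_ r_pos (Reg r_u))) (run (PAsg r_u (Mem (Reg r_k))) s) = s1.
  by rewrite !runE /= /upd /= hu rpos s1E.
have h1 : heap s1 = heap s by rewrite s1E.
have fr1 r : r \notin [:: r_p; r_u] -> regs s1 r = regs s r.
  by rewrite !inE negb_or s1E /= /upd => /andP[/negPf-> /negPf->].
have p1 : regs s1 r_p = p by rewrite s1E.
have u1 : regs s1 r_u = u by rewrite s1E.
have rdy1 : ready a b cur qs s1.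
  have [sol1 _] : solved N C P qs s1 /\ potential N C s1 = potential N C s.
    by apply: solved_ext => //; rewrite ?h1 ?fr1.
  split; split; rewrite ?fr1 //; try by split; rewrite fr1.
  - by apply: consts_ext cs => q q10; rewrite fr1 // !inE; move: q10; clear; lia.
  - by move=> x xW; rewrite h1 inp.
  by move=> i il; rewrite h1 pos.
have pot1 : potential N C s1 = potential N C s by rewrite /potential /comp_of h1.
have [ra1 rb1] : regs s1 r_sa = line_start a /\ regs s1 r_ea = line_start a + size (line a).
  by rewrite !fr1.
(* Each failing check of the stored position shows that [u] is not on line [a]; the step is then
   idle and its equation void. *)
have skip t : st = (cur, (0, 0, false)) -> s' = s1 -> time vertex_prog s <= t ->
    ready a b st.1 (rcons qs st.2) s' /\
    time vertex_prog s + potential N C s' <= t + potential N C s.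
  move=> -> -> le; rewrite pot1 leq_add2r; split=> //.
  case: rdy1 => R1 [? ? ? sol1]; split=> //; split=> //; exact: solved_void.
have absent : u \notin line a -> st = (cur, (0, 0, false)).
  move=> uNa; rewrite /st /event_at /pcode /ncode (negPf uNa) /=.
  by rewrite vertex_event_absent.
have s'E : s' = run guard_prog s1 by rewrite /s' /vertex_prog run_seq run_seq s1r.
have tE : time vertex_prog s <= 8 + time guard_prog s1.
  rewrite /vertex_prog time_seq time_seq s1r addnA leq_add2r.
  by rewrite -[8]/(3 + 5) leq_add // (leq_trans (time_cost _ _)).
have eG : eval s1 (Sub (Add (Reg r_p) (Const 1)) (Reg r_sa)) = (p + 1) - line_start a.
  by rewrite /= p1 ra1.
have eH : eval s1 (Sub (Reg r_ea) (Reg r_p)) = line_start a + size (line a) - p.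
  by rewrite /= p1 rb1.
have eK : eval s1 (Dist (Mem (Reg r_p)) (Reg r_u)) = dist (heap s p) u.
  by rewrite /= p1 u1 h1.
move: tE s'E; rewrite /guard_prog !run_if !time_if eG eH eK dist_eq0 !subn_eq0 run_skip.
rewrite [expr_cost (Sub _ (Reg r_sa))]/= [expr_cost (Sub _ (Reg r_p))]/=.
rewrite [expr_cost (Dist _ _)]/= (_ : time PSkip s1 = 1) //.
case: (leqP (p + 1) (line_start a)) => [le|lt] /= tE s'E.
  apply: skip => //; last by apply: (leq_trans tE); apply: (@leq_trans 600); rewrite ?leq_addr.
  apply: absent; apply/negP => ua; move: le; rewrite /p.
  have := pos (index u (line a)); rewrite index_mem nth_index // => /(_ ua) ->.
  by rewrite addn1 ltnNge leq_addr.
case: (leqP (line_start a + size (line a)) p) tE s'E => [le|lt'] /= tE s'E.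
  apply: skip => //; last by apply: (leq_trans tE); apply: (@leq_trans 600); rewrite ?leq_addr.
  apply: absent; apply/negP => ua; move: le; rewrite /p.
  have := pos (index u (line a)); rewrite index_mem nth_index // => /(_ ua) ->.
  by rewrite leq_add2l leqNgt index_mem ua.
case: (eqVneq (heap s p) u) tE s'E => [E|NE] /= tE s'E; last first.
  apply: skip => //; last by apply: (leq_trans tE); apply: (@leq_trans 600); rewrite ?leq_addr.
  apply: absent; apply: contra NE => ua; rewrite /p.
  have := pos (index u (line a)); rewrite index_mem nth_index // => /(_ ua) ->.
  by rewrite line_read // ?index_mem // nth_index.
have pl : line_start a <= p by move: lt; rewrite addn1 ltnS.
have il : p - line_start a < size (line a) by rewrite ltn_subLR.
have Eu : nth 0 (line a) (p - line_start a) = u by rewrite -E -(line_read inp a_s il) subnKC.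
have ua : u \in line a by rewrite -Eu mem_nth.
have pE : regs s1 r_p = line_start a + index u (line a).
  by rewrite p1 -Eu index_uniq // subnKC.
have k1 : regs s1 r_k = line_start b + j by rewrite fr1.
have [R T] := common_spec a_s b_s jb rdy1 k1 ua u1 pE.
rewrite -s'E pot1 in R T; split=> //.
move: tE T; rewrite -/u; move: (time _ _) (time _ _) (potential _ _ _) (potential _ _ _).
by move: (size _); clear; lia.
Qed.

End Vertex.

(** [D] bounds a walk along one line: 608 is the 600 of [vertex_spec] and the loop overhead of 8. *)
Variable D : nat.
Hypothesis D_bound : forall l, l \in ls -> \sum_(u <- l) (608 + 20 * size (row u)) <= D.

Notation pot := (potential N C).

Definition ready_line a qs s : Prop :=
  [/\ consts s, input s, positions a s, line_a a s & solved N C P qs s].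

Definition ready_main qs s : Prop := [/\ consts s, input s & solved N C P qs s].

Lemma walk_eqs_rcons cur es e : walk_eqs cur (rcons es e) =
  rcons (walk_eqs cur es) (walk_step (foldl (fun c e => (walk_step c e).1) cur es) e).2.
Proof. by elim: es cur => //= e' es IHes cur; rewrite IHes. Qed.

Lemma pair_spec a b qs s : a < size ls -> b < size ls -> ready_line a qs s ->
  regs s r_b = b ->
  let s' := run pair_prog s in
  ready_line a (qs ++ pair_eqs rot ls a b) s' /\
  time pair_prog s + pot s' <= 40 + D + pot s.
Proof.
move=> a_s b_s [cs inp pos la sol] rb s'.
have lbI : line b \in ls by rewrite mem_nth.
have [Eb offb _ _] := ls_stored b_s; rewrite addnS in Eb offb.
have [_ rlo rli _ _] := cs.
have [s0 s0E] : exists s0, s0 = run pair_init s by eexists.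
have [sb0 eb0 cn0 cp0 k0] : [/\ regs s0 r_sb = line_start b,
    regs s0 r_eb = line_start b + size (line b), regs s0 r_cn = 0,
    regs s0 r_cp = 0 & regs s0 r_k = line_start b].
  rewrite s0E /pair_init !runE /= /upd /= rlo rli rb addn1 !inp //; last exact: ltnW.
  by rewrite /line_start -addnA Eb.
have fr0 r : r \notin writes pair_init -> regs s0 r = regs s r by rewrite s0E;
  apply: run_frame.
have h0 : heap s0 = heap s by rewrite s0E run_heap.
have t0 : time pair_init s <= 30 by rewrite (leq_trans (time_cost _ _)).
have s'E : s' = run (PFor r_k r_eb vertex_prog) s0 by rewrite /s' /pair_prog run_seq -s0E.
(* The walk after [j] vertices of line [b]: its current literal, and below the equations emitted so
   far. *)
pose cur j := foldl (fun c e => (walk_step c e).1) (0, false)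
  (take j [seq event_at a b u | u <- line b]).
pose eqs j := walk_eqs (0, false) (take j [seq event_at a b u | u <- line b]).
pose Inv k s2 t := let j := k - line_start b in
  ready a b (cur j) (qs ++ eqs j) s2 /\
  t + pot s2 <= \sum_(i < j) (608 + 20 * size (row (nth 0 (line b) i))) + pot s.
have [sol0 pot0] : solved N C P qs s0 /\ pot s0 = pot s.
  by apply: solved_ext => //; rewrite ?h0 ?fr0.
have [|||t [tE [R T]]] := @for_rule Inv r_k r_eb vertex_prog s0 isT.
- by rewrite k0 eb0 leq_addr.
- rewrite k0 /Inv subnn /= big_ord0 /cur /eqs take0 /= cats0 pot0; split=> //.
  split; split=> //.
  + by apply: consts_ext cs => q q10; rewrite fr0 // !inE; move: q10; clear; lia.
  + by move=> x xW; rewrite h0 inp.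
  + by move=> i il; rewrite h0 pos.
  + by case: la => ? ? ?; split; rewrite fr0.
  + by split=> //; rewrite fr0.
  by rewrite N_size.
- move=> s2 t; rewrite k0 eb0; move Ek : (regs s2 r_k) => k /andP[lek ltk] fr [R T].
  have js : k - line_start b < size (line b) by rewrite ltn_subLR.
  have Ek' : regs s2 r_k = line_start b + (k - line_start b).
    by rewrite Ek subnKC.
  have [R' T'] := vertex_spec a_s b_s js R Ek'.
  rewrite /Inv subSn //; split; last first.
    rewrite big_ord_recr /=.
    have -> : pot (incr r_k (run vertex_prog s2)) = pot (run vertex_prog s2) by [].
    move: T T'; move: (\sum_(i < _) _) (size (row _)) (time _ _) (pot _) (pot _) (pot _).
    by clear; lia.
  have takeS : take (k - line_start b).+1 [seq event_at a b u | u <- line b] =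
      rcons (take (k - line_start b) [seq event_at a b u | u <- line b])
        (event_at a b (nth 0 (line b) (k - line_start b))).
    by rewrite (take_nth Idle) ?size_map // (nth_map 0).
  have -> : cur (k - line_start b).+1 = (walk_step (cur (k - line_start b))
      (event_at a b (nth 0 (line b) (k - line_start b)))).1.
    by rewrite /cur takeS foldl_rcons.
  have -> : eqs (k - line_start b).+1 = rcons (eqs (k - line_start b))
     (walk_step (cur (k - line_start b))
      (event_at a b (nth 0 (line b) (k - line_start b)))).2.
    by rewrite /eqs takeS walk_eqs_rcons.
  by rewrite -rcons_cat.
rewrite -s'E eb0 /= addKn in R T.
have full : take (size (line b)) [seq event_at a b u | u <- line b] =
    [seq event_at a b u | u <- line b].
  by rewrite take_oversize // size_map.
split.
  case: R => [[cs' inp' pos' la' _] [_ _ _ sol']]; split=> //.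
  by move: sol'; rewrite /eqs full.
rewrite /pair_prog time_seq -s0E tE.
have := D_bound lbI; rewrite (big_nth 0) big_mkord => DB.
have := leq_trans T (leq_add DB (leqnn _)).
by move: t0; move: (time _ _) (pot _) (pot _); clear; lia.
Qed.

Lemma position_spec a s : a < size ls -> consts s -> input s -> line_a a s ->
  regs s r_k = line_start a ->
  let s' := run (PFor r_k r_ea position_body) s in
  [/\ positions a s', forall x, ~~ (W <= x < W + W) -> heap s' x = heap s x &
      time (PFor r_k r_ea position_body) s <= 20 * size (line a) + 4].
Proof.
move=> a_s cs inp [ra rsa rea] rk s'; have laI : line a \in ls by rewrite mem_nth.
have [Ul vl] := ls_uniq laI; have [_ _ _ _ [rpos _ _ _ _]] := cs.
have [Ea offa dW _] := ls_stored a_s.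
have endW : line_start a + size (line a) <= W by rewrite /line_start -addnA Ea.
pose Inv k s2 t := let j := k - line_start a in [/\ t <= 20 * j,
  forall i, i < j -> heap s2 (W + nth 0 (line a) i) = line_start a + i &
  forall x, ~~ (W <= x < W + W) -> heap s2 x = heap s x].
have [|||t [-> [tj Hi Hx]]] := @for_rule Inv r_k r_ea position_body s isT.
- by rewrite rk rea leq_addr.
- by rewrite rk /Inv subnn; split.
- move=> s2 t; rewrite rk rea; move Ek : (regs s2 r_k) => k /andP[lek ltk] fr [tj Hi Hx].
  have js : k - line_start a < size (line a) by rewrite ltn_subLR.
  have kW : k < W by apply: leq_trans ltk endW.
  have hk : heap s2 k = nth 0 (line a) (k - line_start a).
    by rewrite Hx -?(line_read inp a_s js) ?subnKC //; move: kW; clear; lia.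
  have vW : nth 0 (line a) (k - line_start a) < W.
    by have [us _] := vl _ (mem_nth 0 js); apply: ltn_trans rot_size.
  have hb x : heap (run position_body s2) x =
      if x == W + nth 0 (line a) (k - line_start a) then k else heap s2 x.
    by rewrite /position_body run_sto /= /upd fr // rpos Ek hk.
  rewrite /Inv subSn //; split.
  + have : time position_body s2 <= 6 by rewrite (leq_trans (time_cost _ _)).
    by move: (time _ _) tj; clear; lia.
  + move=> i; rewrite ltnS => ij; rewrite [heap _]/= hb eqn_add2l.
    case: (ltngtP i (k - line_start a)) ij => // [ij _|-> _].
      by rewrite nth_uniq ?(ltn_trans ij) // ltn_eqF // Hi.
    by rewrite eqxx subnKC.
  move=> x xW; rewrite [heap _]/= hb Hx //.
  case: eqP => // Ex; move: xW vW; rewrite Ex; move: (nth 0 _ _) => v; clear; lia.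
by move: Hi Hx tj; rewrite rea addKn leq_add2r.
Qed.

(** 48 is the 40 of [pair_spec] and the loop overhead of 8; the term in [size (line a)] pays for
    recording the positions. *)
Lemma line_spec a qs s : a < size ls -> ready_main qs s -> regs s r_a = a ->
  let s' := run line_prog s in
  ready_main (qs ++ line_eqs rot ls a) s' /\
  time line_prog s + pot s' <=
    50 + 20 * size (line a) + (size ls) * (48 + D) + pot s.
Proof.
move=> a_s [cs inp sol] ra s'; have laI : line a \in ls by rewrite mem_nth.
have [Ua vl] := ls_uniq laI.
have [Ea offa _ _] := ls_stored a_s; rewrite addnS in Ea offa.
have [_ rlo rli rL _] := cs.
have [s0 s0E] : exists s0, s0 = run line_init s by eexists.
have [sa0 ea0 k0] : [/\ regs s0 r_sa = line_start a,
    regs s0 r_ea = line_start a + size (line a) &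
    regs s0 r_k = line_start a].
  rewrite s0E /line_init !runE /= /upd /= rlo rli ra addn1 !inp //; last exact: ltnW.
  by rewrite /line_start -addnA Ea.
have fr0 r : r \notin writes line_init -> regs s0 r = regs s r by rewrite s0E;
  apply: run_frame.
have h0 : heap s0 = heap s by rewrite s0E run_heap.
have t0 : time line_init s <= 25 by rewrite (leq_trans (time_cost _ _)).
have cs0 : consts s0 by rewrite s0E; apply: consts_run.
have inp0 : input s0 by move=> x xW; rewrite h0 inp.
have la0 : line_a a s0 by split=> //; rewrite fr0.
have [pos1 X1 T1] := position_spec a_s cs0 inp0 la0 k0.
have [s1 s1E] : exists s1, s1 = run (PFor r_k r_ea position_body) s0 by eexists.
rewrite -s1E in pos1 X1.
have fr1 r : r \notin [:: r_k] -> regs s1 r = regs s0 r.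
  by rewrite s1E; apply: (@run_frame (PFor r_k r_ea position_body)).
have [s2 s2E] : exists s2, s2 = set_reg r_b a.+1 s1 by eexists.
have a1 : regs s1 r_a = a by rewrite fr1 // fr0.
have s2r : run (PAsg r_b (Add (Reg r_a) (Const 1))) s1 = s2.
  by rewrite run_asg /= a1 addn1 s2E.
have fr2 r : r \notin [:: r_b; r_k] -> regs s2 r = regs s0 r.
  by rewrite !inE negb_or s2E /= /upd => /andP[/negPf-> rk]; rewrite fr1 // inE.
have b2 : regs s2 r_b = a.+1 by rewrite s2E.
have L2 : regs s2 r_L = size ls by rewrite fr2 // fr0.
have h2 : heap s2 = heap s1 by rewrite s2E.
have s'E : s' = run (PFor r_b r_L pair_prog) s2.
  by rewrite /s' /line_prog run_seq -s0E run_seq -s1E run_seq s2r.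
have [sol2 pot2] : solved N C P qs s2 /\ pot s2 = pot s.
  apply: solved_ext => //; last by rewrite fr2 // fr0.
  by move=> x xC; rewrite h2 X1 ?h0 //; move: xC; clear; lia.
pose Inv b s3 t :=
  ready_line a (qs ++ flatten [seq pair_eqs rot ls a b' | b' <- iota a.+1 (b - a.+1)]) s3 /\
  t + pot s3 <= (b - a.+1) * (48 + D) + pot s.
have [|||t [tE [R T]]] := @for_rule Inv r_b r_L pair_prog s2 isT.
- by rewrite b2 L2.
- rewrite b2 /Inv subnn /= cats0 pot2; split=> //; split=> //.
  + by apply: consts_ext cs0 => q q10; rewrite fr2 // !inE; move: q10; clear; lia.
  + by move=> x xW; rewrite h2 X1 ?inp0 //; move: xW; clear; lia.
  + by move=> i il; rewrite h2 pos1.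
  by case: la0 => ? ? ?; split; rewrite fr2.
- move=> s3 t; rewrite b2 L2; move Eb : (regs s3 r_b) => b /andP[ab bL] fr [R T].
  have [R' T'] := pair_spec a_s bL R Eb.
  rewrite /Inv subSn //; split; last first.
    have -> : pot (incr r_b (run pair_prog s3)) = pot (run pair_prog s3) by [].
    move: T T'; rewrite mulSn; move: (_ * _) (time _ _) (pot _) (pot _) (pot _).
    by clear; lia.
  rewrite -(addn1 (b - a.+1)) iotaD map_cat flatten_cat catA /= cats0 subnKC //.
rewrite -s'E L2 in R T.
split; first by case: R => cs' inp' pos' la' sol'; split.
rewrite /line_prog time_seq -s0E time_seq -s1E time_seq s2r tE.
have : time (PAsg r_b (Add (Reg r_a) (Const 1))) s1 <= 4
  by rewrite (leq_trans (time_cost _ _)).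
have : (size ls - a.+1) * (48 + D) <= size ls * (48 + D) by rewrite leq_mul2r leq_subr orbT.
move: T T1 t0; rewrite -/(pot s') -/(pot s).
move: ((size ls - a.+1) * (48 + D)) (size ls * (48 + D)) (20 * size (line a)).
move: (time line_init s) (time (PFor _ _ _) s0) (time (PAsg _ _) s1) (pot s') (pot s).
by clear; lia.
Qed.

Hypothesis NB_def : NB = 4 + w 0.
Hypothesis LO_def : LO = NB + w (3 + w 0).
Hypothesis LI_def : LI = LO + size ls + 1.
Hypothesis W_def : W = LI + w (LO + size ls).
Hypothesis w2 : w 2 = size ls.
Hypothesis w_zero : forall a, W <= a -> w a = 0.

Let s0 := State (fun=> 0) w.

Lemma setup_spec : let s1 := run setup_prog s0 in
  [/\ consts s1, heap s1 = w & time setup_prog s0 <= 60].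
Proof.
split; last by rewrite (leq_trans (time_cost _ _)).
  rewrite /setup_prog !runE /= /upd /= w2 -NB_def -LO_def -LI_def -W_def.
  by split=> //; split=> //; rewrite /= N_size addn2.
by rewrite run_heap.
Qed.

Lemma singletons_spec s : consts s -> heap s = w -> regs s r_i = 0 ->
  regs s r_bad = 0 ->
  let s' := run (PFor r_i r_N singleton_body) s in
  [/\ ready_main [::] s',
      time (PFor r_i r_N singleton_body) s <= 20 * N + 4 & pot s' <= (60 * N + 4) * N].
Proof.
move=> cs hs ri rbad s'; have [_ _ _ _ [_ _ rC _ rN]] := cs.
pose Inv i s2 t := [/\ t <= 20 * i, forall j, j < i -> heap s2 (C + j) = j &
  forall x, ~~ (C <= x < C + N) -> heap s2 x = w x].
have [|||t [-> [tN Hj Hx]]] := @for_rule Inv r_i r_N singleton_body s isT.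
- by rewrite ri.
- by rewrite ri; split=> // x _; rewrite hs.
- move=> s2 t; rewrite ri rN; move Ei : (regs s2 r_i) => i /andP[_ iN] fr [ti Hj Hx].
  have hb x : heap (run singleton_body s2) x = if x == C + i then i else heap s2 x.
    by rewrite /singleton_body run_sto /= /upd fr // rC Ei.
  split.
  + have : time singleton_body s2 <= 6 by rewrite (leq_trans (time_cost _ _)).
    by move: (time _ _) ti; clear; lia.
  + move=> j; rewrite ltnS leq_eqVlt [heap _]/= hb eqn_add2l.
    by case: (eqVneq j i) => //= _; apply: Hj.
  move=> x xC; rewrite [heap _]/= hb Hx //.
  by case: eqP => // Ex; move: xC iN; rewrite Ex; clear; lia.
rewrite rN in tN Hj Hx; split; last 2 first.
- by rewrite leq_add2r.
- by rewrite /potential leq_mul2l /roots (leq_trans (count_size _ _)) ?size_iota ?orbT.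
have par0 i : i < N -> par_of P s' i = 0.
  move=> iN; rewrite /par_of; have CP' := CP.
  rewrite Hx ?w_zero //; first by rewrite -!addnA leq_addr.
  by move: CP'; clear; lia.
have comp0 i : i < N -> comp_of C s' i = i by move=> iN; rewrite /comp_of Hj.
split.
- by apply: consts_run.
- by move=> x xW; rewrite Hx //; move: xW; clear; lia.
split=> [i iN|f].
  by rewrite comp0 // comp0 // par0.
split=> // _; split; first by rewrite run_frame.
by move=> i iN; rewrite comp0 // par0 // addbF.
Qed.

Notation size_bound := (20 * N + N * (60 * N + 4) + size ls * (58 + D + size ls * (48 + D)) + 100).

(** 58 is the 50 of [line_spec] and the loop overhead of 8. The initial potential, at most
    [(60 * N + 4) * N], pays for all merging passes together. *)
Lemma body_spec : let s' := run body_prog s0 in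
  (regs s' r_ans != 0 <-> satisfiable (all_eqs rot ls)) /\
  time body_prog s0 <= size_bound.
Proof.
move=> s'; have [cs1 h1 t1] := setup_spec.
have [s1 s1E] : exists s1, s1 = run setup_prog s0 by eexists.
rewrite -s1E in cs1 h1.
have fr1 r : r \notin writes setup_prog -> regs s1 r = 0.
  by move=> rN; rewrite s1E run_frame.
have [s2 s2E] : exists s2, s2 = run (PFor r_i r_N singleton_body) s1 by eexists.
have [R2 t2 p2] := singletons_spec cs1 h1 (fr1 r_i isT) (fr1 r_bad isT).
rewrite -s2E in R2 p2.
have a2 : regs s2 r_a = 0 by rewrite s2E run_frame // fr1.
have L2 : regs s2 r_L = size ls by case: R2 => -[].
pose Inv a s3 t :=
  ready_main (flatten [seq line_eqs rot ls a' | a' <- iota 0 a]) s3 /\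
  t + pot s3 <= a * (58 + D + size ls * (48 + D)) + pot s2.
have [|||t [tE [R T]]] := @for_rule Inv r_a r_L line_prog s2 isT.
- by rewrite a2.
- by rewrite a2; split.
- move=> s3 t; rewrite a2 L2; move Ea : (regs s3 r_a) => a /andP[_ aL] fr [R T].
  have [R' T'] := line_spec aL R Ea.
  split; last first.
    have -> : pot (incr r_a (run line_prog s3)) = pot (run line_prog s3) by [].
    (* Recording the positions of a line costs no more than the bound for walking along it. *)
    have la : 20 * size (line a) <= D.
      apply: leq_trans (D_bound (mem_nth [::] aL)).
      have -> : 20 * size (line a) = \sum_(u <- line a) 20.
        by rewrite big_const_seq count_predT iter_addn_0.
      by apply: leq_sum => u _; apply: leq_trans (isT : 20 <= 608) (leq_addr _ _).
    rewrite mulSn; move: T T' la.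
    move: (_ * (48 + D)) (20 * _) (a * _) (time _ _) (pot _) (pot _) (pot _).
    by clear; lia.
  rewrite -addn1 iotaD map_cat flatten_cat /= cats0 //.
rewrite L2 in R T; have [s3 s3E] : exists s3, s3 = run (PFor r_a r_L line_prog) s2 by eexists.
rewrite -s3E in R T; have [_ _ [wf S]] := R.
have s'E : s' = set_reg r_ans (1 - regs s3 r_bad) s3.
  by rewrite /s' /body_prog run_seq -s1E run_seq -s2E run_seq -s3E run_asg.
split; last first.
  rewrite /body_prog time_seq -s1E time_seq -s2E time_seq -s3E tE.
  have : time (PAsg r_ans (Sub (Const 1) (Reg r_bad))) s3 <= 4.
    by rewrite (leq_trans (time_cost _ _)).
  move: t1 t2 p2 T; rewrite (mulnC N).
  move: (size ls * (58 + D + _)) ((60 * N + 4) * N) (time (PAsg _ _) s3) (20 * N).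
  move: (time setup_prog s0) (time (PFor _ _ _) s1) (pot s2) (pot s3).
  by clear; lia.
rewrite s'E regs_set_reg eqxx -/(all_eqs rot ls) in S *.
have bad : (1 - regs s3 r_bad != 0) <-> regs s3 r_bad = 0.
  by case: (regs s3 r_bad) => [|k] //; split.
rewrite bad; split=> [b0|[f [_ /S[]]] //].
have N1 : 1 < N by rewrite N_size.
have [f [f1 fS]] := uf_sat_consistent N1 wf.
by exists f; split=> //; apply/S.
Qed.

Lemma main_spec : 0 < w 1 -> 0 < w 2 -> let s' := run main_prog s0 in
  (regs s' r_ans != 0 <-> satisfiable (all_eqs rot ls)) /\
  time main_prog s0 <= size_bound + 10.
Proof.
rewrite !lt0n => w1 w2'; have [H T] := body_spec.
rewrite /main_prog !run_if !time_if /= w1 w2' /=; split=> //.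
apply: (@leq_trans (time body_prog s0 + 10)); last by rewrite leq_add2r.
by move: (time _ _); clear; lia.
Qed.

Lemma main_trivial : w 1 = 0 \/ w 2 = 0 -> let s' := run main_prog s0 in
  regs s' r_ans != 0 /\ time main_prog s0 <= 20.
Proof.
have T : time (PAsg r_ans (Const 1)) s0 <= 2 by rewrite (leq_trans (time_cost _ _)).
move=> w0'; rewrite /main_prog run_if time_if /=.
case: (eqVneq (w 1) 0) w0' => /= [_ _|w1 [E|w20]].
- by rewrite run_asg; split=> //; move: (time _ _) T; clear; lia.
- by rewrite E in w1.
rewrite run_if time_if /= w20 /= run_asg; split=> //.
Qed.

End Memory.

(** * Encoded instances *)

Lemma size_csr ss : size (csr ss) = (size ss + sumn (shape ss)).+1.
Proof. by rewrite /csr /= size_cat size_scanl size_map size_flatten. Qed.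

Lemma nth_scanl_addn c d u : u < size d ->
  nth 0 (scanl addn c d) u = c + sumn (take u.+1 d).
Proof.
elim: d c u => //= x d IHd c [|u] ud; first by rewrite take0 /= addn0.
by rewrite /= (IHd _ _ ud) addnA.
Qed.

Lemma nth_csr_offset ss u : u <= size ss -> nth 0 (csr ss) u = sumn (take u (shape ss)).
Proof.
case: u => [|u] us; first by rewrite take0.
rewrite /csr /= nth_cat size_scanl size_map us.
by rewrite nth_scanl_addn ?size_map.
Qed.

Lemma nth_csr_row ss u k : u < size ss -> k < size (nth [::] ss u) ->
  nth 0 (csr ss) ((size ss).+1 + sumn (take u (shape ss)) + k) = nth 0 (nth [::] ss u) k.
Proof.
move=> us ks; rewrite /csr addSn addSn /= nth_cat size_scanl size_map -addnA.
rewrite ltnNge leq_addr /= addKn; elim: ss u us ks => //= s t IHt [|u] us ks.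
  by rewrite take0 /= add0n nth_cat ks.
by rewrite /= nth_cat -addnA ltnNge leq_addr /= addKn IHt.
Qed.

(** Stated with arbitrary surroundings so that it serves both tables of the input word. *)
Lemma csr_stored (word pre post : seq nat) ss : word = pre ++ csr ss ++ post ->
  stored (nth 0 word) (size word) (size pre) (size pre + (size ss).+1) ss.
Proof.
move=> ->; have nthE i : i < size (csr ss) ->
    nth 0 (pre ++ csr ss ++ post) (size pre + i) = nth 0 (csr ss) i.
  move=> ic; rewrite nth_cat ifF; last by rewrite ltnNge leq_addr.
  by rewrite addKn nth_cat ic.
have takeS u : u < size ss -> sumn (take u (shape ss)) + size (nth [::] ss u) =
    sumn (take u.+1 (shape ss)).
  move=> us; rewrite (take_nth 0) ?size_map // sumn_rcons.
  by rewrite (nth_map [::]).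
have le_total u : sumn (take u (shape ss)) <= sumn (shape ss).
  by rewrite -{2}(cat_take_drop u (shape ss)) sumn_cat leq_addr.
move=> u us; have u1 : u.+1 < size (csr ss) by rewrite size_csr ltnS ltn_addr // ltnW.
rewrite !nthE //; last exact: ltnW.
rewrite !nth_csr_offset //; last exact: ltnW.
split.
- exact: takeS.
- by rewrite !size_cat ltn_add2l ltn_addr.
- rewrite -addnA size_cat leq_add2l size_cat; apply: leq_trans (leq_addr _ _).
  by rewrite size_csr addSn ltnS leq_add2l.
move=> k ks; rewrite -!addnA nthE; first by rewrite -nth_csr_row // !addnA.
rewrite size_csr addSn ltnS ltn_add2l.
by apply: leq_trans (le_total u.+1); rewrite -takeS // ltn_add2l.
Qed.

Section Instance.

Variable I : instance.

Notation V := 'I_(nV I).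
Notation line := (seq V).
Notation rot := (rotation_lists I).
Notation ls := (line_lists I).

Lemma size_rot : size rot = nV I.
Proof. by rewrite size_map size_enum_ord. Qed.

Lemma row_rot (u : V) : nth [::] rot (val u) = map val (nbrs u).
Proof.
by rewrite /rotation_lists (nth_map u) ?size_enum_ord ?ltn_ord // ?nth_ord_enum.
Qed.

Lemma rotation_lists_uniq r : r \in rot -> uniq r /\ forall v, v \in r -> v < size rot.
Proof.
case/mapP=> u _ ->; split; first by rewrite (map_inj_uniq val_inj) nbrs_uniq.
by move=> v /mapP[v' _ ->]; rewrite size_rot; apply: ltn_ord.
Qed.

Lemma line_lists_uniq l : l \in ls -> uniq l /\ forall u, u \in l ->
  u < size rot /\ forall c, c != 0 -> c = pcode l u \/ c = ncode l u ->
  c.-1 \in nth [::] rot u.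
Proof.
case/mapP=> m mI ->; have Um := line_uniq mI; split; first by rewrite (map_inj_uniq val_inj).
move=> _ /mapP[u um ->]; rewrite size_rot ltn_ord; split=> // c c0 cE.
have [v E] : exists v : V, c = code v.
  by case: cE c0 => ->; [apply: pc_decode | apply: nc_decode].
have uv : uses_edge u v m.
  by rewrite uses_edge_code // -E /pc /nc; case: cE => ->; rewrite eqxx ?orbT.
by rewrite row_rot E; apply: (map_f val (uses_edge_adj mI uv)).
Qed.

(** Handshaking: every dart goes up or down, and reversal maps the latter injectively into the
    former, which are the edges counted by [nE]. *)
Lemma sum_degrees : \sum_(u : V) size (nbrs u) <= 2 * nE I.
Proof.
have [nU irr sym] := nbrs_rotation I.
pose A := [set e : V * V | adj (@nbrs I) e.1 e.2 && (e.1 < e.2)].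
pose B := [set e : V * V | adj (@nbrs I) e.1 e.2 && (e.2 < e.1)].
have cardB : #|B| <= #|A|.
  pose swap (e : V * V) := (e.2, e.1).
  have swapK : cancel swap swap by case.
  rewrite -(card_imset (mem B) (can_inj swapK)).
  apply/subset_leq_card/subsetP => _ /imsetP[[u v] + ->].
  by rewrite !inE /= sym.
have -> : \sum_(u : V) size (nbrs u) = #|[set e : V * V | adj (@nbrs I) e.1 e.2]|.
  rewrite -sum1dep_card -(pair_big_dep predT (adj (@nbrs I)) (fun _ _ => 1)) /=.
  by apply: eq_bigr => u _; rewrite sum1_card; apply/esym/card_uniqP.
rewrite mulSn mul1n -[nE I]/#|A|; apply: leq_trans (leq_add (leqnn _) cardB).
rewrite -cardsUI; apply: leq_trans (leq_addr _ _).
apply/subset_leq_card/subsetP => -[u v]; rewrite !inE /= => uv; rewrite uv /=.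
rewrite -neq_ltn; apply: contraTneq uv => /val_inj ->.
by rewrite irr.
Qed.

(** A line visits a vertex at most once, so its degrees sum to at most [2 * nE I]. On a line with an
    edge all these degrees are positive, which bounds its length in the same way; a one-vertex line
    needs [0 < nE I]. The constant is 2 * 608 + 2 * 20. *)
Lemma line_degrees l : l \in ls -> 0 < nE I ->
  \sum_(u <- l) (608 + 20 * size (nth [::] rot u)) <= 1256 * nE I.
Proof.
move=> lI E0; have [Ul vl] := line_lists_uniq lI; case/mapP: lI Ul vl => m mI -> Um vm.
have le_deg : \sum_(u <- m) size (nbrs u) <= 2 * nE I.
  apply: leq_trans sum_degrees; rewrite -big_enum /=.
  rewrite big_uniq ?line_uniq //= big_enum /= [leqRHS](bigID (mem m)) /=.
  exact: leq_addr.
have size_deg : size m <= 2 * nE I.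
  case: (leqP (size m) 1) => [m1|m2]; first by apply: leq_trans m1 _; lia.
  apply: leq_trans le_deg; rewrite -sum1_size big_seq [leqRHS]big_seq.
  apply: leq_sum => u um; have Um' := line_uniq mI.
  have : (pc m u != 0) || (nc m u != 0).
    rewrite pcE ncE um /=; by case: (posnP (index u m)) => [->|] //=; rewrite m2.
  have port c : c != 0 -> c = pc m u \/ c = nc m u -> 0 < size (nbrs u).
    move=> c0 cE; have [v E] : exists v : V, c = code v.
      by case: cE c0 => ->; [apply: pc_decode | apply: nc_decode].
    have vu : v \in nbrs u.
      apply: (uses_edge_adj mI); rewrite uses_edge_code // -E.
      by case: cE => ->; rewrite eqxx ?orbT.
    by case: (nbrs u) vu.
  by case/orP=> c0; apply: port c0 _; [left | right].
rewrite big_map.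
have -> : \sum_(u <- m) (608 + 20 * size (nth [::] rot (val u))) =
    608 * size m + 20 * \sum_(u <- m) size (nbrs u).
  rewrite big_split /= big_const_seq count_predT iter_addn_0 big_distrr /=.
  by congr (_ + _); apply: eq_bigr => u _; rewrite row_rot size_map.
by move: le_deg size_deg; move: (\sum_(u <- m) _) (size m); clear; lia.
Qed.

(** No line uses an edge, so empty orders form a layout. *)
Lemma trivial_layout : nE I = 0 \/ nL I = 0 -> has_crossing_free_periphery_layout I.
Proof.
move=> EL; have none (u v : V) : v \in nbrs u -> edge_lines u v = [::].
  case: EL => [E0|L0] vu; last first.
    by rewrite /edge_lines (size0nil L0).
  have [_ irr sym] := nbrs_rotation I.
  have uv : val u != val v by apply: contraTneq vu => /val_inj ->; rewrite -/(adj _ _ _) irr.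
  suff : 0 < nE I by rewrite E0.
  apply/card_gt0P; move: uv; rewrite neq_ltn => /orP[uv|vu'].
    by exists (u, v); rewrite inE /= uv andbT.
  by exists (v, u); rewrite inE /= vu' andbT sym.
pose pi (u v : V) : seq line := [::].
have no_order u : vertex_order pi u = [::].
  by rewrite /vertex_order /pi; elim: (nbrs u).
have no_crossing u l m : ~ vertex_crossing pi u l m.
  by case=> _ [k]; rewrite no_order.
exists pi; split; last by move=> u v _; exists [::], [::], [::].
split=> //; split=> [u v vu|u l m]; first by rewrite none.
by move/no_crossing.
Qed.

Lemma decide_spec : exists t, let s := run main_prog (input_state (encode I)) in
  [/\ time main_prog (input_state (encode I)) = t, t <= 4000 * (nE I * nL I ^ 2).+1 &
      regs s 0 != 0 <-> has_crossing_free_periphery_layout I].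
Proof.
exists (time main_prog (input_state (encode I))); rewrite /input_state.
set word := encode I; set w := nth 0 word.
have w0 : w 0 = nV I by [].
have w1 : w 1 = nE I by [].
have w2 : w 2 = nL I by [].
case: (posnP (nE I)) => [E0|E0].
  have [r0 T] := main_trivial (or_introl (etrans w1 E0)).
  split=> //; first by apply: leq_trans T _; rewrite -[20]/(20 * 1) leq_mul.
  by split=> // _; apply: trivial_layout; left.
case: (posnP (nL I)) => [L0|L0].
  have [r0 T] := main_trivial (or_intror (etrans w2 L0)).
  split=> //; first by apply: leq_trans T _; rewrite -[20]/(20 * 1) leq_mul.
  by split=> // _; apply: trivial_layout; right.
have szls : size ls = nL I by rewrite size_map.
pose pre := [:: nV I; nE I; nL I] ++ csr rot.
have wordE : word = [:: nV I; nE I; nL I] ++ csr rot ++ csr ls by [].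
have wordE' : word = pre ++ csr ls ++ [::] by rewrite cats0 /pre -catA.
have S1 := csr_stored wordE; have S2 := csr_stored wordE'.
have size_pre : size pre = 3 + size (csr rot) by rewrite size_cat.
have size_word : size word = size pre + size (csr ls) by rewrite wordE' cats0 size_cat.
have wrot : w (3 + nV I) = sumn (shape rot).
  rewrite /w wordE nth_cat ltnNge leq_addr addKn nth_cat size_csr size_rot ltnS leq_addr.
  by rewrite nth_csr_offset ?size_rot // take_oversize // size_map size_rot.
have wls : w (size pre + size ls) = sumn (shape ls).
  rewrite /w wordE' cats0 nth_cat ifF; last by rewrite ltnNge leq_addr.
  by rewrite addKn nth_csr_offset // take_oversize // size_map.
have total : nL I <= sumn (shape ls).
  rewrite -szls -sum1_size sumnE [leqRHS]big_map big_seq [leqRHS]big_seq.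
  apply: leq_sum => l.
  by case/mapP=> m /lines_simple/and3P[m0 _ _] ->; rewrite size_map lt0n size_eq0.
have le_pre : 4 + size rot <= size pre by rewrite size_pre size_csr; lia.
have szcsr := size_csr ls.
have [r0 T] : (regs (run main_prog (State (fun=> 0) w)) 0 != 0 <->
      satisfiable (all_eqs rot ls)) /\
    time main_prog (State (fun=> 0) w) <= 20 * (nL I + nL I).+2 +
      (nL I + nL I).+2 * (60 * (nL I + nL I).+2 + 4) +
      nL I * (58 + 1256 * nE I + nL I * (48 + 1256 * nE I)) + 100 + 10.
  rewrite -szls; apply: (main_spec S1 S2) => //.
  - by rewrite size_word; lia.
  - by rewrite size_word; lia.
  - exact: rotation_lists_uniq.
  - exact: line_lists_uniq.
  - by move=> l lI; apply: line_degrees.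
  - by rewrite -/w w0 size_rot.
  - by rewrite -/w w0 wrot size_pre size_csr size_rot /=; lia.
  - by rewrite addnS addn1.
  - by rewrite -/w wls size_word szcsr; lia.
  - by move=> a; apply: nth_default.
split=> //; last first.
  by rewrite r0 satisfiable_solution layout_iff_solution.
apply: leq_trans T _; move: (nE I) (nL I) E0 L0 => E L E0 L0.
(* These inequalities reduce every term to [E * L ^ 2]. Its coefficient becomes 2512 + 288 + 586 =
   3386, and the constant is 398, both below 4000. *)
have X1 : E * L <= E * L ^ 2 by rewrite leq_mul2l -{1}[L]expn1 leq_pexp2l ?orbT.
have X2 : L ^ 2 <= E * L ^ 2 by apply: leq_pmull.
have X3 : L <= L ^ 2 by rewrite -{1}[L]expn1 leq_pexp2l.
by rewrite -mulnn in X1 X2 X3 *; clear -E0 L0 X1 X2 X3; nia.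
Qed.

End Instance.

Theorem theorem3 :
  decidable_in_time (fun I : instance => nE I * nL I ^ 2)
    (fun I : instance => has_crossing_free_periphery_layout I).
Proof.
exists (compile main_prog), 4000 => I; have [t [<- T ans]] := decide_spec I.
exists (run main_prog (input_state (encode I))).
exists (time main_prog (input_state (encode I))); split=> //.
exact/exec_compile/main_well_formed.
Qed.
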